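(* Let $B(y)=\sum_{n\ge0}b_ny^n$ be the generating series of 2-connected tree-rooted maps counted by edges, and $\rho_B=\frac{4(3\pi-8)^2}{9\pi^2}$ its radius of convergence. For $u\geq 0$, the equation $$\frac{2yuB'(y)}{uB(y)+1-u}=1$$ has a unique solution $y$ in $[0,\rho_B]$ if and only if $u\geq u_C$, where $$u_C:=\frac{9 \pi (4-\pi )}{ 420 \pi - 81 \pi^{2}- 512}\simeq 3.02.$$
   Context: A map is a connected planar finite multigraph (loops and multiple edges allowed) properly embedded in the sphere, up to homeomorphism, rooted at a distinguished half-edge. A map is separable if its edge set can be partitioned into two non-empty subsets $E_1,E_2$ such that exactly one vertex is incident both to an element of $E_1$ and to an element of $E_2$; otherwise it is 2-connected (so the vertex map, the single loop and the single non-loop edge are 2-connected). A tree-rooted map is a map endowed with a spanning tree; it is 2-connected if the underlying map is. $b_n$ is the number of 2-connected tree-rooted maps with $n$ edges, $b_0=1$. The values $B(\rho_B)$ and $B'(\rho_B)$ are the (finite) sums $\sum b_n\rho_B^n$ and $\sum nb_n\rho_B^{n-1}$. *)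

(* Defs.v *)
From HB Require Import structures.
From mathcomp Require Import all_boot perm.

Set Implicit Arguments.
Unset Strict Implicit.
Unset Printing Implicit Defensive.

(* A map on an oriented sphere is encoded by its rotation system on the set D
   of half-edges: [edge_perm] swaps the two halves of each edge and
   [vertex_perm] turns around each vertex. *)
Record rotation_system (D : finType) := RotationSystem {
  edge_perm : {perm D};
  vertex_perm : {perm D};
  root : D }.

Section RotationSystem.
Variable D : finType.

Definition tuple_of_rotation_system (m : rotation_system D) :=
  (edge_perm m, vertex_perm m, root m).
Definition rotation_system_of_tuple (t : {perm D} * {perm D} * D) :=
  RotationSystem t.1.1 t.1.2 t.2.
Lemma tuple_of_rotation_systemK :
  cancel tuple_of_rotation_system rotation_system_of_tuple.
Proof. by case. Qed.

HB.instance Definition _ :=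
  Countable.copy (rotation_system D) (can_type tuple_of_rotation_systemK).
HB.instance Definition _ : isFinite (rotation_system D) :=
  CanIsFinite tuple_of_rotation_systemK.

Variable m : rotation_system D.

Definition edge_of (d : D) : {set D} := porbit (edge_perm m) d.
Definition vertex_of (d : D) : {set D} := porbit (vertex_perm m) d.

Definition edges : {set {set D}} := porbits (edge_perm m).
Definition vertices : {set {set D}} := porbits (vertex_perm m).
Definition faces : {set {set D}} := porbits (vertex_perm m * edge_perm m)%g.

(* The vertices [v] and [w] are joined by an edge of [E]. *)
Definition adjacent (E : {set {set D}}) : rel {set D} := fun v w =>
  [exists d, [&& edge_of d \in E,
                 vertex_of d == v & vertex_of (edge_perm m d) == w]].

(* The subgraph formed by all the vertices and the edges of [E] is connected. *)
Definition connected_by (E : {set {set D}}) : bool :=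
  [forall v in vertices, forall w in vertices, connect (adjacent E) v w].

(* Planarity is Euler's formula. *)
Definition planar_map : bool :=
  [&& [forall d, (edge_perm m d != d) && (edge_perm m (edge_perm m d) == d)],
      connected_by edges
    & #|vertices| + #|faces| == #|edges| + 2].

Definition incident (v : {set D}) (E : {set {set D}}) : bool :=
  [exists e in E, ~~ [disjoint v & e]].

Definition separable : bool :=
  [exists E1 : {set {set D}}, exists E2 : {set {set D}},
    [&& E1 != set0, E2 != set0, E1 :|: E2 == edges, [disjoint E1 & E2]
      & #|[set v in vertices | incident v E1 && incident v E2]| == 1]].

(* A simple cycle is given by the half-edges leaving its successive vertices;
   it has length 1 when it is a loop, and length 2 when it consists of two
   parallel edges. *)
Definition simple_cycle (E : {set {set D}}) (c : seq D) : bool :=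
  [&& c != [::],
      all (fun d => edge_of d \in E) c,
      cycle (fun d d' => vertex_of d' == vertex_of (edge_perm m d)) c,
      uniq [seq edge_of d | d <- c]
    & uniq [seq vertex_of d | d <- c]].

(* Bounding the length of cycles by #|D| loses nothing, by uniqueness. *)
Definition acyclic (E : {set {set D}}) : bool :=
  [forall k : 'I_#|D|.+1, forall c : k.-tuple D, ~~ simple_cycle E c].

Definition spanning_tree (T : {set {set D}}) : bool :=
  [&& T \subset edges, connected_by T & acyclic T].

End RotationSystem.

Section TreeRooted.
Variable D : finType.

Definition tree_rooted_2connected_maps :
    {set rotation_system D * {set {set D}}} :=
  [set mT | [&& planar_map mT.1, spanning_tree mT.1 mT.2 & ~~ separable mT.1]].

(* Equality up to relabelling of the half-edges, that is, up to
   orientation-preserving homeomorphism. *)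
Definition isomorphic (mT mT' : rotation_system D * {set {set D}}) : bool :=
  [exists f : {perm D},
    [&& [forall d, f (edge_perm mT.1 d) == edge_perm mT'.1 (f d)],
        [forall d, f (vertex_perm mT.1 d) == vertex_perm mT'.1 (f d)],
        f (root mT.1) == root mT'.1
      & [set f @: (e : {set D}) | e in mT.2] == mT'.2]].

End TreeRooted.

(* The vertex map has no half-edge, so it has no rotation system: it is
   counted separately, by the value at 0. *)
Definition b (n : nat) : nat :=
  if n is 0 then 1
  else #|equivalence_partition (@isomorphic 'I_n.*2)
           (tree_rooted_2connected_maps 'I_n.*2)|.

From Stdlib Require Import Reals.
From Coquelicot Require Import Coquelicot.

Local Open Scope R_scope.

Definition b_coef (n : nat) : R := INR (b n).

Definition B (y : R) : R := PSeries b_coef y.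

(* Termwise derivative, which also makes sense at the radius of convergence. *)
Definition B' (y : R) : R := PSeries (PS_derive b_coef) y.

Definition rho_B : R := 4 * (3 * PI - 8) ^ 2 / (9 * PI ^ 2).

Definition u_C : R := 9 * PI * (4 - PI) / (420 * PI - 81 * PI ^ 2 - 512).

(* Main.v *)
(* The tour of a tree-rooted map along its spanning tree turns it into a word in
   two pairs of parentheses, one for the tree edges and one for the other edges:
   the two matchings are noncrossing exactly when the edges of the first colour
   form a spanning tree and the map is planar, so tree-rooted maps correspond to
   the shuffles of two Dyck words, that is to the closed walks in the quarter
   plane. The map is separable exactly when the word has a proper nonempty factor
   that is again such a shuffle, so every word is obtained in a unique way by
   inserting shuffles after the letters of a word that encodes a 2-connected map.
   Hence M(x) = B(x M(x)^2) with M(x) = sum_n Cat_n Cat_(n+1) x^n.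

   At its radius of convergence 1/16, M and M' have values that follow from
   telescoping sums and the Wallis product, which gives B and B' at
   rho_B = M(1/16)^2 / 16. If B converged beyond rho_B, then M'' would be bounded
   near 1/16, while its series diverges like the harmonic one. Finally the
   equation reads u (2 y B'(y) - B(y) + 1) = 1, where the factor of u is a power
   series with nonnegative coefficients that increases from 0 to 1 / u_C. *)

From mathcomp Require Import all_boot perm zify.
Require Import Defs.
Set Implicit Arguments.
Unset Strict Implicit.
Unset Printing Implicit Defensive.

(** * Words and their blocks *)

(* The first component is the colour of the arc, the second tells whether it opens. *)
Notation letter := (bool * bool)%type.

(** The obstacle is that [b] counts isomorphism classes of rotation systems, whereas words are
    linear objects. A rooted map with a spanning tree has a canonical numbering of its half-edges,
    their positions on the tour, so each class is represented by exactly one diagram of chords on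
    ['I_N] and can be counted through it. In these coordinates a tree edge cuts the tour into two
    intervals, which makes the tree chords noncrossing. Vertices and faces are, up to conjugation,
    the cycles of the tour composed with one family of chords or the other, and Euler's formula
    becomes a count of cycles that only noncrossing chords attain. The number of closed walks is
    obtained from walks with an arbitrary starting point, since only these satisfy a recurrence. On
    the analytic side all series have nonnegative coefficients, so values at the radius of
    convergence are limits from the left along the reals, and no singular expansion is needed. *)

Definition step (s : nat * nat) (l : letter) : option (nat * nat) :=
  match l, s with
  | (true, true), (i, j) => Some (i.+1, j)
  | (true, false), (i.+1, j) => Some (i, j)
  | (false, true), (i, j) => Some (i, j.+1)
  | (false, false), (i, j.+1) => Some (i, j)
  | _, _ => None
  end.

Fixpoint run (s : nat * nat) (w : seq letter) : option (nat * nat) :=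
  if w is l :: w' then obind (run^~ w') (step s l) else Some s.

Definition balanced (w : seq letter) := run (0, 0) w == Some (0, 0).

Lemma run_cat s u v : run s (u ++ v) = obind (run^~ v) (run s u).
Proof. by elim: u s => //= l u IH s; case: (step s l). Qed.

Lemma run_shift i j a b i' j' w :
  run (i, j) w = Some (i', j') -> run (i + a, j + b) w = Some (i' + a, j' + b).
Proof.
elim: w i j => /= [|[c o] w IH] i j; first by case=> -> ->.
by case: c; case: o => /=; case: i => [|i]; case: j => [|j] //=; move/IH;
  rewrite ?addSn ?add0n.
Qed.

Lemma run_balanced s w : balanced w -> run s w = Some s.
Proof. by case: s => i j /eqP/(run_shift i j); rewrite !add0n. Qed.

Lemma balanced_insert u w v :
  balanced w -> balanced (u ++ w ++ v) = balanced (u ++ v).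
Proof.
move=> bw; rewrite /balanced !run_cat; case: (run _ u) => //= s.
by rewrite run_cat run_balanced.
Qed.

Lemma balanced_catr u v : balanced u -> balanced (u ++ v) = balanced v.
Proof. exact: (@balanced_insert [::]). Qed.

(** Read after [x], the word [y] returns to the origin, so its net displacement is nonpositive in
    both colours. Read from the origin, as a prefix of [y ++ z], it stays in the quarter plane, so
    the displacement is nonnegative. *)
Lemma balanced_overlap x y z :
  balanced (x ++ y) -> balanced (y ++ z) -> balanced y.
Proof.
rewrite /balanced !run_cat.
case Ex: (run _ x) => [[i j]|] //= /eqP Ey; case Ey': (run _ y) => [[i' j']|] //= _.
move: (run_shift i j Ey'); rewrite !add0n Ey => -[? ?].
by have [-> ->] : i' = 0 /\ j' = 0 by lia.
Qed.

Fixpoint balanced_free (q : seq letter) : bool :=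
  if q is _ :: q' then
    balanced_free q' && all (fun j => ~~ balanced (take j q)) (iota 1 (size q))
  else true.

(* A proper balanced factor through the first letter has a balanced complement, so
   it suffices to exclude the factors that avoid that letter. *)
Definition irreducible (p : seq letter) : bool :=
  [&& p != [::], balanced p & balanced_free (behead p)].

Lemma balanced_free_behead q : balanced_free q -> balanced_free (behead q).
Proof. by case: q => //= l q /andP[]. Qed.

Lemma balanced_free_take q j : balanced_free q -> 0 < j <= size q -> ~~ balanced (take j q).
Proof.
case: q => [|l q]; first by move=> _ /=; lia.
move=> /andP[_ /allP h] hj; apply: h; rewrite mem_iota; lia.
Qed.

Lemma balanced_freeP q :
  reflect (forall i j, i < j <= size q -> ~~ balanced (drop i (take j q)))
          (balanced_free q).
Proof.
elim: q => [|l q IH]; first by apply: ReflectT => i j /=; lia.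
apply: (iffP andP) => [[fq /allP h] [|i] j hij|h].
- rewrite drop0; apply: h; rewrite mem_iota; lia.
- case: j hij => [|j] hij; first by lia.
  by apply/(IH fq).
- split; first by apply/IH => i j hij; apply: (h i.+1 j.+1).
  apply/allP => j; rewrite mem_iota => hj.
  by move: (h 0 j); rewrite drop0; apply; lia.
Qed.

(* [expands p w]: inserting a balanced word after each letter of [p] gives [w]. *)
Fixpoint expands (p w : seq letter) : bool :=
  match p, w with
  | [::], [::] => true
  | l :: p', l' :: t => (l == l') &&
      [exists i : 'I_(size t).+1, balanced (take i t) && expands p' (drop i t)]
  | _, _ => false
  end.

Arguments expands : simpl never.

Lemma expands_cons l p l' t : expands (l :: p) (l' :: t) =
  (l == l') && [exists i : 'I_(size t).+1, balanced (take i t) && expands p (drop i t)].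
Proof. by []. Qed.

Lemma expands_consP l p w :
  reflect (exists w1 r, [/\ w = l :: w1 ++ r, balanced w1 & expands p r])
          (expands (l :: p) w).
Proof.
case: w => [|l' t]; rewrite ?expands_cons; first by apply: ReflectF => -[? [? []]].
apply: (iffP andP) => [[/eqP -> /existsP[i /andP[b1 d]]]|].
  by exists (take i t), (drop i t); rewrite cat_take_drop.
move=> [w1 [r [[-> ->] b1 d]]]; split=> //.
have h : size w1 < (size (w1 ++ r)).+1 by rewrite size_cat; lia.
apply/existsP; exists (Ordinal h) => /=.
by rewrite take_size_cat // drop_size_cat // b1 d.
Qed.

(** The context [x], [y] makes the induction work: letters of [p] already treated move into [x]. *)
Lemma expands_balanced p w x y :
  expands p w -> balanced (x ++ w ++ y) = balanced (x ++ p ++ y).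
Proof.
elim: p w x => [|l p IH] w x; first by case: w.
move=> /expands_consP[w1 [r [-> b1 /(IH _ (rcons x l))]]].
rewrite !cat_rcons /= => <-.
by rewrite -catA -!cat_rcons balanced_insert.
Qed.

(** The prefix [u] stops at the end of the word inserted after the last letter kept. *)
Lemma expands_take p w j : expands p w -> 0 < j -> p != [::] ->
  exists u v, [/\ w = u ++ v, u != [::] & expands (take j p) u].
Proof.
elim: p w j => // l p IH w [|j] //.
move=> /expands_consP[w1 [r [-> b1 d]]] _ _ /=.
have [jE|pE] : (j == 0) || (p == [::]) \/ (0 < j /\ p != [::]).
- by case: (posnP j); case: (eqVneq p [::]); auto.
- exists (l :: w1), r; split=> //.
  have -> : take j p = [::] by case/orP: jE => /eqP ->; rewrite ?take0.
  by apply/expands_consP; exists w1, [::]; rewrite cats0.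
case: (IH r j d pE.1 pE.2) => u [v [-> un du]].
exists (l :: w1 ++ u), v; split=> //; first by rewrite /= catA.
by apply/expands_consP; exists w1, u.
Qed.

Lemma expands_prefix p u v x : expands p (u ++ v) -> balanced (x ++ u) ->
  exists2 j, balanced (x ++ take j p) & (j <= size p) && ((u != [::]) ==> (0 < j)).
Proof.
elim: p u x => [|l p IH] u x.
  by case: u => //= _ bx; exists 0.
move=> /expands_consP[w1 [r [E b1 d]]].
case: u E => [|l' u] /=; first by move=> _ bx; exists 0.
case=> -> E bx.
have [le|lt] := leqP (size u) (size w1).
  exists 1 => //=; rewrite take0.
  have uE : u = take (size u) w1.
    by rewrite -[LHS](@take_size_cat _ (size u) u v) // E takel_cat.
  have bu : balanced u.
    apply: (@balanced_overlap (rcons x l) _ (drop (size u) w1)).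
      by rewrite cat_rcons.
    by rewrite {1}uE cat_take_drop.
  have := @balanced_insert (rcons x l) u [::] bu.
  by rewrite !cats0 cat_rcons bx cats1 => <-.
have uE : u = w1 ++ drop (size w1) u.
  rewrite -[LHS](cat_take_drop (size w1)); congr (_ ++ _).
  rewrite -[RHS](@take_size_cat _ (size w1) w1 r) // -E takel_cat //; lia.
have rE : r = drop (size w1) u ++ v.
  move/eqP: E; rewrite {1}uE -catA eqseq_cat // eqxx /=.
  by move/eqP.
rewrite rE in d.
have /(IH _ (rcons x l) d)[j bj hj] : balanced (rcons x l ++ drop (size w1) u).
  by move: bx; rewrite {1}uE -cat_rcons balanced_insert.
exists j.+1; first by rewrite /= -cat_rcons.
by case/andP: hj => hj _; rewrite /= ltnS hj ?implybT.
Qed.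

(** An inserted word is therefore the longest balanced prefix of what follows its letter, which is
    why insertions can be undone in only one way. *)
Lemma expands_free_prefix p u v :
  balanced_free p -> expands p (u ++ v) -> balanced u -> u = [::].
Proof.
move=> fp d bu; apply/eqP; apply: contraT => un.
have [j bj hj] := @expands_prefix p u v [::] d bu.
by have := @balanced_free_take p j fp; rewrite /= in bj; rewrite bj; move: hj; rewrite un /=; lia.
Qed.

Lemma expands_split_uniq p q w1 r1 w2 r2 : balanced_free p -> balanced_free q -> expands p r1 -> expands q r2 ->
  balanced w1 -> balanced w2 -> w1 ++ r1 = w2 ++ r2 -> size w1 <= size w2 ->
  w1 = w2 /\ r1 = r2.
Proof.
move=> fp fq d1 d2 b1 b2 E le.
have w2E : w2 = w1 ++ drop (size w1) w2.
  rewrite -[LHS](cat_take_drop (size w1)); congr (_ ++ _).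
  by rewrite -[RHS](@take_size_cat _ (size w1) w1 r1) // E takel_cat.
have rE : r1 = drop (size w1) w2 ++ r2.
  move/eqP: E; rewrite {1}w2E -catA eqseq_cat // eqxx /=; by move/eqP.
have : drop (size w1) w2 = [::].
  apply: (@expands_free_prefix p _ r2) => //; first by rewrite -rE.
  by rewrite -(balanced_catr _ b1) -w2E.
by move=> E0; split; [rewrite w2E E0 cats0 | rewrite rE E0].
Qed.

Lemma expands_uniq p q w : balanced_free (behead p) -> balanced_free (behead q) ->
  expands p w -> expands q w -> p = q.
Proof.
elim: p q w => [|l p IH] [|l' q] [|l'' w] //=.
move=> fp fq /expands_consP[w1 [r1 [[-> E1] b1 d1]]] /expands_consP[w2 [r2 [[-> E2] b2 d2]]].
have rE : r1 = r2.
  have [le|le] := leqP (size w1) (size w2).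
    by apply: proj2 (expands_split_uniq fp fq d1 d2 b1 b2 _ le); rewrite -E1.
  by apply/esym; apply: proj2 (expands_split_uniq fq fp d2 d1 b2 b1 _ (ltnW le)); rewrite -E1.
congr (_ :: _); apply: (IH q r1) => //; last by rewrite rE.
- exact: balanced_free_behead.
- exact: balanced_free_behead.
Qed.

(** Greedy parsing: the longest balanced prefix after the first letter is taken as the inserted
    word, and the rest is parsed recursively. *)
Lemma expands_exists w : exists2 p, expands p w & balanced_free (behead p).
Proof.
have [n] := ubnP (size w); elim: n w => // n IH [|l t] /=; first by exists [::].
move=> lt.
have ex0 : exists i, (i <= size t) && balanced (take i t).
  by exists 0; rewrite take0.
have bnd i : (i <= size t) && balanced (take i t) -> i <= size t by case/andP.
case: (ex_maxnP ex0 bnd) => i /andP[le bi] imax.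
have [|p d fp] := IH (drop i t); first by rewrite size_drop; lia.
exists (l :: p).
  by apply/expands_consP; exists (take i t), (drop i t); rewrite cat_take_drop.
case: p d fp => [//|l' p] d fp; rewrite [balanced_free _]/= in fp *; apply/andP; split => //.
(* A balanced prefix of the remaining skeleton would expand to a balanced [u], and appending [u]
   would contradict the maximality of [i]. *)
apply/allP => j; rewrite mem_iota => hj; apply/negP => bj.
have [|//|u [v [E un du]]] := @expands_take _ _ j d; first by lia.
have bu : balanced u.
  by move: (expands_balanced [::] [::] du); rewrite /= !cats0 bj.
have := imax (i + size u).
have szE : size (drop i t) = size u + size v by rewrite E size_cat.
rewrite size_drop in szE.
have -> : take (i + size u) t = take i t ++ u.
  by rewrite takeD E take_size_cat.
rewrite balanced_catr // bu andbT.
case: u un {du bu E} szE => //= ? ? _ szE h.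
have := h ltac:(lia); lia.
Qed.

Lemma irreducible_expands w : balanced w -> w != [::] ->
  exists2 p, irreducible p & expands p w.
Proof.
move=> bw wn; have [p d fp] := expands_exists w; exists p => //.
rewrite /irreducible fp andbT; apply/andP; split.
  by case: p d {fp} => //; case: w wn {bw}.
by move: (expands_balanced [::] [::] d); rewrite /= !cats0 bw.
Qed.

Lemma size_expands p w : expands p w -> size p <= size w.
Proof.
elim: p w => // l p IH w /expands_consP[w1 [r [-> _ /IH]]] /=.
by rewrite size_cat; lia.
Qed.

(** * Counting words *)

Definition word_count (k : nat) (P : pred (seq letter)) : nat :=
  \sum_(w : k.-tuple letter) P w.

Lemma word_count0 P : word_count 0 P = P [::].
Proof.
rewrite /word_count (bigD1 [tuple]) //= big1 ?addn0 // => i.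
by rewrite (tuple0 i).
Qed.

Lemma word_countS k P :
  word_count k.+1 P = \sum_(l : letter) word_count k (fun w => P (l :: w)).
Proof.
rewrite /word_count pair_big /=.
rewrite (reindex (fun x : letter * k.-tuple letter => [tuple of x.1 :: x.2])) //=.
exists (fun t : k.+1.-tuple letter => (thead t, [tuple of behead t])).
- by move=> [l w] _; congr (_, _); apply/val_inj.
- by move=> t _; apply/val_inj => /=; case/tupleP: t.
Qed.

Lemma eq_word_count k P Q : (forall w, size w = k -> P w = Q w) -> word_count k P = word_count k Q.
Proof. by move=> h; apply: eq_bigr => w _; rewrite h ?size_tuple. Qed.

Lemma word_count_false k P : (forall w, size w = k -> P w = false) -> word_count k P = 0.
Proof. by move=> h; rewrite /word_count big1 // => w _; rewrite h ?size_tuple. Qed.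

Lemma word_count_prod i j P Q :
  word_count (i + j) (fun w => P (take i w) && Q (drop i w)) = word_count i P * word_count j Q.
Proof.
elim: i P => [|i IH] P.
  rewrite word_count0 add0n.
  rewrite (@eq_word_count _ _ (fun w => P [::] && Q w)); last by move=> w _; rewrite take0 drop0.
  case: (P [::]) => /=; rewrite ?mul1n ?mul0n //.
  by rewrite word_count_false.
rewrite addSn !word_countS big_distrl /=; apply: eq_bigr => l _.
exact: (IH (fun w => P (l :: w))).
Qed.

(** The coefficient of x^n in the k-th power of the series with coefficients [m]. *)
Fixpoint conv_pow (m : nat -> nat) (k n : nat) : nat :=
  if k is k'.+1 then \sum_(i < n.+1) m i * conv_pow m k' (n - i) else (n == 0).

Definition num_balanced (k : nat) : nat := word_count k balanced.
Definition num_irreducible (k : nat) : nat := word_count k irreducible.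

Lemma sum_bool_unique (I : finType) (P : pred I) :
  (forall i j, P i -> P j -> i = j) -> \sum_i (P i : nat) = [exists i, P i].
Proof.
move=> un; case: existsP => [[i Pi]|n].
  rewrite (bigD1 i) //= Pi big1 // => j ne.
  by case Pj: (P j) => //; move: ne; rewrite (un _ _ Pi Pj) eqxx.
by rewrite big1 // => i _; case Pi: (P i) => //; case: n; exists i.
Qed.

(** Each letter of [p] contributes one independent balanced word, and the expansion determines the
    cuts, so only the length of [p] matters. *)
Lemma word_count_dec p n : balanced_free (behead p) ->
  word_count n (expands p) = if size p <= n then conv_pow num_balanced (size p) (n - size p) else 0.
Proof.
elim: p n => [|l p IH] n fp.
  rewrite /= subn0; case: n => [|n]; first by rewrite word_count0.
  by rewrite word_count_false // => -[].
case: n => [|n]; first by rewrite word_count0.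
rewrite word_countS (bigD1 l) //= big1 ?addn0; last first.
  by move=> l' ne; apply: word_count_false => w _; rewrite expands_cons eq_sym (negbTE ne).
have fp' : balanced_free p by [].
transitivity (\sum_(i < n.+1) num_balanced i * word_count (n - i) (expands p)).
  transitivity (\sum_(i < n.+1) word_count n (fun w => balanced (take i w) && expands p (drop i w))).
    rewrite /word_count exchange_big /=; apply: eq_bigr => w _.
    (* The cut is unique, so its existence can be replaced by a sum over its position. *)
    rewrite expands_cons eqxx /= size_tuple sum_bool_unique // => i j.
    move=> /andP[bi di] /andP[bj dj]; apply/val_inj => /=.
    have szi : size (take i w) = i by rewrite size_takel // size_tuple -ltnS.
    have szj : size (take j w) = j by rewrite size_takel // size_tuple -ltnS.
    have E : take i w ++ drop i w = take j w ++ drop j w by rewrite !cat_take_drop.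
    have [le|le] := leqP i j.
      have [h _] := expands_split_uniq fp' fp' di dj bi bj E ltac:(lia).
      by rewrite -szi h szj.
    have [h _] := expands_split_uniq fp' fp' dj di bj bi (esym E) ltac:(lia).
    by rewrite -szj h szi.
  apply: eq_bigr => i _; rewrite -word_count_prod subnKC // -ltnS; exact: ltn_ord.
have [le|lt] := leqP (size p) n; last first.
  rewrite ltnS leqNgt lt big1 // => i _; rewrite IH ?balanced_free_behead //.
  by case: leqP; rewrite ?muln0 //; lia.
rewrite ltnS le subSS -(big_mkord xpredT (fun i => num_balanced i * word_count (n - i) (expands p))).
rewrite (@big_cat_nat _ _ _ (n - size p).+1) //=; last by lia.
rewrite [X in _ + X]big1_seq ?addn0; last first.
  move=> i /andP[_]; rewrite mem_index_iota => hi; rewrite IH ?balanced_free_behead //.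
  by case: leqP; rewrite ?muln0 //; lia.
rewrite big_mkord; apply: eq_bigr => i _; rewrite IH ?balanced_free_behead //.
have lti := ltn_ord i; have -> : size p <= n - i by lia.
by congr (_ * conv_pow _ _ _); lia.
Qed.

(** Balanced words are grouped by their irreducible skeleton. The empty word has none, hence
    [0 < n]. *)
Lemma num_balanced_conv n : 0 < n ->
  num_balanced n = \sum_(k < n.+1) num_irreducible k * conv_pow num_balanced k (n - k).
Proof.
move=> n0.
have -> : num_balanced n = \sum_(k < n.+1) \sum_(p : k.-tuple letter | irreducible p) word_count n (expands p).
  rewrite /num_balanced /word_count.
  under [RHS]eq_bigr do rewrite exchange_big /=.
  rewrite exchange_big /=; apply: eq_bigr => w _.
  have szw : size w = n by rewrite size_tuple.
  case bw: (balanced w); last first.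
    rewrite big1 // => k _; rewrite big1 // => p /and3P[_ bp _].
    case d: (expands p w) => //; move: (expands_balanced [::] [::] d).
    by rewrite /= !cats0 bw bp.
  have wn : w != [::] :> seq _ by rewrite -size_eq0 szw; lia.
  have [p ip d] := irreducible_expands bw wn.
  have lt : size p < n.+1 by rewrite ltnS -szw size_expands.
  rewrite (bigD1 (Ordinal lt)) //= (bigD1 (in_tuple p)) //= d big1 ?add1n ?big1 //.
    move=> k ne; rewrite big1 // => q iq; case dq: (expands q w) => //.
    case/negP: ne; apply/eqP/val_inj => /=.
    case/and3P: ip => _ _ fp; case/and3P: iq => _ _ fq.
    by rewrite (expands_uniq fp fq d dq) size_tuple.
  move=> q /andP[iq ne]; case dq: (expands q w) => //.
  case/negP: ne; apply/eqP/val_inj => /=.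
  case/and3P: ip => _ _ fp; case/and3P: iq => _ _ fq.
  exact: expands_uniq fq fp dq d.
apply: eq_bigr => k _; rewrite /num_irreducible [word_count k irreducible]/word_count big_distrl /= [LHS]big_mkcond /=.
apply: eq_bigr => p _; case ip: (irreducible p); last by rewrite mul0n.
case/and3P: (ip) => _ _ fp; by rewrite mul1n word_count_dec // size_tuple; case: leqP => //; have := ltn_ord k; lia.
Qed.

(** The starting point is arbitrary so that removing the first step gives a recurrence. *)
Definition num_walks (k i j : nat) : nat :=
  word_count k (fun w => run (i, j) w == Some (0, 0)).

Lemma num_walksS k i j : num_walks k.+1 i j =
  (num_walks k i.+1 j + (if i is i'.+1 then num_walks k i' j else 0) +
   (num_walks k i j.+1 + (if j is j'.+1 then num_walks k i j' else 0))).
Proof.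
rewrite /num_walks word_countS.
pose F (c o : bool) := word_count k (fun w => run (i, j) ((c, o) :: w) == Some (0, 0)).
rewrite (eq_bigr (fun p => F p.1 p.2)); last by case.
rewrite -(pair_bigA _ F) /F {F}.
rewrite !big_bool /=; congr (_ + _ + (_ + _)).
- by case: i => [|i] //=; exact: word_count_false.
- by case: j => [|j] //=; exact: word_count_false.
Qed.

Lemma num_walks_eq0 k i j : (k < i + j) || odd (k + i + j) -> num_walks k i j = 0.
Proof.
elim: k i j => [|k IH] i j h.
  rewrite /num_walks word_count0 /=.
  by case: i j h => [|i] [|j].
rewrite num_walksS !IH; try lia.
by case: i j h => [|i] [|j] h; rewrite ?IH //; lia.
Qed.

Lemma num_balanced_odd n : odd n -> num_balanced n = 0.
Proof. by move=> o; rewrite -[num_balanced _]/(num_walks _ 0 0) num_walks_eq0 // !addn0 o orbT. Qed.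

(** * Tours of tree-rooted maps *)

Section PermFacts.
Variable D : finType.
Implicit Types (s : {perm D}) (A : pred D).

Lemma porbit_closed s A d y :
  (forall x, A x -> A (s x)) -> A d -> y \in porbit s d -> A y.
Proof.
move=> cl Ad /porbitP[i ->]; elim: i => [|i IH]; first by rewrite expg0 perm1.
by rewrite expgSr permM; apply: cl.
Qed.

Lemma mem_porbit1 s d : s d \in porbit s d.
Proof. by have := mem_porbit s 1 d; rewrite expg1. Qed.

Lemma porbit_perm_eq s d : porbit s (s d) = porbit s d.
Proof. by have := porbit_perm s 1 d; rewrite expg1. Qed.

(** The two products are conjugate by [s], and conjugation carries cycles to cycles. *)
Lemma card_porbits_mulC s s' : #|porbits (s * s')%g| = #|porbits (s' * s)%g|.
Proof.
have h (u v : {perm D}) : #|porbits (u * v)%g| <= #|porbits (v * u)%g|.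
  apply: (@leq_trans #|[set [set u^-1%g y | y in (O : {set D})] | O in porbits (v * u)%g]|);
    last exact: leq_imset_card.
  apply/subset_leq_card/subsetP => _ /imsetP[d _ ->].
  apply/imsetP; exists (porbit (v * u)%g (u d)); first exact: imset_f.
  have E i y : u (((u * v) ^+ i)%g y) = ((v * u) ^+ i)%g (u y).
    elim: i => [|i IH]; first by rewrite !expg0 !perm1.
    by rewrite !expgSr !permM IH.
  apply/setP => y; apply/porbitP/imsetP => [[i ->]|[_ /porbitP[i ->] ->]].
    by exists (((v * u) ^+ i)%g (u d)); rewrite ?mem_porbit // -E permK.
  by exists i; rewrite -E permK.
by apply/eqP; rewrite eqn_leq !h.
Qed.

End PermFacts.

(** This makes [tau] a single cycle, cut open just before [r] so that its elements are linearly
    ordered. *)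
Definition tour_position (D : finType) (tau : {perm D}) (r : D) (pos : D -> nat) :=
  [/\ injective pos, forall d, pos d < #|D|, pos r = 0
    & forall d, pos (tau d) = if (pos d).+1 == #|D| then 0 else (pos d).+1].

(** Fixed points of [t] satisfy the condition trivially, so the chords of one colour can be treated
    while the other half-edges stay in place. *)
Definition noncrossing (D : finType) (pos : D -> nat) (t : D -> D) :=
  [forall a, forall b, (pos a < pos b < pos (t a)) ==> (pos a < pos (t b) < pos (t a))].

Definition closers (D : finType) (pos : D -> nat) (t : D -> D) :=
  [set d | pos (t d) < pos d].

Section Tour.
Variables (D : finType) (tau : {perm D}) (r : D) (pos : D -> nat).
Hypothesis tourP : tour_position tau r pos.

Let pos_inj : injective pos. Proof. by case: tourP. Qed.
Let pos_lt d : pos d < #|D|. Proof. by case: tourP. Qed.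
Let pos_r : pos r = 0. Proof. by case: tourP. Qed.
Let pos_tau d : pos (tau d) = if (pos d).+1 == #|D| then 0 else (pos d).+1.
Proof. by case: tourP. Qed.

Definition at_pos (k : nat) : D := iter k tau r.

Lemma at_posK k : k < #|D| -> pos (at_pos k) = k.
Proof.
elim: k => [|k IH] lt //=; rewrite pos_tau IH; last by lia.
by case: eqP => //; lia.
Qed.

Lemma posK d : at_pos (pos d) = d.
Proof. by apply: pos_inj; rewrite at_posK. Qed.

Lemma tour_ind (A : D -> Prop) : A r -> (forall x, A x -> A (tau x)) -> forall x, A x.
Proof.
move=> Ar cl x; rewrite -[x]posK; elim: (pos x) => //= k; exact: cl.
Qed.

Lemma pos_tauS d e : pos d < pos e -> pos (tau d) = (pos d).+1.
Proof. by move=> lt; rewrite pos_tau; case: eqP => // E; have := pos_lt e; lia. Qed.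

(** * Chord diagrams with the maximal number of cycles *)

Section Chords.
Variables (t : D -> D) (s : {perm D}).
Hypothesis tK : involutive t.
Hypothesis sE : forall d, s d = tau (t d).

Lemma noncrossingP :
  reflect (forall a b, pos a < pos b < pos (t a) -> pos a < pos (t b) < pos (t a))
          (noncrossing pos t).
Proof.
by apply: (iffP forallP) => h a; [move=> b; move/forallP: (h a) => /(_ b)/implyP
  |apply/forallP => b; apply/implyP; apply: h].
Qed.

(** The top position of each cycle of [s] is a descent, so there are at most as many cycles as
    descents, with equality when each cycle has only one. *)
Let descents := [set d | pos (s d) <= pos d].

(** [s] maps [p0] to [r]: it is the one descent due to the wrap-around of the tour. The other
    descents are the closers. *)
Let p0 := t (at_pos #|D|.-1).
Let D_gt0 : 0 < #|D|. Proof. by apply/card_gt0P; exists r. Qed.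
Let pos_p0 : pos (t p0) = #|D|.-1.
Proof. by rewrite /p0 tK at_posK // prednK. Qed.

Let descentsE : descents = p0 |: closers pos t.
Proof.
apply/setP => d; rewrite !inE sE pos_tau.
case: eqP => E.
  have -> : d = p0 by apply: (can_inj tK); apply: pos_inj; rewrite pos_p0; lia.
  by rewrite eqxx.
have -> : (d == p0) = false.
  by apply/eqP => dE; apply: E; rewrite dE pos_p0 prednK.
by [].
Qed.

Let card_descents : #|descents| = #|closers pos t|.+1.
Proof.
rewrite descentsE cardsU1 !inE pos_p0.
by rewrite ltnNge -ltnS prednK // pos_lt.
Qed.

Let orbit_top d : exists2 e, e \in porbit s d & {in porbit s d, forall y, pos y <= pos e}.
Proof.
have Pd : d \in porbit s d by exact: porbit_id.
by case: (arg_maxnP pos Pd) => e He max; exists e.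
Qed.

Let top_descent d e :
  e \in porbit s d -> {in porbit s d, forall y, pos y <= pos e} -> e \in descents.
Proof.
move=> He max; rewrite inE; apply: max.
by rewrite -eq_porbit_mem in He; rewrite -(eqP He) mem_porbit1.
Qed.

Let porbits_descents : porbits s = [set porbit s d | d in descents].
Proof.
apply/setP => O; apply/imsetP/imsetP => -[d Hd ->]; last by exists d.
have [e He max] := orbit_top d; exists e; first exact: top_descent max.
by apply/eqP; rewrite eq_porbit_mem porbit_sym.
Qed.

(** The positions in ]t d, d], or in [0, p0] for the wrap-around, are stable under [s]: a chord from
    a position below the top lands below the top without leaving the interval, [tau] then moves up
    by one, and the top itself returns to the bottom. *)
Let noncrossing_top d : noncrossing pos t -> d \in descents ->
  {in porbit s d, forall y, pos y <= pos d}.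
Proof.
move=> /noncrossingP nc; rewrite descentsE !inE => /orP[/eqP ->|lt] y.
  apply: (@porbit_closed _ s (fun y => pos y <= pos p0)) => // x le.
  have [-> |ne] := eqVneq x p0; first by rewrite sE pos_tau pos_p0 prednK // eqxx.
  have ltx : pos x < pos p0.
    by rewrite ltn_neqAle le andbT; apply: contra ne => /eqP/pos_inj ->.
  have : pos (t x) < pos p0.
    rewrite ltnNge; apply/negP => ge.
    have ne1 : pos (t x) <> pos p0.
      move=> /pos_inj E; have : pos x = #|D|.-1 by rewrite -pos_p0 -E tK.
      by have := pos_lt p0; lia.
    have := nc x p0; rewrite pos_p0.
    by have := pos_lt (t x); lia.
  by move=> lt; rewrite sE (pos_tauS lt).
move=> Hy; suff : pos (t d) < pos y <= pos d by case/andP.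
apply: (@porbit_closed _ s (fun y => pos (t d) < pos y <= pos d) d y _ _ Hy).
  move=> x /andP[ltx lex].
  have [-> |ne] := eqVneq x d; first by rewrite sE (pos_tauS lt); lia.
  have ltx' : pos x < pos d.
    by rewrite ltn_neqAle lex andbT; apply: contra ne => /eqP/pos_inj ->.
  have /andP[h1 h2] : pos (t d) < pos (t x) < pos d.
    by have := nc (t d) x; rewrite tK; apply; rewrite ltx ltx'.
  by rewrite sE (pos_tauS h2); lia.
by rewrite lt leqnn.
Qed.

(* If every cycle of [s] has a single descent, the cycle through [t x] climbs
   from just after [x] to [t x]; a chord [(y, t y)] crossing [(x, t x)] forces
   it to jump over [y] along a shorter crossing chord. *)
Let unique_descent_noncrossing : {in descents &, injective (porbit s)} ->
  noncrossing pos t.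
Proof.
move=> inj.
have top d : d \in descents -> {in porbit s d, forall y, pos y <= pos d}.
  move=> Hd y Hy; have [e He max] := orbit_top d.
  have <- : e = d; last exact: max.
  apply: inj => //; first exact: top_descent max.
  by apply/eqP; rewrite eq_porbit_mem.
have key n x y : pos (t x) - pos x < n -> pos x < pos y -> pos y < pos (t x) ->
    pos (t x) < pos (t y) -> False.
  elim: n x y => // n IH x y le xy ytx cr.
  set c := t x in ytx cr le *.
  have sc : pos (s c) = (pos x).+1 by rewrite sE tK (pos_tauS xy).
  have cD : c \in descents by rewrite inE sc; lia.
  have [z /and3P[zO xz zy] ysz] :
      exists2 z, [&& z \in porbit s c, pos x < pos z & pos z <= pos y] & pos y < pos (s z).
    case: (pickP [pred z | [&& z \in porbit s c, pos x < pos z & pos z <= pos y]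
                            & pos y < pos (s z)]) => [z /andP[]|no]; first by exists z.
    have : [&& c \in porbit s c, pos x < pos c & pos c <= pos y]; last by lia.
    have cO : c \in porbit s (s c) by rewrite porbit_perm_eq porbit_id.
    move: cO; apply: (@porbit_closed _ s
      (fun z => [&& z \in porbit s c, pos x < pos z & pos z <= pos y])); last first.
      by rewrite mem_porbit1 sc; lia.
    move=> z Hz; have := no z; rewrite /= Hz /= => /negbT.
    rewrite -leqNgt => szy; rewrite szy andbT.
    case/and3P: Hz => zO xz zy.
    have szO : s z \in porbit s c.
      by move: zO; rewrite -eq_porbit_mem => /eqP <-; exact: mem_porbit1.
    rewrite szO /=.
    have : z \notin descents.
      apply/negP => zD; have E : z = c.
        by apply: inj => //; apply/eqP; rewrite eq_porbit_mem.
      by rewrite E in zy; lia.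
    by rewrite inE; lia.
  have szO : s z \in porbit s c.
    by move: zO; rewrite -eq_porbit_mem => /eqP <-; exact: mem_porbit1.
  have szc := top c cD _ szO.
  have tz : pos (s z) = (pos (t z)).+1.
    by move: ysz; rewrite sE pos_tau; case: eqP.
  have [E|ne] := eqVneq z y; first by rewrite E in tz szc; lia.
  have neP : pos z <> pos y by move/pos_inj => E; rewrite E eqxx in ne.
  have ntz : pos (t z) <> pos y.
    by move/pos_inj => E; rewrite -E tK in cr; lia.
  by apply: (IH z y); lia.
apply/noncrossingP => a b /andP[ab bta]; apply/andP; split.
- rewrite ltnNge leq_eqVlt; apply/negP => /orP[/eqP/pos_inj E|lt].
    by rewrite -E tK ltnn in bta.
  by apply: (key (pos b - pos (t b)).+1 (t b) a); rewrite ?tK //; lia.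
- rewrite ltnNge leq_eqVlt; apply/negP => /orP[/eqP/pos_inj E|lt].
    by move/(can_inj tK): E => E; rewrite E ltnn in ab.
  by apply: (key (pos (t a) - pos a).+1 a b).
Qed.

(** The cycles are the image of the descents under [porbit s], so equality of the cardinals says
    that this map is injective, that is, that each cycle has one descent. *)
Lemma card_porbits_noncrossing :
  (#|porbits s| == #|closers pos t|.+1) = noncrossing pos t.
Proof.
rewrite porbits_descents -card_descents; apply/imset_injP/idP => [|nc].
  exact: unique_descent_noncrossing.
move=> d e dD eD /eqP E; apply: pos_inj; apply/eqP; rewrite eqn_leq.
rewrite (noncrossing_top nc dD) ?(noncrossing_top nc eD) //.
- by rewrite -eq_porbit_mem.
- by rewrite -eq_porbit_mem eq_sym.
Qed.

End Chords.
End Tour.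

Definition fixfree_involution (D : finType) (alpha : {perm D}) :=
  [forall d, (alpha d != d) && (alpha (alpha d) == d)].

(* Cutting the edge of [d] separates [s] from its complement. *)
Definition side_function (D : finType) (m : rotation_system D) (T : {set {set D}})
    (d : D) (s : pred D) :=
  [/\ forall x, s (vertex_perm m x) = s x,
      forall x, edge_of m x \in T -> edge_of m x != edge_of m d ->
        s (edge_perm m x) = s x
    & s (edge_perm m d) = ~~ s d].

(** * Colour changes in a sequence *)

Section ColourChanges.
Variable c : nat -> bool.

Definition colour_change (k : nat) : bool := c k.-1 != c k.

Lemma no_colour_change a b :
  a <= b -> (forall k, a < k <= b -> ~~ colour_change k) -> c a = c b.
Proof.
elim: b => [|b IH] le h; first by have -> : a = 0 by lia.
have [lt|ge] := ltnP a b.+1; last by have -> : a = b.+1 by lia.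
rewrite IH; [|lia|by move=> k ?; apply: h; lia].
have : ~~ colour_change b.+1 by apply: h; lia.
by rewrite /colour_change negbK => /eqP.
Qed.

Lemma colour_change_exists a b : a <= b -> c a != c b ->
  exists2 k, a < k <= b & colour_change k.
Proof.
move=> le ne; case: (pickP [pred k : 'I_b.+1 | (a < k) && colour_change k])
  => [k /andP[h1 h2]|no].
  by exists k => //; have := ltn_ord k; lia.
case/eqP: ne; apply: no_colour_change => // k hk; have lt : k < b.+1 by lia.
have /= := no (Ordinal lt); have -> : a < k by lia.
by move=> /= ->.
Qed.

Lemma colour_change_twice a b k : c a = c b -> a < k <= b -> colour_change k ->
  exists i j, [/\ a < i, i < j, j <= b, colour_change i & colour_change j].
Proof.
move=> E hk bk; case: (eqVneq (c a) (c k.-1)) => [E1|ne].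
  have [||j hj bj] := @colour_change_exists k b; [lia|by rewrite -E E1 eq_sym|].
  by exists k, j; split=> //; lia.
have [||j hj bj] := @colour_change_exists a k.-1 => //; first by lia.
by exists j, k; split=> //; lia.
Qed.

End ColourChanges.

(** * Spanning trees in terms of the tour *)

Section TreeTour.
Variables (D : finType) (m : rotation_system D) (T : {set {set D}}).
Local Notation alpha := (edge_perm m).
Local Notation sigma := (vertex_perm m).
Local Notation edge_of := (edge_of m).
Local Notation vertex_of := (vertex_of m).
Local Notation tree d := (edge_of d \in T).

Hypothesis alphaP : fixfree_involution alpha.
Hypothesis TE : T \subset edges m.

Lemma alphaK : involutive alpha.
Proof. by move=> d; move/forallP: alphaP => /(_ d)/andP[_ /eqP]. Qed.

Lemma alpha_neq d : (alpha d == d) = false.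
Proof. by move/forallP: alphaP => /(_ d)/andP[/negbTE]. Qed.

Lemma edge_ofE d : edge_of d = [set d; alpha d].
Proof.
apply/setP => y; rewrite !inE; apply/idP/idP.
  apply: (@porbit_closed _ alpha (fun y => (y == d) || (y == alpha d))); last by rewrite eqxx.
  by move=> x /orP[]/eqP ->; rewrite ?alphaK eqxx ?orbT.
by move=> /orP[]/eqP ->; rewrite ?porbit_id // mem_porbit1.
Qed.

Lemma edge_of_alpha d : edge_of (alpha d) = edge_of d.
Proof. exact: porbit_perm_eq. Qed.

Lemma edge_of_eq d e : (edge_of d == edge_of e) = (d == e) || (d == alpha e).
Proof. by rewrite eq_porbit_mem -/(Defs.edge_of _ _) edge_ofE !inE. Qed.

Lemma vertex_of_sigma d : vertex_of (sigma d) = vertex_of d.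
Proof. exact: porbit_perm_eq. Qed.

Lemma vertex_invariant (A : Type) (f : D -> A) x y :
  (forall z, f (sigma z) = f z) -> vertex_of x = vertex_of y -> f x = f y.
Proof.
move=> inv /eqP; rewrite eq_porbit_mem => /porbitP[i ->].
elim: i => [|i IH]; first by rewrite expg0 perm1.
by rewrite expgSr permM inv.
Qed.

Lemma mem_vertices d : vertex_of d \in vertices m.
Proof. exact: imset_f. Qed.

Lemma adjacent_edge (E : {set {set D}}) d : edge_of d \in E ->
  adjacent m E (vertex_of d) (vertex_of (alpha d)).
Proof. by move=> dE; apply/existsP; exists d; rewrite dE !eqxx. Qed.

Lemma cycle_relE (d : D) (c : seq D) :
  cycle (fun d d' => vertex_of d' == vertex_of (alpha d)) (d :: c) =
  (map vertex_of (rcons c d) == [seq vertex_of (alpha x) | x <- d :: c]).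
Proof.
rewrite /= ; have : forall x, path (fun d d' => vertex_of d' == vertex_of (alpha d)) x (rcons c d)
   = (map vertex_of (rcons c d) == [seq vertex_of (alpha x) | x <- x :: c]); last exact.
elim: c => [|y c IH] x /=; first by rewrite eqseq_cons andbT.
by rewrite eqseq_cons IH.
Qed.

Lemma path_half_edges (E : {set {set D}}) v p : path (adjacent m E) v p ->
  exists c, [/\ all (fun d => edge_of d \in E) c, map vertex_of c = belast v p
             & [seq vertex_of (alpha d) | d <- c] = p].
Proof.
elim: p v => [|w p IH] v /=; first by exists [::].
case/andP => /existsP[d /and3P[dE /eqP <- /eqP <-]] /IH[c [h1 h2 h3]].
by exists (d :: c); rewrite /= dE h1 h2 h3.
Qed.

(** An edge used twice would bring the path back to a vertex already visited, whichever way it is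
    traversed. *)
Lemma uniq_edges v p c : map vertex_of c = belast v p ->
  [seq vertex_of (alpha d) | d <- c] = p -> uniq (v :: p) -> uniq (map edge_of c).
Proof.
elim: c v p => // x c IH v [|w p] //= [xv h] [xw h'] /andP[vp up].
rewrite (IH w p) // andbT; apply/negP => /mapP[y yc].
move/eqP; rewrite eq_sym edge_of_eq => /orP[]/eqP yE.
  have : vertex_of y \in w :: p.
    by rewrite lastI mem_rcons inE -h map_f ?orbT.
  by rewrite yE xv (negbTE vp).
have : vertex_of (alpha y) \in p by rewrite -h' (map_f (fun d => vertex_of (alpha d))).
by rewrite yE alphaK xv => Hv; case/negP: vp; rewrite inE Hv orbT.
Qed.

(** The side of [d] is the component of its vertex once its edge is removed. If it contained the
    other end, a path without repeated vertices would close up with [d] into a simple cycle. *)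
Lemma acyclic_side d : acyclic m T -> tree d -> exists s, side_function m T d s.
Proof.
move=> acT dT; pose E := T :\ edge_of d.
pose s x := connect (adjacent m E) (vertex_of d) (vertex_of x).
exists s; split=> [x|x xT ne|]; first by rewrite /s vertex_of_sigma.
  have xE : edge_of x \in E by rewrite in_setD1 ne.
  rewrite /s; apply/idP/idP => h; apply: (connect_trans h); apply: connect1.
    by have := @adjacent_edge E (alpha x); rewrite edge_of_alpha alphaK; exact.
  exact: adjacent_edge.
rewrite [s d]connect0 /s; apply/negP => cn.
have symE : connect_sym (adjacent m E).
  have sym : symmetric (adjacent m E).
    have h v w : adjacent m E v w -> adjacent m E w v.
      case/existsP => x /and3P[xE /eqP <- /eqP <-].
      by have := @adjacent_edge E (alpha x); rewrite edge_of_alpha alphaK; exact.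
    by move=> v w; apply/idP/idP; exact: h.
  exact: sym_connect_sym.
rewrite symE in cn; case/connectP: cn => p0 pth0 lst0.
case: (shortenP pth0) lst0 => p pth up _ lst {p0 pth0}.
have [c [cE cv ca]] := path_half_edges pth.
suff sc : simple_cycle m T (d :: c).
  (* [acyclic] quantifies over cycles of length at most [#|D|]; the distinctness of the edges gives
     this bound. *)
  have lt : size (d :: c) < #|D|.+1.
    case/and5P: sc => _ _ _ /map_uniq u _.
    by rewrite ltnS -(card_uniqP u) max_card.
  by move/forallP: acT => /(_ (Ordinal lt))/forallP/(_ (in_tuple (d :: c)))/negP.
apply/and5P; split=> //.
- rewrite /= dT; apply: sub_all cE => x; by rewrite in_setD1 => /andP[].
- by rewrite cycle_relE map_rcons cv /= ca lst -lastI.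
- rewrite /= (uniq_edges cv ca up) andbT; apply/negP => /mapP[y /(allP cE)].
  by rewrite in_setD1 => /andP[/negP ne _] E'; apply: ne; rewrite E'.
- by rewrite map_cons cv lst cons_uniq -rcons_uniq -lastI.
Qed.

(** A cycle through [d] crosses the edge of [d] once, and no other edge of the cycle changes sides,
    so it could not return to the side where it started. *)
Lemma side_acyclic : (forall d, tree d -> exists s, side_function m T d s) -> acyclic m T.
Proof.
move=> side; apply/forallP => k; apply/forallP => -[c _] /=; apply/negP.
case: c => [|d c] // /and5P[_ /= /andP[dT cT] cyc /andP[ud _] _].
have [s [s1 s2 s3]] := side d dT.
have sv x y : vertex_of x = vertex_of y -> s x = s y by exact: vertex_invariant.
have h : forall x, s (alpha x) = ~~ s d -> all (fun d => edge_of d \in T) c ->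
    edge_of d \notin map edge_of c ->
    path (fun d d' => vertex_of d' == vertex_of (alpha d)) x (rcons c d) -> s d = ~~ s d.
  elim: c {cT cyc ud} => [|y c IH] x sx /=.
    by move=> _ _ /andP[/eqP/sv E _]; rewrite {1}E.
  case/andP => yT cT; rewrite inE negb_or eq_sym => /andP[ne nc] /andP[/eqP/sv syx].
  by apply: IH => //; rewrite s2 // syx.
by have := h d s3 cT ud cyc; case: (s d).
Qed.

(** The tour crosses tree edges, ignores the others, and then turns around the vertex. Hence [tau]
    after this flip gives back the vertices, and [tau] after [cotree_flip] gives the faces up to
    conjugation. *)
Definition tree_flip d := if tree d then alpha d else d.
Definition cotree_flip d := if tree d then d else alpha d.

Lemma tree_flipK : involutive tree_flip.
Proof.
move=> d; rewrite /tree_flip; case tr: (tree d); last by rewrite tr.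
by rewrite edge_of_alpha tr alphaK.
Qed.

Lemma cotree_flipK : involutive cotree_flip.
Proof.
move=> d; rewrite /cotree_flip; case tr: (tree d); first by rewrite tr.
by rewrite edge_of_alpha tr alphaK.
Qed.

Variable tau : {perm D}.
Hypothesis tauE : forall d, tau d = sigma (tree_flip d).

Lemma sigmaE d : sigma d = tau (tree_flip d).
Proof. by rewrite tauE tree_flipK. Qed.

Lemma side_tau d s x : side_function m T d s -> tree d ->
  s (tau x) = s x (+) (x \in edge_of d).
Proof.
case=> s1 s2 s3 dT; rewrite tauE s1 edge_ofE !inE /tree_flip.
have [->|nd] := eqVneq x d; first by rewrite dT s3 addbT.
have [->|na] := eqVneq x (alpha d).
  by rewrite edge_of_alpha dT alphaK s3 addbT negbK.
rewrite addbF; case: ifP => // xT; apply: s2 => //.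
by rewrite edge_of_eq (negbTE nd) (negbTE na).
Qed.

(* Crossing a tree edge changes side, so the tour has to come back through it. *)
Lemma tour_is_cycle r x : spanning_tree m T -> x \in porbit tau r.
Proof.
case/and3P => _ conT acT.
have Oal d : d \in porbit tau r -> tree d -> alpha d \in porbit tau r.
  move=> dO dT; have [s sd] := acyclic_side acT dT.
  have sad : s (alpha d) = ~~ s d by case: sd.
  apply: contraT => nO.
  have : (d \in porbit tau r) && (s d == s (alpha d)); last by rewrite sad; case: (s d); rewrite andbF.
  have dO' : d \in porbit tau (tau d) by rewrite porbit_perm_eq porbit_id.
  move: dO'; apply: (@porbit_closed _ tau
    (fun x => (x \in porbit tau r) && (s x == s (alpha d)))); last first.
    rewrite (side_tau _ sd) // edge_ofE !inE eqxx /= sad addbT eqxx andbT.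
    by move: dO; rewrite -eq_porbit_mem => /eqP <-; exact: mem_porbit1.
  move=> y /andP[yO /eqP ys]; apply/andP; split.
    by move: yO; rewrite -eq_porbit_mem => /eqP <-; exact: mem_porbit1.
  rewrite (side_tau _ sd) // edge_ofE !inE ys.
  have -> : (y == d) = false.
    by apply/eqP => yd; move: ys; rewrite yd sad; case: (s d).
  have -> : (y == alpha d) = false by apply/eqP => yd; rewrite yd (negbTE nO) in yO.
  by rewrite addbF.
have Osg d : d \in porbit tau r -> sigma d \in porbit tau r.
  move=> dO; rewrite sigmaE.
  have fO : tree_flip d \in porbit tau r by rewrite /tree_flip; case: ifP => // /Oal; exact.
  by move: fO; rewrite -eq_porbit_mem => /eqP <-; exact: mem_porbit1.
have Ov d y : d \in porbit tau r -> vertex_of d = vertex_of y -> y \in porbit tau r.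
  move=> dO /esym/eqP; rewrite eq_porbit_mem => yd.
  exact: (@porbit_closed _ sigma (fun y => y \in porbit tau r) d).
move/forall_inP: conT => /(_ _ (mem_vertices r))/forall_inP/(_ _ (mem_vertices x)).
case/connectP => p; have rO : r \in porbit tau r by exact: porbit_id.
elim: p {1 3 4}r rO => [|w p IH] d dO /=; first by move=> _ /esym E; exact: Ov dO E.
case/andP => /existsP[y /and3P[yT /eqP yd /eqP <-]].
apply: IH; apply: Oal => //; apply: Ov dO _; by rewrite yd.
Qed.

Section Positions.
Variables (r : D) (pos : D -> nat).
Hypothesis tourP : tour_position tau r pos.

Let pos_inj : injective pos. Proof. by case: tourP. Qed.
Let pos_lt d : pos d < #|D|. Proof. by case: tourP. Qed.

Let pos_tau d : pos (tau d) = if (pos d).+1 == #|D| then 0 else (pos d).+1.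
Proof. by case: tourP. Qed.

(** The far side of [d]: crossing [d] leads to position [(pos d).+1], and the tour crosses back on
    leaving [pos (alpha d)], hence the half-open interval. *)
Let inside d x := pos d < pos x <= pos (alpha d).

Let inside_tau d x : pos d < pos (alpha d) ->
  inside d (tau x) = inside d x (+) (x \in edge_of d).
Proof.
move=> lt; rewrite /inside edge_ofE !inE -!(inj_eq pos_inj) pos_tau.
move: lt (pos_lt (alpha d)) (pos_lt x).
move: (pos x) (pos d) (pos (alpha d)) #|D| => px pd pa n lt ltn ltx.
by case: eqP => ?; case: eqP => ?; case: eqP => ?; rewrite /= ?addbT ?addbF;
  apply/idP/idP; lia.
Qed.

(** Both functions change at the same steps of the tour, so they differ by a constant. *)
Lemma side_inside d s x : side_function m T d s -> tree d -> pos d < pos (alpha d) ->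
  s x = s d (+) inside d x.
Proof.
move=> sd dT lt.
suff h : forall y, s y (+) inside d y = s r (+) inside d r.
  have := h x; rewrite -(h d) => E.
  have E' : inside d d = false by rewrite /inside ltnn.
  by move: E; rewrite E'; case: (s x); case: (inside d x); case: (s d).
apply: (@tour_ind _ tau r pos tourP) => // y <-.
rewrite (side_tau _ sd) // inside_tau //.
by case: (s y); case: (inside d y); case: (_ \in _).
Qed.

(** The ends of another tree edge lie on the same side of [a], and this side is an interval of the
    tour. *)
Lemma spanning_tree_noncrossing : spanning_tree m T -> noncrossing pos tree_flip.
Proof.
case/and3P => _ _ acT; apply/noncrossingP => a b.
rewrite {1}/tree_flip; case aT: (tree a) => /andP[ab ba]; last by lia.
have -> : tree_flip a = alpha a by rewrite /tree_flip aT.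
have lt : pos a < pos (alpha a) by lia.
rewrite /tree_flip; case bT: (tree b); last by rewrite ab ba.
have [s sd] := acyclic_side acT aT.
have na : b != a by apply/eqP => E; rewrite E ltnn in ab.
have nb : b != alpha a by apply/eqP => E; rewrite E ltnn in ba.
have : inside a (alpha b).
  have : s (alpha b) = s b by case: sd => _ h _; rewrite h // edge_of_eq (negbTE na) (negbTE nb).
  rewrite (side_inside b sd) // (side_inside (alpha b) sd) //.
  have -> : inside a b by rewrite /inside ab ltnW.
  by case: (inside a _); case: (s a).
rewrite /inside => /andP[-> h]; rewrite ltn_neqAle h andbT /=.
apply: contra na => /eqP/pos_inj E; by rewrite -(inj_eq (can_inj alphaK)) E.
Qed.

(** The interval [inside d] is itself a side function: noncrossing chords do not leave it, and
    around a vertex the flip compensates the two steps where [tau] enters or leaves it. *)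
Lemma noncrossing_side : noncrossing pos tree_flip ->
  forall d, tree d -> exists s, side_function m T d s.
Proof.
move=> nc.
suff h d : tree d -> pos d < pos (alpha d) -> exists s, side_function m T d s.
  move=> d dT; have [lt|gt|/pos_inj/esym/eqP] := ltngtP (pos d) (pos (alpha d)).
  - exact: h.
  - have [||s [s1 s2 s3]] := h (alpha d); rewrite ?edge_of_alpha ?alphaK //.
    exists s; split => //; first by move=> x; have := s2 x; rewrite edge_of_alpha.
    by move: s3; rewrite alphaK => ->; rewrite negbK.
  - by rewrite alpha_neq.
move=> dT lt; exists (inside d).
have ins x : tree x -> x != d -> x != alpha d -> inside d x -> inside d (alpha x).
  move=> xT nd na /andP[h1 h2].
  have h3 : pos x < pos (alpha d).
    by rewrite ltn_neqAle h2 andbT; apply: contra na => /eqP/pos_inj ->.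
  have := (noncrossingP _ _ nc) d x; rewrite /tree_flip dT xT h1 h3 /inside.
  by move=> /(_ isT) /andP[-> /ltnW].
have flp x : tree x -> x != d -> x != alpha d -> inside d (alpha x) = inside d x.
  move=> xT nd na; apply/idP/idP; last exact: ins.
  move=> h; rewrite -[x]alphaK; apply: ins => //; first by rewrite edge_of_alpha.
    by apply: contra na => /eqP <-; rewrite alphaK.
  by apply: contra nd => /eqP/(can_inj alphaK) ->.
split=> [x|x xT|].
- rewrite sigmaE inside_tau // edge_ofE !inE /tree_flip.
  case xT: (tree x).
    have [->|nd] := eqVneq x d.
      by rewrite eqxx orbT addbT /inside lt leqnn ltnn.
    have [->|na] := eqVneq x (alpha d).
      by rewrite alphaK eqxx addbT /inside lt leqnn ltnn.
    rewrite flp // (inj_eq (can_inj alphaK)) (negbTE nd) orbF.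
    by rewrite -(inj_eq (can_inj alphaK)) alphaK (negbTE na) addbF.
  have [E|_] := eqVneq x d; first by rewrite E dT in xT.
  have [E|_] := eqVneq x (alpha d); first by rewrite E edge_of_alpha dT in xT.
  by rewrite addbF.
- by rewrite edge_of_eq negb_or => /andP[nd na]; apply: flp.
- by rewrite /inside lt leqnn ltnn.
Qed.

(** Each step of the tour stays at a vertex or crosses a tree edge, and the tour visits every
    half-edge. *)
Lemma tree_connected : connected_by m T.
Proof.
apply/forall_inP => _ /imsetP[x _ ->]; apply/forall_inP => _ /imsetP[y _ ->].
have O z : z \in porbit tau r.
  apply: (tour_ind tourP (A := fun z => z \in porbit tau r)) => [|w]; first exact: porbit_id.
  by rewrite -eq_porbit_mem => /eqP <-; exact: mem_porbit1.
have : y \in porbit tau x.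
  by rewrite -eq_porbit_mem; have := O x; have := O y; rewrite -!eq_porbit_mem => /eqP -> /eqP ->.
apply: (@porbit_closed _ tau
  (fun z => connect (adjacent m T) (vertex_of x) (vertex_of z))); last exact: connect0.
move=> z cz; rewrite tauE vertex_of_sigma /tree_flip; case: ifP => // zT.
by apply: (connect_trans cz); apply: connect1; exact: adjacent_edge.
Qed.

Lemma spanning_treeE : spanning_tree m T = noncrossing pos tree_flip.
Proof.
apply/idP/idP; first exact: spanning_tree_noncrossing.
move=> nc; rewrite /spanning_tree TE tree_connected /=.
by apply: side_acyclic; apply: noncrossing_side.
Qed.

Lemma card_edges : #|edges m| = #|closers pos tree_flip| + #|closers pos cotree_flip|.
Proof.
transitivity #|[set d | pos (alpha d) < pos d]|.
  rewrite -(@card_in_imset _ _ edge_of); last first.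
    move=> x y; rewrite !inE => xp yp /eqP; rewrite edge_of_eq => /orP[]/eqP // xy.
    by move: xp yp; rewrite xy alphaK; lia.
  apply: eq_card => e; apply/imsetP/imsetP => -[d Hd ->]; last by exists d.
  have [lt|gt|/pos_inj/eqP] := ltngtP (pos d) (pos (alpha d)).
  - by exists (alpha d); rewrite ?inE ?alphaK ?edge_of_alpha.
  - by exists d; rewrite ?inE.
  - by rewrite eq_sym alpha_neq.
rewrite -cardsUI (_ : _ :&: _ = set0) ?cards0 ?addn0.
  apply: eq_card => d; rewrite !inE /tree_flip /cotree_flip.
  by case: ifP; rewrite ltnn ?orbF.
apply/setP => d; rewrite !inE /tree_flip /cotree_flip.
by case: ifP; rewrite ltnn ?andbF.
Qed.

(** As the tree chords do not cross, there is one more vertex than tree chords. Euler's formula then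
    asks for one more face than cotree chords, which is the equality case of the cycle count. *)
Lemma planar_mapE : noncrossing pos tree_flip ->
  planar_map m = noncrossing pos cotree_flip.
Proof.
move=> nc; rewrite /planar_map; have := alphaP; rewrite /fixfree_involution => -> /=.
have -> : connected_by m (edges m).
  apply/forall_inP => v vV; apply/forall_inP => w wV.
  move/forall_inP: tree_connected => /(_ v vV)/forall_inP/(_ w wV).
  apply: connect_sub => x y /existsP[d /and3P[dT dx dy]].
  by apply: connect1; apply/existsP; exists d; rewrite (subsetP TE) // dx.
have /eqP -> : #|vertices m| == #|closers pos tree_flip|.+1.
  by rewrite (card_porbits_noncrossing tourP tree_flipK sigmaE).
rewrite /faces card_porbits_mulC card_edges.
have sE d : (alpha * sigma)%g d = tau (cotree_flip d).
  rewrite permM sigmaE; congr (tau _); rewrite /tree_flip /cotree_flip edge_of_alpha.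
  by case: ifP; rewrite ?alphaK.
rewrite -(card_porbits_noncrossing tourP cotree_flipK sE) /=.
apply/eqP/eqP; lia.
Qed.

(** * Separable maps and intervals closed under the matching *)

Definition closed_interval (i j : nat) :=
  [forall x, (i <= pos x < j) ==> (i <= pos (alpha x) < j)].

Lemma closed_intervalP i j :
  reflect (forall x, i <= pos x < j -> i <= pos (alpha x) < j) (closed_interval i j).
Proof. by apply: (iffP forallP) => h x; apply/implyP; apply: h. Qed.

Lemma incidentP d (E : {set {set D}}) : E \subset edges m ->
  reflect (exists2 x, vertex_of x = vertex_of d & edge_of x \in E)
          (incident (vertex_of d) E).
Proof.
move=> /subsetP sE; apply: (iffP exists_inP) => [[e eE /pred0Pn[x /andP[xd xe]]]|[x xd xE]].
  have /imsetP[y _ ey] := sE e eE.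
  exists x; first by apply/eqP; rewrite eq_porbit_mem.
  rewrite (_ : edge_of x = e) // ey; apply/eqP; rewrite eq_porbit_mem.
  by move: xe; rewrite ey.
exists (edge_of x) => //; apply/pred0Pn; exists x => /=.
by rewrite porbit_id -eq_porbit_mem andbT; apply/eqP.
Qed.

(** [E1] consists of the edges of the interval. Around a vertex incident to both sides, [sigma]
    enters the interval somewhere; since [sigma] is [tau] after a flip that respects the interval,
    this happens only where the tour steps from position [i.-1] to [i]. The vertex is therefore
    unique, and [0 < i] ensures that something lies outside. *)
Lemma closed_interval_separable i j : 0 < i -> i < j -> j <= #|D| ->
  closed_interval i j -> separable m.
Proof.
move=> i0 ij jD /closed_intervalP cl.
pose I x := i <= pos x < j.
have Ial x : I (alpha x) = I x.
  by apply/idP/idP => [h|]; [rewrite -[x]alphaK; exact: cl|exact: cl].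
have Ifl x : I (tree_flip x) = I x by rewrite /tree_flip; case: ifP.
pose E1 := [set edge_of x | x in I].
have mE1 x : (edge_of x \in E1) = I x.
  apply/imsetP/idP => [[y yI /eqP]|xI]; last by exists x.
  by rewrite edge_of_eq => /orP[]/eqP -> //; rewrite Ial.
pose E2 := edges m :\: E1.
have mE2 x : (edge_of x \in E2) = ~~ I x by rewrite inE mE1 imset_f ?andbT.
have sE1 : E1 \subset edges m by apply/subsetP => _ /imsetP[x _ ->]; exact: imset_f.
have sE2 : E2 \subset edges m by exact: subsetDl.
pose z := at_pos tau r i.-1.
have pz : pos z = i.-1 by rewrite (at_posK tourP) //; lia.
have ptz : pos (tau z) = i by rewrite pos_tau pz; case: eqP => //; lia.
have zI : ~~ I z by rewrite /I pz; lia.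
have tzI : I (tau z) by rewrite /I ptz; lia.
apply/existsP; exists E1; apply/existsP; exists E2; apply/and5P; split.
- by apply/set0Pn; exists (edge_of (tau z)); rewrite mE1.
- by apply/set0Pn; exists (edge_of z); rewrite mE2.
- apply/eqP/setP => e; rewrite !inE; case: (boolP (e \in E1)) => //=.
  by move/(subsetP sE1) ->.
- by rewrite -setI_eq0; apply/eqP/setP => e; rewrite !inE; case: (e \in E1).
apply/cards1P; exists (vertex_of (tau z)); apply/setP => v; rewrite !inE.
apply/and3P/eqP => [[/imsetP[d _ ->] /incidentP-/(_ sE1)[x xd xI] /incidentP-/(_ sE2)[x' xd' xI']]|->].
  rewrite mE1 in xI; rewrite mE2 in xI'.
  have [y yx /andP[yI yI']] : exists2 y, y \in porbit sigma x' & ~~ I y && I (sigma y).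
    apply/exists_inP; apply: contraLR xI => /exists_inPn h.
    have : x \in porbit sigma x' by rewrite -eq_porbit_mem; apply/eqP; rewrite -/(vertex_of _) xd.
    move=> xx; suff /andP[] : (~~ I x) && (x \in porbit sigma x') by [].
    apply: (@porbit_closed _ sigma (fun y => (~~ I y) && (y \in porbit sigma x')) x') => //;
      last by rewrite xI' porbit_id.
    move=> y /andP[yI yx]; have := h y yx; rewrite yI /= => -> /=.
    by move: yx; rewrite -eq_porbit_mem => /eqP <-; exact: mem_porbit1.
  have E : tree_flip y = z.
    rewrite sigmaE in yI'; rewrite -Ifl in yI; apply: pos_inj; rewrite pz.
    move: yI yI'; rewrite /I pos_tau; move: (pos (tree_flip y)) i0 ij jD; clear => k.
    by case: eqP => ?; lia.
  have -> : tau z = sigma y by rewrite sigmaE E.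
  rewrite vertex_of_sigma -[porbit _ d]/(vertex_of d) -xd'; apply/eqP; rewrite eq_sym eq_porbit_mem.
  exact: yx.
have vz : vertex_of (tau z) = vertex_of (tree_flip z) by rewrite tauE vertex_of_sigma.
split; first exact: mem_vertices.
- by apply/incidentP => //; exists (tau z); rewrite ?mE1.
- by apply/incidentP => //; exists (tree_flip z); rewrite ?mE2 ?Ifl.
Qed.

(** * Edge colourings that change at a single vertex *)

Section CutVertex.
Variables (colour : D -> bool) (v : {set D}).
Hypothesis colour_alpha : forall x, colour (alpha x) = colour x.
Hypothesis colour_cut :
  forall x y, vertex_of x = vertex_of y -> colour x != colour y -> vertex_of x = v.
Hypothesis nct : noncrossing pos tree_flip.
Hypothesis ncc : noncrossing pos cotree_flip.

Let kp k := colour (at_pos tau r k).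
Local Notation bd := (colour_change kp).

Let kp_pos x : kp (pos x) = colour x.
Proof. by rewrite /kp (posK tourP). Qed.

(** The tour goes from [z] to a half-edge at the vertex of [tree_flip z], and the flip preserves
    colours. *)
Lemma colour_change_vertex k : 0 < k -> bd k -> vertex_of (at_pos tau r k) = v.
Proof.
case: k => // k _; rewrite /colour_change /kp /= => ne.
have E : vertex_of (at_pos tau r k.+1) = vertex_of (tree_flip (at_pos tau r k)).
  by rewrite /at_pos /= tauE vertex_of_sigma.
apply: (colour_cut E); rewrite eq_sym /tree_flip.
by case: ifP => _; rewrite ?colour_alpha.
Qed.

(** All changes of colour occur at the cut vertex, which lies on one side of a given tree edge. *)
Lemma tree_edge_span x k l : tree x -> pos x < pos (alpha x) ->
  0 < k < #|D| -> 0 < l < #|D| -> bd k -> bd l ->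
  (pos x < k <= pos (alpha x)) = (pos x < l <= pos (alpha x)).
Proof.
move=> xT lt /andP[k0 kD] /andP[l0 lD] bk bl.
have [s sx] := noncrossing_side nct xT.
have E : s (at_pos tau r k) = s (at_pos tau r l).
  by case: sx => s1 _ _; apply: vertex_invariant => //; rewrite !colour_change_vertex.
move: E; rewrite !(side_inside (at_pos tau r _) sx) // /inside !(at_posK tourP) //.
by case: (s x); do 2!case: (pos x < _ <= _).
Qed.

(** A chord leaving the interval spans exactly one of its two bounds, so by [tree_edge_span] it is
    not a tree edge. Its ends have the same colour, so the change that it spans comes with a second
    one. *)
Lemma leaving_chord i j : 0 < i -> i < j -> j < #|D| -> bd i -> bd j ->
  ~~ closed_interval i j ->
  exists x i' j', [/\ ~~ tree x, (i <= pos x < j) (+) (i <= pos (alpha x) < j) &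
    [/\ pos x < i', i' < j', j' <= pos (alpha x), bd i' & bd j']].
Proof.
move=> i0 ij jD bi bj /forallPn[y]; rewrite negb_imply => /andP[yi yo].
have [x [lt xio]] : exists x, pos x < pos (alpha x) /\
    (i <= pos x < j) (+) (i <= pos (alpha x) < j).
  have [lt|lt|/pos_inj/esym/eqP] := ltngtP (pos y) (pos (alpha y)).
  - by exists y; rewrite yi (negbTE yo).
  - by exists (alpha y); rewrite alphaK yi (negbTE yo).
  - by rewrite alpha_neq.
have iD : 0 < i < #|D| by rewrite i0 (ltn_trans ij).
have jD' : 0 < j < #|D| by rewrite (ltn_trans i0).
have span : (pos x < i <= pos (alpha x)) (+) (pos x < j <= pos (alpha x)).
  move: xio lt ij; clear; move: (pos x) (pos (alpha x)) => p q; lia.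
have xN : ~~ tree x.
  by apply/negP => xT; move: span; rewrite (tree_edge_span xT lt iD jD' bi bj) addbb.
have [k hk bk] : exists2 k, pos x < k <= pos (alpha x) & bd k.
  by move: span; case hi: (_ < i <= _); [exists i | move=> ?; exists j].
have E : kp (pos x) = kp (pos (alpha x)) by rewrite !kp_pos colour_alpha.
have [i' [j' h]] := colour_change_twice E hk bk.
by exists x, i', j'.
Qed.

(** If the interval between the two changes is not closed, a chord leaving it is a cotree edge. It
    may not cross [x], so it is nested under [x]; it again spans two changes and is shorter. *)
Lemma cotree_edge_span x i j : ~~ tree x ->
  pos x < i -> i < j -> j <= pos (alpha x) -> bd i -> bd j ->
  exists i j, [/\ 0 < i, i < j, j <= #|D| & closed_interval i j].
Proof.
have [n] := ubnP (pos (alpha x) - pos x).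
elim: n x i j => // n IH x i j le xN xi ij jx bi bj.
have i0 : 0 < i by exact: leq_ltn_trans xi.
have jD : j < #|D| by apply: leq_ltn_trans jx (pos_lt _).
case: (boolP (closed_interval i j)) => [cl|].
  by exists i, j; split=> //; exact: ltnW.
case/leaving_chord=> // y [i' [j' [yN yio [h1 h2 h3 bi' bj']]]].
have fx : cotree_flip x = alpha x by rewrite /cotree_flip (negbTE xN).
have fy : cotree_flip y = alpha y by rewrite /cotree_flip (negbTE yN).
have fay : cotree_flip (alpha y) = y.
  by rewrite /cotree_flip edge_of_alpha (negbTE yN) alphaK.
have := (noncrossingP _ _ ncc) x y; have := (noncrossingP _ _ ncc) x (alpha y).
rewrite fx fy fay => nc1 nc2.
apply: (IH y i' j') => //.
have lty : pos y < pos (alpha y) by apply: (leq_trans h1); exact: leq_trans (ltnW h2) h3.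
move: nc1 nc2 yio lty xi ij jx le; clear.
move: (pos x) (pos (alpha x)) (pos y) (pos (alpha y)) => a b c d; lia.
Qed.

Lemma bicoloured_closed_interval x1 x2 : colour x1 -> ~~ colour x2 ->
  exists i j, [/\ 0 < i, i < j, j <= #|D| & closed_interval i j].
Proof.
move=> k1 k2.
have [i /andP[i0 iD] bi] : exists2 i, 0 < i < #|D| & bd i.
  have [x kx] : exists x, kp 0 != kp (pos x).
    by case k0: (kp 0); [exists x2|exists x1]; rewrite kp_pos; move: k1 k2;
      do 2!case: (colour _).
  have [i /andP[hi hx] bi] := colour_change_exists (leq0n _) kx.
  by exists i => //; rewrite hi (leq_ltn_trans hx).
have [/existsP[j /andP[j0 /andP[ne bj]]]|/existsPn no] :=
  boolP [exists j : 'I_#|D|, [&& 0 < j, j != i :> nat & bd j]].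
  have [lo [hi [lo0 lohi hiD blo bhi]]] :
      exists lo hi, [/\ 0 < lo, lo < hi, hi < #|D|, bd lo & bd hi].
    have [lt|gt|E] := ltngtP i j; [by exists i, j|by exists j, i|].
    by rewrite E eqxx in ne.
  case: (boolP (closed_interval lo hi)) => [cl|].
    by exists lo, hi; split=> //; exact: ltnW.
  by case/leaving_chord => // y [i' [j' [yN _ [h1 h2 h3 bi' bj']]]];
    exact: (cotree_edge_span yN h1 h2).
(* There is a single change, so the positions from [i] on form a colour class, which the matching
   preserves. *)
exists i, #|D|; split=> //.
have one k : 0 < k -> k < #|D| -> bd k -> k = i.
  move=> k0 kD bk; have := no (Ordinal kD); rewrite /= bk k0 andbT /= negbK.
  by move/eqP.
have k0i : kp 0 = kp i.-1.
  apply: no_colour_change => // k /andP[k0 ki]; apply/negP => /(one _ k0) E.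
  have lt : k < i by rewrite -(prednK i0).
  by have := lt; rewrite E ?ltnn // (ltn_trans lt).
have col x : (i <= pos x < #|D|) = (colour x != kp 0).
  rewrite pos_lt andbT -kp_pos; have [le|lt] := leqP i (pos x).
    have <- : kp i = kp (pos x).
      apply: no_colour_change => // k /andP[ik kx]; apply/negP => /one E.
      by have := ik; rewrite E ?ltnn ?(leq_ltn_trans kx) ?(ltn_trans i0).
    by rewrite k0i eq_sym; apply/esym.
  have <- : kp 0 = kp (pos x).
    apply: no_colour_change => // k /andP[k0 kx]; apply/negP => /one E.
    have ki := leq_ltn_trans kx lt.
    by have := ki; rewrite E ?ltnn // (leq_ltn_trans kx).
  by rewrite eqxx.
by apply/closed_intervalP => x; rewrite !col colour_alpha.
Qed.

End CutVertex.

(* The tour changes colour only at the cut vertex. A chord leaving the interval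
   between two changes cannot be a tree edge, since it would separate
   occurrences of the cut vertex; and a shortest chord over a change is not a
   cotree edge either. *)
Lemma separable_closed_interval :
  noncrossing pos tree_flip -> noncrossing pos cotree_flip -> separable m ->
  exists i j, [/\ 0 < i, i < j, j <= #|D| & closed_interval i j].
Proof.
move=> nct ncc /existsP[E1 /existsP[E2 /and5P[n1 n2 /eqP E12 dis /cards1P[v vE]]]].
have sE1 : E1 \subset edges m by rewrite -E12 subsetUl.
have sE2 : E2 \subset edges m by rewrite -E12 subsetUr.
have kE2 x : (edge_of x \in E2) = (edge_of x \notin E1).
  have : edge_of x \in E1 :|: E2 by rewrite E12 imset_f.
  rewrite inE; case: (boolP (edge_of x \in E1)) => //= h _.
  by apply/negP => h2; move/pred0P: dis => /(_ (edge_of x)); rewrite /= h h2.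
have cut x y : vertex_of x = vertex_of y ->
    (edge_of x \in E1) != (edge_of y \in E1) -> vertex_of x = v.
  move=> xy ne; have : vertex_of x \in [set v0 in vertices m | incident v0 E1 && incident v0 E2].
    rewrite !inE mem_vertices /=; apply/andP; split; apply/incidentP => //.
      by move: ne; case kx: (edge_of x \in E1) => /= ne; [exists x|exists y => //; case: (_ \in _) ne].
    move: ne; case kx: (edge_of x \in E1) => /= ne; last by exists x => //; rewrite kE2 kx.
    by exists y => //; rewrite kE2; case: (_ \in _) ne.
  by rewrite vE inE => /eqP.
have [e1 e1E] := set0Pn _ n1; have [e2 e2E] := set0Pn _ n2.
have /imsetP[x1 _ x1E] := subsetP sE1 _ e1E.
have /imsetP[x2 _ x2E] := subsetP sE2 _ e2E.
rewrite x1E in e1E; rewrite x2E -/(edge_of x2) kE2 in e2E.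
by apply: (bicoloured_closed_interval _ cut nct ncc e1E e2E) => x; rewrite edge_of_alpha.
Qed.

Lemma separableE : noncrossing pos tree_flip -> noncrossing pos cotree_flip ->
  separable m = [exists i : 'I_#|D|.+1, exists j : 'I_#|D|.+1,
                   (0 < i < j) && closed_interval i j].
Proof.
move=> nct ncc; apply/idP/existsP.
  case/(separable_closed_interval nct ncc) => i [j [i0 ij jD cl]].
  have iD : i < #|D|.+1 by rewrite ltnS (leq_trans (ltnW ij)).
  by exists (Ordinal iD); apply/existsP; exists (Ordinal (jD : j < #|D|.+1)); rewrite /= i0 ij.
case=> i /existsP[j /andP[/andP[i0 ij]]].
by apply: closed_interval_separable; rewrite // -ltnS.
Qed.

End Positions.
End TreeTour.

(** * Arc diagrams *)

Definition letter_count (c o : bool) (w : seq letter) : nat := count_mem (c, o) w.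

Lemma letter_count_cons c o l w :
  letter_count c o (l :: w) = (l == (c, o)) + letter_count c o w.
Proof. by []. Qed.

Lemma run_count i j i' j' (w : seq letter) : run (i, j) w = Some (i', j') ->
  i + letter_count true true w = i' + letter_count true false w /\
  j + letter_count false true w = j' + letter_count false false w.
Proof.
elim: w i j => [|[c o] w IH] i j; first by case=> <- <-.
rewrite !letter_count_cons.
by case: c; case: o; case: i => [|i]; case: j => [|j] //= /IH; rewrite ?eqxx /=; lia.
Qed.

Lemma run_defined (s : nat * nat) (w : seq letter) :
  (forall k, letter_count true false (take k w) <= s.1 + letter_count true true (take k w) /\
     letter_count false false (take k w) <= s.2 + letter_count false true (take k w)) ->
  run s w != None.
Proof.
elim: w s => [|l w IH] s //= h.
case E: (step s l) => [s'|] /=.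
  apply: IH => k; have := h k.+1; rewrite take_cons !letter_count_cons.
  by move: s l E {h} => [i j] [[] []] /=; case: i => [|i]; case: j => [|j] //= [<-];
    rewrite ?eqxx /=; lia.
have := h 1; rewrite take_cons take0 !letter_count_cons.
by move: s l E {h} => [i j] [[] []] /=; case: i => [|i]; case: j => [|j] //=; lia.
Qed.

Lemma balancedP (w : seq letter) :
  reflect ((forall c k, letter_count c false (take k w) <= letter_count c true (take k w))
           /\ forall c, letter_count c false w = letter_count c true w)
          (balanced w).
Proof.
apply: (iffP eqP) => [h|[h1 h2]].
  split=> [c k|c]; last by case: (run_count h); case: c; lia.
  move: h; rewrite -{1}(cat_take_drop k w) run_cat.
  by case E: (run _ _) => [[i j]|] //= _; case: (run_count E); case: c; lia.
have := @run_defined (0, 0) w; case E: (run _ _) => [[i j]|] /=.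
  move=> _; case: (run_count E); have := h2 true; have := h2 false.
  by move=> e1 e2 ? ?; congr (Some (_, _)); lia.
by move=> /(_ _)/negP; case=> // k; rewrite !add0n; split; exact: h1.
Qed.

Lemma irreducibleP (w : seq letter) :
  reflect [/\ w != [::], balanced w &
             forall i j, 0 < i < j -> j <= size w -> ~~ balanced (drop i (take j w))]
          (irreducible w).
Proof.
rewrite /irreducible; case: w => [|l w] /=; first by apply: ReflectF => -[].
apply: (iffP andP) => [[bw /balanced_freeP h]|[_ bw h]]; split=> //.
  move=> [|i] [|j] //= hij hj; apply: h; lia.
by apply/balanced_freeP => i j hij; apply: (h i.+1 j.+1); lia.
Qed.

(** * Two-colour diagrams and their words *)

Section Diagrams.
Variable N : nat.
Local Notation D := 'I_N.
Local Notation pos := (@nat_of_ord N).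
Implicit Types (x : {perm D} * {set D}) (d : D).

(** A diagram is a matching [x.1] together with the set [x.2] of the ends of its first-colour
    chords. *)
Definition colour_flip x (c : bool) d : D := if (d \in x.2) == c then x.1 d else d.

Definition interval_closed x (i j : nat) :=
  [forall d : D, (i <= d < j) ==> (i <= x.1 d < j)].

Definition two_colour_diagram x :=
  [&& fixfree_involution x.1, [forall d, (x.1 d \in x.2) == (d \in x.2)],
      noncrossing pos (colour_flip x true) & noncrossing pos (colour_flip x false)].

Definition prime_diagram x := two_colour_diagram x &&
  ~~ [exists i : 'I_N.+1, exists j : 'I_N.+1, (0 < i < j) && interval_closed x i j].

Definition letter_at x d : letter := (d \in x.2, d < x.1 d).
Definition word x : N.-tuple letter := [tuple letter_at x i | i < N].

Definition factor_count x c o i j := #|[set d : D | (i <= d < j) && (letter_at x d == (c, o))]|.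

Lemma count_factor x c o i j : j <= N ->
  letter_count c o (drop i (take j (word x))) = factor_count x c o i j.
Proof.
move=> jN; rewrite /letter_count /word /= /mktuple /= -[X in take j X]/(map _ (enum D)) -map_take -map_drop count_map.
set s := drop i (take j (enum D)).
have us : uniq s by rewrite /s drop_uniq // take_uniq // enum_uniq.
have ms d : (d \in s) = (i <= d < j).
  rewrite -(mem_map val_inj) /s map_drop map_take val_enum_ord.
  by rewrite take_iota drop_iota mem_iota /=; have := ltn_ord d; lia.
rewrite -size_filter -(card_uniqP _) ?filter_uniq //.
by apply: eq_card => d; rewrite !inE mem_filter ms andbC.
Qed.

Lemma factor_count_split x c o i b j : i <= b -> b <= j ->
  factor_count x c o i j = factor_count x c o i b + factor_count x c o b j.
Proof.
move=> ib bj; rewrite /factor_count -cardsUI (_ : _ :&: _ = set0) ?cards0 ?addn0.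
  apply: eq_card => d; rewrite !inE -andb_orl; congr (_ && _).
  move: (nat_of_ord d) => k; lia.
apply/setP => d; rewrite !inE andbACA; move: (nat_of_ord d) => k.
by have -> : (i <= k < b) && (b <= k < j) = false by lia.
Qed.

Lemma balanced_factorP x i j : i <= j -> j <= N ->
  reflect ((forall c b, i <= b -> b <= j ->
              factor_count x c false i b <= factor_count x c true i b)
           /\ forall c, factor_count x c false i j = factor_count x c true i j)
          (balanced (drop i (take j (word x)))).
Proof.
move=> ij jN; apply: (iffP (balancedP _)) => -[h1 h2]; split=> [c b|c].
- move=> ib bj; have := h1 c (b - i).
  by rewrite take_drop take_takel ?subnK // ?count_factor // (leq_trans bj).
- by rewrite -!count_factor.
- rewrite take_drop -take_min !count_factor ?geq_min ?jN ?orbT //.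
  have [le|lt] := leqP (b + i) j; last by rewrite h2.
  by apply: h1 => //; exact: leq_addl.
- by rewrite !count_factor.
Qed.

Section OneDiagram.
Variable x : {perm D} * {set D}.
Hypothesis diag : two_colour_diagram x.
Local Notation alpha := x.1.

Lemma chordK : involutive alpha.
Proof. by case/and4P: diag => /forallP h _ _ _ d; case/andP: (h d) => _ /eqP. Qed.

Lemma chord_neq d : val (alpha d) != d.
Proof. by case/and4P: diag => /forallP h _ _ _; case/andP: (h d). Qed.

Lemma chord_colour d : (alpha d \in x.2) = (d \in x.2).
Proof. by case/and4P: diag => _ /forallP h _ _; apply/eqP. Qed.

Lemma chord_noncrossing (a b : D) : a < b < alpha a -> (b \in x.2) = (a \in x.2) -> a < alpha b < alpha a.
Proof.
move=> h e; case/and4P: diag => _ _ h1 h2.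
have [nct ncf] := (noncrossingP _ _ h1 a b, noncrossingP _ _ h2 a b).
by case aC': (a \in x.2); [move: nct|move: ncf];
  rewrite /colour_flip e aC' /= => /(_ h).
Qed.

Lemma letter_chord d c o : letter_at x d = (c, o) -> letter_at x (alpha d) = (c, ~~ o).
Proof.
rewrite /letter_at chord_colour chordK => -[-> <-]; congr pair.
by have := chord_neq d; rewrite -leqNgt ltn_neqAle; case: ltngtP.
Qed.

Lemma letter_opener (d : D) c : letter_at x d = (c, true) -> d < alpha d.
Proof. by case. Qed.

Lemma letter_closer (d : D) c : letter_at x d = (c, false) -> alpha d < d.
Proof.
by rewrite /letter_at => -[_ h]; rewrite ltn_neqAle (chord_neq d) leqNgt h.
Qed.

Lemma letter_colour (d : D) c o : letter_at x d = (c, o) -> (d \in x.2) = c.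
Proof. by case. Qed.

Lemma factor_count_le c o i j :
  (forall d, i <= d < j -> letter_at x d = (c, o) -> i <= alpha d < j) ->
  factor_count x c o i j <= factor_count x c (~~ o) i j.
Proof.
move=> h; rewrite /factor_count -(card_imset _ (can_inj chordK)).
apply/subset_leq_card/subsetP => _ /imsetP[d dP ->].
move: dP; rewrite inE => /andP[dij /eqP ld].
by rewrite inE h //= (letter_chord ld).
Qed.

(** The matching injects the letters of one kind into the opposite ones, and the image misses [d],
    whose partner lies outside. *)
Lemma factor_count_lt c o i j (d : D) :
  i <= d < j -> letter_at x d = (c, ~~ o) -> ~~ (i <= alpha d < j) ->
  (forall e : D, i <= e < j -> letter_at x e = (c, o) -> i <= alpha e < j) ->
  factor_count x c o i j < factor_count x c (~~ o) i j.
Proof.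
move=> dij ld nd h; rewrite /factor_count -(card_imset _ (can_inj chordK)).
apply: proper_card; apply/properP; split.
  apply/subsetP => _ /imsetP[e eP ->]; move: eP; rewrite inE => /andP[eij /eqP le].
  by rewrite inE h //= (letter_chord le).
exists d; first by rewrite inE dij ld eqxx.
apply/imsetP => -[e]; rewrite inE => /andP[eij _] E.
by move: nd; rewrite E chordK eij.
Qed.

(** In a prefix of a closed factor each closer comes after its opener, so closers are never in
    excess. *)
Lemma closed_factor_balanced i j : i <= j -> j <= N -> interval_closed x i j ->
  balanced (drop i (take j (word x))).
Proof.
move=> ij jN /forallP cl'; have cl (d : D) : i <= d < j -> i <= alpha d < j by apply/implyP.
apply/balanced_factorP => //; split=> [c b ib bj|c].
  apply: factor_count_le => d /andP[h1 h2] /letter_closer lt.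
  have := cl d; move: (nat_of_ord d) (nat_of_ord (alpha d)) h1 h2 lt bj; clear; lia.
by apply/eqP; rewrite eqn_leq !factor_count_le // => d h _; exact: cl.
Qed.

(** Suppose that the chord of [d] leaves the factor. If [d] opens, noncrossing puts the openers of
    all closers of its colour after [d] in the factor, and [d] creates an excess of openers at the
    end. If [d] closes, the prefix up to [d] has too many closers. *)
Lemma balanced_factor_closed i j : i <= j -> j <= N ->
  balanced (drop i (take j (word x))) -> interval_closed x i j.
Proof.
move=> ij jN /(balanced_factorP _ ij jN)[h1 h2].
apply/forallP => d; apply/implyP => /andP[id dj]; apply: contraT => no.
case ld: (letter_at x d) => [c []].
  have := h1 c d id (ltnW dj); have := h2 c.
  rewrite !(factor_count_split _ _ _ id (ltnW dj)).
  suff : factor_count x c false d j < factor_count x c true d j by clear; lia.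
  have ad := letter_opener ld.
  have jad : j <= alpha d by move: no id ad; clear; lia.
  apply: (@factor_count_lt c false d j d) => //; first by rewrite leqnn.
    by rewrite negb_and -!ltnNge ltnS jad orbT.
  move=> e /andP[de ej] le; have ae := letter_closer le.
  have de' : d < e.
    rewrite ltn_neqAle de andbT; apply/eqP => /val_inj E.
    by move: le; rewrite -E ld.
  have := @chord_noncrossing d e; rewrite de' (leq_trans ej) // => /(_ isT).
  rewrite (letter_colour le) (letter_colour ld) => /(_ erefl) /andP[/ltnW -> _].
  by rewrite (ltn_trans ae).
have ad := letter_closer ld.
have := h1 c d.+1 (leqW id) dj.
suff : factor_count x c true i d.+1 < factor_count x c false i d.+1 by clear; lia.
apply: (@factor_count_lt c true i d.+1 d) => //; first by rewrite id leqnn.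
  by move: no dj ad; clear; lia.
have adi : alpha d < i by move: no dj ad; clear; lia.
move=> e /andP[ie ed] le; have ae := letter_opener le.
have ed' : e < d.
  rewrite ltn_neqAle -ltnS ed andbT; apply/eqP => /val_inj E.
  by move: le; rewrite E ld.
have := @chord_noncrossing (alpha d) e; rewrite chordK ed' (leq_trans adi) // => /(_ isT).
rewrite (letter_colour le) chord_colour (letter_colour ld) => /(_ erefl) /andP[_ h].
by rewrite (leq_trans ie (ltnW ae)) ltnW.
Qed.

Lemma word_balanced : balanced (word x).
Proof.
have := @closed_factor_balanced 0 N; rewrite drop0 take_oversize ?size_tuple //.
by apply=> //; apply/forallP => d; apply/implyP => _; rewrite ltn_ord.
Qed.

Lemma prime_diagramE : 0 < N -> prime_diagram x = irreducible (word x).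
Proof.
move=> N0; rewrite /prime_diagram diag andTb; apply/existsPn/irreducibleP => [h|[_ _ h] i].
  split; [by rewrite -size_eq0 size_tuple -lt0n|exact: word_balanced|].
  move=> i j /andP[i0 ij]; rewrite size_tuple => jN; apply/negP => b.
  have iN : i < N.+1 by rewrite ltnS; exact: leq_trans (ltnW ij) jN.
  have /existsPn/(_ (Ordinal (jN : j < N.+1)))/negP := h (Ordinal iN); apply.
  by rewrite /= i0 ij; apply: balanced_factor_closed => //; exact: ltnW.
apply/existsPn => j; apply/negP => /andP[ij cl].
have jN : j <= N by rewrite -ltnS.
have := h i j ij; rewrite size_tuple => /(_ jN)/negP; apply.
by apply: closed_factor_balanced => //; case/andP: ij => _ /ltnW.
Qed.

End OneDiagram.

Lemma word_letter x y : word x = word y -> forall d, letter_at x d = letter_at y d.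
Proof.
by move=> E d; have := congr1 (fun w => tnth w d) E; rewrite !tnth_mktuple.
Qed.

(** Were [d] closed later in [y], the letters from [d] to its partner in [x] would have strictly
    more openers than closers of its colour according to [y], and not more according to [x]. *)
Lemma eq_word_opener x y d : two_colour_diagram x -> two_colour_diagram y ->
  (forall e, letter_at x e = letter_at y e) -> d < x.1 d -> y.1 d <= x.1 d.
Proof.
move=> dx dy l dxd; rewrite leqNgt; apply/negP => lt.
have ld : letter_at x d = (d \in x.2, true) by rewrite /letter_at dxd.
set c := d \in x.2 in ld.
have E o i j : factor_count x c o i j = factor_count y c o i j.
  by apply: eq_card => e; rewrite !inE l.
have : factor_count x c true d (x.1 d).+1 <= factor_count x c false d (x.1 d).+1.
  apply: (factor_count_le dx (o := true)) => e /andP[de ed] le.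
  have [->|ne] := eqVneq e d; first by rewrite (ltnW dxd) ltnS leqnn.
  have de' : d < e by rewrite ltn_neqAle de andbT eq_sym.
  have ed' : e < x.1 d.
    rewrite ltn_neqAle -ltnS ed andbT; apply/eqP => /val_inj Ee.
    by have := letter_chord dx ld; rewrite -Ee le.
  have := chord_noncrossing dx (a := d) (b := e).
  rewrite de' ed' (letter_colour le) => /(_ isT erefl) /andP[h1 h2].
  by rewrite (ltnW h1) (ltn_trans h2).
apply/negP; rewrite -ltnNge !E; rewrite l in ld.
apply: (factor_count_lt dy (o := false) (d := d)) => //.
- by rewrite leqnn ltnS ltnW.
- by rewrite negb_and -!ltnNge ltnS lt orbT.
move=> e /andP[de ed] le; have ae := letter_closer dy le.
have de' : d < e.
  by rewrite ltn_neqAle de andbT; apply/eqP => /val_inj Ee; move: le; rewrite -Ee ld.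
have := chord_noncrossing dy (a := d) (b := e).
rewrite de' (leq_ltn_trans _ lt) // (letter_colour le) (letter_colour ld).
move=> /(_ isT erefl) /andP[/ltnW -> _].
exact: ltn_trans ae ed.
Qed.

Lemma word_inj x y : two_colour_diagram x -> two_colour_diagram y ->
  word x = word y -> x = y.
Proof.
move=> dx dy /word_letter l.
have l' d : letter_at y d = letter_at x d by [].
have opn d : (d < x.1 d) = (d < y.1 d) by case: (l d).
have op d : d < x.1 d -> x.1 d = y.1 d.
  move=> lt; apply/val_inj/eqP; rewrite eqn_leq (eq_word_opener dx dy) //.
  by rewrite (eq_word_opener dy dx) // -opn.
have E d : x.1 d = y.1 d.
  have [/op//|ge] := ltnP d (x.1 d).
  have lt : x.1 d < d.
    by rewrite ltn_neqAle ge andbT; exact: chord_neq.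
  have := op (x.1 d); rewrite (chordK dx) => /(_ lt) {2}->.
  by rewrite (chordK dy).
case: x y l l' {dx dy opn op} E => [a C] [a' C'] l _ /= E.
congr pair; first by apply/permP.
by apply/setP => d; case: (l d).
Qed.

(** * Matching the parentheses of a balanced word *)

Section Matching.
Variable w : N.-tuple letter.
Hypothesis bw : balanced w.

(** The height of colour [c] after [k] letters; the truncated subtraction is exact because [w] is
    balanced. *)
Let h c k := letter_count c true (take k w) - letter_count c false (take k w).

Let h0 c : h c 0 = 0.
Proof. by rewrite /h take0. Qed.

Let hN c : h c N = 0.
Proof.
case/balancedP: bw => _ e; rewrite /h take_oversize ?size_tuple // e.
exact: subnn.
Qed.

Let hS c (i : D) :
  h c i.+1 + (tnth w i == (c, false)) = h c i + (tnth w i == (c, true)).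
Proof.
case/balancedP: bw => le _; have := le c i; have := le c i.+1.
rewrite /h (tnth_nth (true, true)) /=.
rewrite (take_nth (true, true)) ?size_tuple // -cats1 /letter_count !count_cat /= !addn0.
move: (count_mem _ _) (count_mem _ _) => p q.
have [->|_] := eqVneq (nth _ _ _) (c, true).
  have -> : ((c, true) == (c, false)) = false by rewrite xpair_eqE eqxx.
  lia.
by case: eqVneq => _; lia.
Qed.

Let h_up c (i : D) : h c i < h c i.+1 -> tnth w i = (c, true) /\ h c i.+1 = (h c i).+1.
Proof.
have := hS c i; case: (tnth w i =P (c, true)) => [->|_]; last by lia.
have -> : ((c, true) == (c, false)) = false by rewrite xpair_eqE eqxx.
by move=> E _; split=> //; lia.
Qed.

Let h_down c (i : D) : h c i.+1 < h c i -> tnth w i = (c, false) /\ h c i = (h c i.+1).+1.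
Proof.
have := hS c i; case: (tnth w i =P (c, false)) => [->|_]; last by lia.
have -> : ((c, false) == (c, true)) = false by rewrite xpair_eqE eqxx.
by move=> E _; split=> //; lia.
Qed.

Let h_open c (i : D) : tnth w i = (c, true) -> h c i.+1 = (h c i).+1.
Proof.
by have := hS c i => + E; rewrite E eqxx xpair_eqE eqxx /=; lia.
Qed.

Let h_close c (i : D) : tnth w i = (c, false) -> h c i = (h c i.+1).+1.
Proof.
by have := hS c i => + E; rewrite E eqxx xpair_eqE eqxx /=; lia.
Qed.

(** The closer [j] makes the first return of the height to its value before [i]. *)
Let matched (c : bool) (i j : D) : bool :=
  [&& tnth w i == (c, true), tnth w j == (c, false), i < j, h c i == h c j.+1
    & [forall k : D, (i < k <= j) ==> (h c i < h c k)]].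

Let matched_above c i j (k : D) : matched c i j -> i < k <= j -> h c i < h c k.
Proof. by case/and5P => _ _ _ _ /forallP/(_ k)/implyP; apply. Qed.

Let matched_bottom c i j : matched c i j -> h c i = h c j.+1.
Proof. by case/and5P => _ _ _ /eqP. Qed.

Let opener_matched c i : tnth w i = (c, true) -> exists j, matched c i j.
Proof.
move=> wi; have hi := h_open wi.
have ex0 : exists k, (i < k) && (h c k <= h c i) by exists N; rewrite hN ltn_ord.
case: (ex_minnP ex0) => k /andP[ik hk] kmin.
have kN : k <= N by apply: kmin; rewrite hN ltn_ord.
case: k ik hk kmin kN => // k ik hk kmin kN.
have above l : i < l -> l <= k -> h c i < h c l.
  move=> il lk; rewrite ltnNge; apply/negP => hl.
  by have := kmin l; rewrite il hl => /(_ isT); lia.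
have ik' : i < k.
  rewrite ltn_neqAle -ltnS ik andbT; apply/eqP => E.
  by move: hk; rewrite -E hi; lia.
have hk1 := above k ik' (leqnn k).
have [wk hk'] := @h_down c (Ordinal kN) (leq_ltn_trans hk hk1).
exists (Ordinal kN); apply/and5P; split; rewrite ?wi ?wk //.
  by apply/eqP; move: hk' => /=; lia.
by apply/forallP => l; apply/implyP => /andP[il lk]; apply: above.
Qed.

(** The opener is at the last earlier time when the height was not above its value after [j];
    [opener_matched] uses the first later time instead. *)
Let closer_matched c j : tnth w j = (c, false) -> exists i, matched c i j.
Proof.
move=> wj; have hj := h_close wj.
have ex0 : exists k, (k <= j) && (h c k <= h c j.+1) by exists 0; rewrite h0.
have bnd k : (k <= j) && (h c k <= h c j.+1) -> k <= j by case/andP.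
case: (ex_maxnP ex0 bnd) => i /andP[ij hi] imax.
have above l : i < l -> l <= j -> h c j.+1 < h c l.
  move=> il lj; rewrite ltnNge; apply/negP => hl.
  by have := imax l; rewrite lj hl => /(_ isT); lia.
have ij' : i < j.
  rewrite ltn_neqAle ij andbT; apply/eqP => E.
  by move: hi; rewrite E hj; lia.
have iN : i < N by exact: ltn_trans ij' (ltn_ord j).
have hi1 := above i.+1 (ltnSn i) ij'.
have [wi hi'] := @h_up c (Ordinal iN) (leq_ltn_trans hi hi1).
have E : h c i = h c j.+1 by move: hi' => /=; lia.
exists (Ordinal iN); apply/and5P; split; rewrite ?wi ?wj //=; first by rewrite E.
by apply/forallP => l; apply/implyP => /andP[il lk]; rewrite E; apply: above.
Qed.

Let matched_unique_closer c i j j' : matched c i j -> matched c i j' -> j = j'.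
Proof.
suff lem k k' : matched c i k -> matched c i k' -> ~~ (k < k').
  move=> m m'; apply/val_inj; have := lem _ _ m m'; have := lem _ _ m' m.
  by case: ltngtP.
move=> m m'; apply/negP => lt; have kN : k.+1 < N by exact: leq_ltn_trans lt (ltn_ord _).
have := @matched_above c i k' (Ordinal kN) m'; rewrite /= -(matched_bottom m) ltnn.
by case/and5P: m => _ _ ik _ _; rewrite lt (ltn_trans ik) //; move/(_ isT).
Qed.

Let matched_unique_opener c i i' j : matched c i j -> matched c i' j -> i = i'.
Proof.
suff lem k k' : matched c k j -> matched c k' j -> ~~ (k < k').
  move=> m m'; apply/val_inj; have := lem _ _ m m'; have := lem _ _ m' m.
  by case: ltngtP.
move=> m m'; apply/negP => lt; have := @matched_above c k j k' m.
rewrite (matched_bottom m) (matched_bottom m') ltnn lt.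
by case/and5P: m' => _ _ kj _ _; rewrite (ltnW kj); move/(_ isT).
Qed.

Let linked i j := let c := (tnth w i).1 in matched c i j || matched c j i.

Let matched_colour c i j : matched c i j -> (tnth w i).1 = c /\ (tnth w j).1 = c.
Proof. by case/and5P => /eqP -> /eqP ->. Qed.

Let linked_sym i j : linked i j -> linked j i.
Proof.
by rewrite /linked => /orP[] m; have [e1 e2] := matched_colour m;
  [rewrite e2 -?e1|rewrite e1 -?e2]; rewrite m ?orbT.
Qed.

Let matched_open c i j : matched c i j -> (tnth w i).2 /\ ~~ (tnth w j).2.
Proof. by case/and5P => /eqP -> /eqP ->. Qed.

Let linked_unique i j j' : linked i j -> linked i j' -> j = j'.
Proof.
move=> /orP[] m /orP[] m'.
- exact: matched_unique_closer m m'.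
- by have [o _] := matched_open m; have [_] := matched_open m'; rewrite o.
- by have [o _] := matched_open m'; have [_] := matched_open m; rewrite o.
- exact: matched_unique_opener m m'.
Qed.

Let linked_exists i : exists j, linked i j.
Proof.
rewrite /linked; case E: (tnth w i) => [c []].
  by have [j m] := opener_matched E; exists j; rewrite /= m.
by have [j m] := closer_matched E; exists j; rewrite /= m orbT.
Qed.

(** The default [i] is never taken, by [linked_exists]. *)
Let partner i := odflt i [pick j | linked i j].

Let partnerP i : linked i (partner i).
Proof.
rewrite /partner; case: pickP => [j //|no]; have [j lj] := linked_exists i.
by rewrite no in lj.
Qed.

Let partnerK : involutive partner.
Proof.
by move=> i; apply: linked_unique (partnerP _) _; apply: linked_sym; exact: partnerP.
Qed.

Let partner_open c i : tnth w i = (c, true) -> matched c i (partner i).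
Proof.
move=> E; have := partnerP i; rewrite /linked E /= => /orP[] // m.
by have [_] := matched_open m; rewrite E.
Qed.

Let partner_close c i : tnth w i = (c, false) -> matched c (partner i) i.
Proof.
move=> E; have := partnerP i; rewrite /linked E /= => /orP[] // m.
by have [] := matched_open m; rewrite E.
Qed.

Let partner_lt (i : D) : (i < partner i) = (tnth w i).2.
Proof.
case E: (tnth w i) => [c []] /=.
  by case/and5P: (partner_open E) => _ _ ->.
by case/and5P: (partner_close E) => _ _ lt _ _; rewrite ltnNge ltnW.
Qed.

Let partner_neq i : partner i != i.
Proof.
have := partnerP i; rewrite /linked.
by case/orP => /and5P[_ _ lt _ _]; apply/eqP => E; rewrite E ltnn in lt.
Qed.

(** If the partner of [b] were outside, the two chords would cross, and each would have to stay
    strictly above the bottom level of the other. *)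
Let matched_nested c (i j b : D) : matched c i j -> i < b < j -> (tnth w b).1 = c ->
  i < partner b < j.
Proof.
move=> m /andP[ib bj]; case E: (tnth w b) => [c' []] /= cE; rewrite cE in E.
  have m' := partner_open E.
  case/and5P: (m') => _ _ lt _ _; rewrite (ltn_trans ib lt) /=.
  rewrite ltnNge; apply/negP => ge.
  have [Ej|ne] := eqVneq (partner b) j.
    by rewrite Ej in m'; have := matched_unique_opener m m' => Ei; rewrite Ei ltnn in ib.
  have lt' : j < partner b by rewrite ltn_neqAle ge andbT eq_sym.
  have jN : j.+1 < N by apply: leq_ltn_trans (ltn_ord (partner b)).
  have := @matched_above c b (partner b) (Ordinal jN) m'.
  have := @matched_above c i j b m; rewrite ib (ltnW bj) /= -(matched_bottom m) lt'.
  rewrite ltnS (ltnW bj).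
  by move=> /(_ isT) h1 /(_ isT) h2; have := ltn_trans h1 h2; rewrite ltnn.
have m' := partner_close E.
case/and5P: (m') => _ _ lt _ _; rewrite (ltn_trans lt bj) andbT.
rewrite ltnNge; apply/negP => ge.
have [Ei|ne] := eqVneq (partner b) i.
  by rewrite Ei in m'; have := matched_unique_closer m m' => Ej; rewrite Ej ltnn in bj.
have bN : b.+1 < N by exact: leq_ltn_trans bj (ltn_ord j).
have := @matched_above c i j (Ordinal bN) m.
have := @matched_above c (partner b) b i m'.
have lt' : partner b < i by rewrite ltn_neqAle ge andbT.
rewrite (ltnW ib) lt' /= (matched_bottom m') bj ltnS (ltnW ib).
by move=> /(_ isT) h1 /(_ isT) h2; have := ltn_trans h1 h2; rewrite ltnn.
Qed.

Lemma word_surj : exists2 x, two_colour_diagram x & word x = w.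
Proof.
exists (perm (can_inj partnerK), [set i | (tnth w i).1]); last first.
  apply: eq_from_tnth => i; rewrite tnth_mktuple /letter_at inE permE partner_lt.
  by rewrite -surjective_pairing.
have col i : (tnth w (partner i)).1 = (tnth w i).1.
  by have := partnerP i; rewrite /linked => /orP[] /matched_colour[].
apply/and4P; split.
- by apply/forallP => d; rewrite !permE partnerK eqxx partner_neq.
- by apply/forallP => d; rewrite !inE permE col.
- apply/noncrossingP => a b; rewrite /colour_flip !inE !permE.
  case Ca: (tnth w a).1 => /= /andP[ab bp]; last by have := ltn_trans ab bp; rewrite ltnn.
  have := partner_lt a; rewrite (ltn_trans ab bp) => /esym oa.
  have Ea : tnth w a = (true, true) by rewrite [tnth w a]surjective_pairing Ca oa.
  case Cb: (tnth w b).1; last by rewrite /= ab bp.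
  by apply: (matched_nested (partner_open Ea)); rewrite ?ab.
- apply/noncrossingP => a b; rewrite /colour_flip !inE !permE.
  case Ca: (tnth w a).1 => /= /andP[ab bp]; first by have := ltn_trans ab bp; rewrite ltnn.
  have := partner_lt a; rewrite (ltn_trans ab bp) => /esym oa.
  have Ea : tnth w a = (false, true) by rewrite [tnth w a]surjective_pairing Ca oa.
  case Cb: (tnth w b).1; first by rewrite /= ab bp.
  by apply: (matched_nested (partner_open Ea)); rewrite ?ab.
Qed.

End Matching.

Lemma card_prime_diagrams : 0 < N -> #|[set x | prime_diagram x]| = num_irreducible N.
Proof.
move=> N0; rewrite /num_irreducible /word_count -(@card_in_imset _ _ word); last first.
  by move=> x y; rewrite !inE => /andP[dx _] /andP[dy _]; exact: word_inj.
rewrite -big_mkcond sum1_card; apply: eq_card => w; rewrite -[RHS]/(irreducible w).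
apply/imsetP/idP => [[x]|iw].
  by rewrite inE => px ->; rewrite -prime_diagramE //; case/andP: px.
have [|x dx wx] := @word_surj w; first by case/irreducibleP: iw.
by exists x => //; rewrite inE prime_diagramE // wx.
Qed.

End Diagrams.

(** * From isomorphism classes to diagrams *)

Lemma tour_position_exists (D : finType) (tau : {perm D}) (r : D) :
  (forall x, x \in porbit tau r) -> exists pos, tour_position tau r pos.
Proof.
move=> tr; pose t := traject tau r #|D|.
have cardE : #|porbit tau r| = #|D|.
  by apply: eq_card => x; rewrite tr.
have ut : uniq t by rewrite /t -cardE uniq_traject_porbit.
have mt x : x \in t by rewrite /t -cardE -porbit_traject.
have st : size t = #|D| by rewrite size_traject.
have lt x : index x t < #|D| by rewrite -st index_mem.
have nthE k : k < #|D| -> nth r t k = iter k tau r by move=> lk; rewrite /t nth_traject.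
have D0 : 0 < #|D| by rewrite (leq_ltn_trans _ (lt r)).
exists (index^~ t); split=> //.
- by move=> x y /= E; rewrite -(nth_index r (mt x)) -[RHS](nth_index r (mt y)) E.
- by rewrite -{1}[r]/(iter 0 tau r) -nthE // index_uniq // st.
move=> x; set k := index x t.
have xE : tau x = iter k.+1 tau r by rewrite iterS -(nthE _ (lt x)) nth_index.
case: eqP => E.
  by rewrite xE E -cardE iter_porbit -{1}[r]/(iter 0 tau r) -nthE // index_uniq // st.
have ltk : k.+1 < #|D| by have := lt x; rewrite -/k; lia.
by rewrite xE -nthE // index_uniq // st.
Qed.

Lemma noncrossing_conj (D E : finType) (g : D -> E) (pos : E -> nat)
    (t : D -> D) (t' : E -> E) : bijective g -> (forall x, t' (g x) = g (t x)) ->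
  noncrossing pos t' = noncrossing (pos \o g) t.
Proof.
move=> [g' gK g'K] tE; apply/noncrossingP/noncrossingP => h a b /=.
  by have := h (g a) (g b); rewrite !tE.
by have /= := h (g' a) (g' b); rewrite -!tE !g'K.
Qed.

Section Isomorphic.
Variable D : finType.
Implicit Types mT : rotation_system D * {set {set D}}.

Lemma isomorphic_refl mT : isomorphic mT mT.
Proof.
apply/existsP; exists 1%g; apply/and4P; split.
- by apply/forallP => d; rewrite !perm1.
- by apply/forallP => d; rewrite !perm1.
- by rewrite perm1.
- apply/eqP; rewrite -[RHS]imset_id; apply: eq_imset => A.
  by rewrite -[RHS]imset_id; apply: eq_imset => x; rewrite perm1.
Qed.

Lemma isomorphic_sym mT mT' : isomorphic mT mT' -> isomorphic mT' mT.
Proof.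
case/existsP => f /and4P[/forallP h1 /forallP h2 /eqP h3 /eqP h4].
apply/existsP; exists f^-1%g; apply/and4P; split.
- by apply/forallP => d; apply/eqP/(canLR (permK f)); rewrite (eqP (h1 _)) permKV.
- by apply/forallP => d; apply/eqP/(canLR (permK f)); rewrite (eqP (h2 _)) permKV.
- by rewrite -h3 permK.
- rewrite -h4 -imset_comp -[X in _ == X]imset_id; apply/eqP.
  apply: eq_imset => A /=; rewrite -imset_comp -[RHS]imset_id.
  by apply: eq_imset => x /=; rewrite permK.
Qed.

Lemma isomorphic_trans mT mT' mT'' :
  isomorphic mT mT' -> isomorphic mT' mT'' -> isomorphic mT mT''.
Proof.
case/existsP => f /and4P[/forallP h1 /forallP h2 /eqP h3 /eqP h4].
case/existsP => g /and4P[/forallP k1 /forallP k2 /eqP k3 /eqP k4].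
apply/existsP; exists (f * g)%g; apply/and4P; split.
- by apply/forallP => d; rewrite !permM (eqP (h1 _)) (eqP (k1 _)).
- by apply/forallP => d; rewrite !permM (eqP (h2 _)) (eqP (k2 _)).
- by rewrite permM h3 k3.
- rewrite -k4 -h4 -imset_comp; apply/eqP; apply: eq_imset => A /=.
  by rewrite -imset_comp; apply: eq_imset => x /=; rewrite permM.
Qed.

End Isomorphic.

Section Classes.
Variables (N : nat) (r0 : 'I_N).
Hypothesis r0E : r0 = 0 :> nat.
Local Notation D := 'I_N.
Local Notation pos := (@nat_of_ord N).
Implicit Types (x y : {perm D} * {set D}).

(** The tour of the representative of a class: half-edges are numbered by their positions, so the
    tour is the cyclic successor. *)
Let shift : {perm D} := perm (@ordS_inj N).

Let shift_tour : tour_position shift r0 pos.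
Proof.
split=> //; first exact: val_inj; first by move=> d; rewrite card_ord.
move=> d; rewrite permE /= card_ord; case: eqP => [->|ne]; first exact: modnn.
by rewrite modn_small //; have := ltn_ord d; lia.
Qed.

(* The default permutation is a junk value: [colour_flip] is injective on two-colour
   diagrams. *)
Definition map_of_diagram x : rotation_system D * {set {set D}} :=
  (RotationSystem x.1
     (odflt 1%g [pick s : {perm D} | [forall d, s d == ordS (colour_flip x true d)]]) r0,
   [set porbit x.1 d | d in x.2]).

Section OneDiagram.
Variable x : {perm D} * {set D}.
Hypothesis diag : two_colour_diagram x.
Let m := (map_of_diagram x).1.
Let T := (map_of_diagram x).2.

Lemma colour_flipK c : involutive (colour_flip x c).
Proof.
move=> d; rewrite /colour_flip; case E: ((d \in x.2) == c); last by rewrite E.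
by rewrite (chord_colour diag) E (chordK diag).
Qed.

Lemma map_of_diagram_vertex d : vertex_perm m d = ordS (colour_flip x true d).
Proof.
rewrite /m /=; case: pickP => [s /forallP/(_ d)/eqP //|no].
have inj : injective (fun d : D => ordS (colour_flip x true d)).
  by move=> a b /ordS_inj/(can_inj (@colour_flipK true)).
by have /forallP[] := no (perm inj); move=> e; rewrite permE.
Qed.

Let alphaP : fixfree_involution (edge_perm m).
Proof. by case/and4P: diag. Qed.

Lemma map_of_diagram_tree d : (edge_of m d \in T) = (d \in x.2).
Proof.
apply/imsetP/idP => [[e eC /eqP]|dC]; last by exists d.
rewrite -[porbit _ e]/(edge_of m e) edge_of_eq // => /orP[]/eqP -> //.
by rewrite (chord_colour diag).
Qed.

Let TE : T \subset edges m.
Proof. by apply/subsetP => _ /imsetP[d _ ->]; exact: imset_f. Qed.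

Let tree_flipE : tree_flip m T =1 colour_flip x true.
Proof.
by move=> d; rewrite /tree_flip map_of_diagram_tree /colour_flip eqb_id.
Qed.

Let tauE d : shift d = vertex_perm m (tree_flip m T d).
Proof. by rewrite permE map_of_diagram_vertex tree_flipE colour_flipK. Qed.

Let cotree_flipE : cotree_flip m T =1 colour_flip x false.
Proof.
by move=> d; rewrite /cotree_flip map_of_diagram_tree /colour_flip; case: (d \in x.2).
Qed.

Lemma eq_noncrossing (E : finType) (p : E -> nat) (t t' : E -> E) :
  t =1 t' -> noncrossing p t = noncrossing p t'.
Proof.
by move=> h; apply: eq_forallb => a; apply: eq_forallb => b; rewrite !h.
Qed.

Lemma map_of_diagram_mem :
  (map_of_diagram x \in tree_rooted_2connected_maps D) = prime_diagram x.
Proof.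
case/and4P: (diag) => _ _ nct ncc.
have nct' : noncrossing pos (tree_flip m T) by rewrite (eq_noncrossing _ tree_flipE).
have ncc' : noncrossing pos (cotree_flip m T) by rewrite (eq_noncrossing _ cotree_flipE).
rewrite inE -/m -/T (planar_mapE alphaP TE tauE shift_tour) // ncc'.
rewrite (spanning_treeE alphaP TE tauE shift_tour) nct' /=.
rewrite (separableE alphaP TE tauE shift_tour) //.
by rewrite /prime_diagram diag card_ord.
Qed.

End OneDiagram.

(** An isomorphism commutes with the tour and fixes the root, hence is the identity. *)
Lemma map_of_diagram_inj x y : two_colour_diagram x -> two_colour_diagram y ->
  isomorphic (map_of_diagram x) (map_of_diagram y) -> x = y.
Proof.
move=> dx dy /existsP[f /and4P[/forallP h1 /forallP h2 /eqP h3 /eqP h4]].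
have fa d : f (x.1 d) = y.1 (f d) by exact/eqP/h1.
have fs d : f (ordS (colour_flip x true d)) = ordS (colour_flip y true (f d)).
  by rewrite -!map_of_diagram_vertex //; exact/eqP/h2.
have fe d : f @: porbit x.1 d = porbit y.1 (f d).
  have ax : fixfree_involution x.1 by case/and4P: dx.
  have ay : fixfree_involution y.1 by case/and4P: dy.
  have := @edge_ofE _ (map_of_diagram x).1 ax d; rewrite /edge_of /= => ->.
  have := @edge_ofE _ (map_of_diagram y).1 ay (f d); rewrite /edge_of /= => ->.
  by rewrite imsetU !imset_set1 fa.
have fC d : (f d \in y.2) = (d \in x.2).
  have := map_of_diagram_tree dy (f d); rewrite -h4 /edge_of /= -fe => <-.
  have := map_of_diagram_tree dx d; rewrite /edge_of /= => <-.
  apply/imsetP/idP => [[e eT /(imset_inj (@perm_inj _ f)) ->] //|dT].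
  by exists (porbit x.1 d).
have ff d : f (colour_flip x true d) = colour_flip y true (f d).
  by rewrite /colour_flip fC; case: ifP; rewrite ?fa.
have fS d : f (ordS d) = ordS (f d).
  rewrite -{1}[d](colour_flipK dx true) fs; congr (ordS _).
  by rewrite ff (colour_flipK dy).
have fid d : f d = d.
  apply: (tour_ind shift_tour (A := fun d => f d = d)) => [|e fe']; first exact: h3.
  by rewrite permE fS fe'.
case: x y fa fC {dx dy h1 h2 h3 h4 fs fe ff} => [a C] [a' C'] /= fa fC.
congr pair; first by apply/permP => d; have := fa d; rewrite !fid.
by apply/setP => d; rewrite -fC fid.
Qed.

(** The relabelling [g] sends each half-edge to its position on the tour; the diagram is the
    matching and the tree transported by [g]. *)
Lemma map_of_diagram_surj mT : mT \in tree_rooted_2connected_maps D ->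
  exists2 x, prime_diagram x & isomorphic (map_of_diagram x) mT.
Proof.
case: mT => [m T] mTS; have := mTS; rewrite inE /= => /and3P[pl st nsep].
have alphaP : fixfree_involution (edge_perm m) by case/and3P: pl.
have TE : T \subset edges m by case/and3P: st.
have tinj : injective (fun d => vertex_perm m (tree_flip m T d)).
  by move=> a b /perm_inj/(can_inj (tree_flipK T alphaP)).
pose tau := perm tinj.
have tauE d : tau d = vertex_perm m (tree_flip m T d) by rewrite permE.
have [p tp] := tour_position_exists
  (fun d => @tour_is_cycle _ _ _ alphaP _ tauE (root m) d st).
have [p_inj p_lt p_r p_tau] := tp.
have plt d : p d < N by rewrite -[N]card_ord.
pose g0 d : D := Ordinal (plt d).
have g0_inj : injective g0 by move=> a b [] /p_inj.
pose g : {perm D} := perm g0_inj.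
have gE d : g d = p d :> nat by rewrite permE.
have gtau d : g (tau d) = ordS (g d).
  apply: val_inj; rewrite /= !gE p_tau card_ord; case: eqP => [->|ne].
    by rewrite modnn.
  by rewrite modn_small //; have := plt d; lia.
pose x := ((edge_perm m ^ g)%g, [set g d | d in [pred d | edge_of m d \in T]]).
have xa d : x.1 (g d) = g (edge_perm m d) by rewrite permJ.
have xC d : (g d \in x.2) = (edge_of m d \in T).
  by rewrite mem_imset; last exact: perm_inj.
have gbij : bijective g by exists (g^-1)%g; [exact: permK|exact: permKV].
have gs (P : D -> Prop) : (forall d, P (g d)) -> forall d, P d.
  by move=> h d; rewrite -[d](permKV g).
have ft d : colour_flip x true (g d) = g (tree_flip m T d).
  by rewrite /colour_flip /tree_flip xC eqb_id xa; case: ifP.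
have fn d : colour_flip x false (g d) = g (cotree_flip m T d).
  by rewrite /colour_flip /cotree_flip xC xa; case: (_ \in _).
have nc_p (t : D -> D) : noncrossing (pos \o g) t = noncrossing p t.
  by apply: eq_forallb => a; apply: eq_forallb => b; rewrite /= !gE.
have nct : noncrossing p (tree_flip m T).
  by rewrite -(spanning_treeE alphaP TE tauE tp).
have ncc : noncrossing p (cotree_flip m T).
  by rewrite -(planar_mapE alphaP TE tauE tp).
have dx : two_colour_diagram x.
  apply/and4P; split.
  - apply/forallP; apply: gs => d; rewrite !xa (inj_eq (@perm_inj _ g)).
    by rewrite (alpha_neq alphaP) (alphaK alphaP) eqxx.
  - by apply/forallP; apply: gs => d; rewrite xa !xC edge_of_alpha.
  - by rewrite (noncrossing_conj _ gbij ft) nc_p.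
  - by rewrite (noncrossing_conj _ gbij fn) nc_p.
have iso : isomorphic (map_of_diagram x) (m, T).
  apply/existsP; exists (g^-1)%g; apply/and4P; split.
  - by apply/forallP; apply: gs => d; rewrite [edge_perm _ _]xa !permK.
  - apply/forallP; apply: gs => d; rewrite (map_of_diagram_vertex dx) ft -gtau.
    by rewrite !permK tauE (tree_flipK T alphaP).
  - apply/eqP/(canLR (permK g)); apply: val_inj.
    by rewrite /= gE p_r r0E.
  - have E d : g^-1%g @: porbit x.1 (g d) = edge_of m d.
      have ax : fixfree_involution x.1 by case/and4P: dx.
      have := @edge_ofE _ (map_of_diagram x).1 ax (g d); rewrite {1}/edge_of /= => ->.
      by rewrite imsetU !imset_set1 xa !permK (edge_ofE alphaP).
    apply/eqP/setP => A; apply/imsetP/idP => [[_ /imsetP[d' dC ->] ->]|AT].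
      move: dC => /imsetP[d dT ->]; by rewrite E.
    have /imsetP[d _ dA] := subsetP TE _ AT.
    exists (porbit x.1 (g d)); last by rewrite E dA.
    by apply: imset_f; rewrite xC /edge_of -dA.
exists x => //; rewrite /prime_diagram dx /=.
apply: contra nsep; rewrite (separableE alphaP TE tauE tp) //.
rewrite !card_ord => /existsP[i /existsP[j /andP[ij /forallP cl]]].
apply/existsP; exists i; apply/existsP; exists j; rewrite ij /=.
by apply/forallP => d; have := cl (g d); rewrite xa !gE.
Qed.

Lemma card_isomorphic_classes :
  #|equivalence_partition (@isomorphic D) (tree_rooted_2connected_maps D)| = num_irreducible N.
Proof.
set S := tree_rooted_2connected_maps D.
have N0 : 0 < N by exact: leq_ltn_trans (ltn_ord r0).
pose cls x := [set mT in S | isomorphic (map_of_diagram x) mT].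
rewrite -card_prime_diagrams // -(@card_in_imset _ _ cls).
  apply: eq_card => A; apply/imsetP/imsetP => [[mT mTS ->]|[x]].
    have [x px iso] := map_of_diagram_surj mTS; exists x; first by rewrite inE.
    apply/setP => mT'; rewrite !inE; congr (_ && _); apply/idP/idP => h.
      exact: isomorphic_trans iso h.
    exact: isomorphic_trans (isomorphic_sym iso) h.
  rewrite inE => px ->; exists (map_of_diagram x) => //.
  by rewrite /S map_of_diagram_mem //; case/andP: px.
move=> x y; rewrite !inE => px py E.
have [dx _] := andP px; have [dy _] := andP py.
have : map_of_diagram y \in cls y.
  by rewrite inE /S map_of_diagram_mem // py isomorphic_refl.
by rewrite -E inE => /andP[_]; exact: map_of_diagram_inj.
Qed.

End Classes.

(** * From letters to edges *)

Lemma b_num_irreducible n : 0 < n -> b n = num_irreducible n.*2.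
Proof.
case: n => // n _; exact: (@card_isomorphic_classes _ (Ordinal (isT : 0 < n.+1.*2))).
Qed.

Lemma sum_even (F : nat -> nat) n : (forall i, odd i -> F i = 0) ->
  \sum_(i < (2 * n).+1) F i = \sum_(i < n.+1) F (2 * i).
Proof.
move=> F0; elim: n => [|n IH]; first by rewrite !big_ord_recr !big_ord0.
rewrite [RHS]big_ord_recr /= -IH mulnS !addSn !big_ord_recr /=.
by rewrite (F0 (2 * n).+1) ?addn0 ?add0n //= oddM.
Qed.

Lemma conv_pow_even k n : conv_pow num_balanced k (2 * n) = conv_pow (fun i => num_balanced (2 * i)) k n.
Proof.
elim: k n => [|k IH] n /=; first by rewrite muln_eq0.
rewrite (@sum_even (fun i => num_balanced i * conv_pow num_balanced k (2 * n - i))).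
  by apply: eq_bigr => i _; rewrite -mulnBr IH.
by move=> i oi; rewrite num_balanced_odd.
Qed.

Lemma num_irreducible_le n : num_irreducible n <= num_balanced n.
Proof.
apply: leq_sum => w _; rewrite /irreducible.
by case: (balanced w); rewrite ?andbF ?leq_b1.
Qed.

Lemma tree_rooted_block_decomposition n :
  num_balanced (2 * n) = \sum_(k < n.+1) b k * conv_pow (fun i => num_balanced (2 * i)) (2 * k) (n - k).
Proof.
case: n => [|n].
  by rewrite big_ord_recr big_ord0 muln0 /num_balanced word_count0.
rewrite num_balanced_conv // (@sum_even (fun k => num_irreducible k * conv_pow num_balanced k (2 * n.+1 - k))).
  apply: eq_bigr => -[k lt] _; rewrite -mulnBr conv_pow_even.
  (* [b 0] is 1 although no irreducible word is empty, but for a positive size this term carries a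
     coefficient of a zeroth power, which vanishes. *)
  case: k lt => [|k] lt; first by rewrite /= !muln0.
  by rewrite b_num_irreducible // mul2n.
move=> i oi; have := num_irreducible_le i; rewrite num_balanced_odd // leqn0 => /eqP ->.
by rewrite mul0n.
Qed.

From Stdlib Require Import Reals Lra Psatz Factorial Machin Ranalysis5.
From Coquelicot Require Import Coquelicot.

Local Open Scope R_scope.

(** * Generating functions *)

(* The number of walks of length 2m + i + j from (i, j) to the origin that stay
   in the quarter plane. *)
Definition walk_formula (m i j : nat) : R :=
  (INR i + 1) * (INR j + 1) * INR (fact (2 * m + i + j)) * INR (fact (2 * m + i + j + 2)) /
  (INR (fact m) * INR (fact (m + i + 1)) * INR (fact (m + j + 1)) * INR (fact (m + i + j + 2))).

Lemma INR_factS n : INR (fact n.+1) = (INR n + 1) * INR (fact n).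
Proof. by rewrite fact_simpl mult_INR S_INR. Qed.

Ltac abstract_factorials :=
  repeat match goal with
  | |- context [INR (fact ?n)] =>
    generalize (INR_fact_neq_0 n); generalize (INR (fact n)); intros ? ?
  end.

(** First-step recurrence: the count at each neighbour is the common factor [K] times a polynomial,
    whose factor [INR m], [INR i] or [INR j] vanishes when that neighbour is too far from the origin
    or outside the quadrant. *)
Lemma num_walksE (k m i j : nat) : k = (2 * m + i + j)%nat -> INR (num_walks k i j) = walk_formula m i j.
Proof.
elim: k m i j => [|k IH] m i j E.
  have [-> [-> ->]] : m = 0%nat /\ i = 0%nat /\ j = 0%nat by lia.
  rewrite /num_walks word_count0 /walk_formula /=; field.
rewrite num_walksS !plus_INR.
pose K := INR (fact k) * INR (fact k.+2) /
  (INR (fact m) * INR (fact (m + i + 1)) * INR (fact (m + j + 1)) * INR (fact (m + i + j + 2))).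
have up1 : INR (num_walks k i.+1 j) =
    K * ((INR i + 2) * (INR j + 1) * INR m * (INR m + INR j + 1)).
  rewrite /K; case: m E {K} => [|m] E; first by rewrite num_walks_eq0 ?INR_0; [ring|lia].
  rewrite (IH m); last by lia.
  rewrite /walk_formula.
  have -> : (2 * m + i.+1 + j = k)%nat by lia.
  have -> : (k + 2 = k.+2)%nat by lia.
  have -> : (m + i.+1 + 1 = m.+1 + i + 1)%nat by lia.
  have -> : (m + i.+1 + j + 2 = m.+1 + i + j + 2)%nat by lia.
  have -> : (m.+1 + j + 1 = (m + j + 1).+1)%nat by lia.
  rewrite (INR_factS m) (INR_factS (m + j + 1)); abstract_factorials; rewrite !plus_INR !S_INR !INR_0.
  have := pos_INR m; have := pos_INR i; have := pos_INR j => pj pi pm.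
  by field; do !split=> //; lra.
have up2 : INR (num_walks k i j.+1) =
    K * ((INR i + 1) * (INR j + 2) * INR m * (INR m + INR i + 1)).
  rewrite /K; case: m E {K up1} => [|m] E; first by rewrite num_walks_eq0 ?INR_0; [ring|lia].
  rewrite (IH m); last by lia.
  rewrite /walk_formula.
  have -> : (2 * m + i + j.+1 = k)%nat by lia.
  have -> : (k + 2 = k.+2)%nat by lia.
  have -> : (m + j.+1 + 1 = m.+1 + j + 1)%nat by lia.
  have -> : (m + i + j.+1 + 2 = m.+1 + i + j + 2)%nat by lia.
  have -> : (m.+1 + i + 1 = (m + i + 1).+1)%nat by lia.
  rewrite (INR_factS m) (INR_factS (m + i + 1)); abstract_factorials; rewrite !plus_INR !S_INR !INR_0.
  have := pos_INR m; have := pos_INR i; have := pos_INR j => pj pi pm.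
  by field; do !split=> //; lra.
have dn1 : INR (if i is i'.+1 then num_walks k i' j else 0%nat) =
    K * (INR i * (INR j + 1) * (INR m + INR i + 1) * (INR m + INR i + INR j + 2)).
  rewrite /K; case: i E {K up1 up2} => [|i] E; first by rewrite INR_0; ring.
  rewrite (IH m); last by lia.
  rewrite /walk_formula.
  have -> : (2 * m + i + j = k)%nat by lia.
  have -> : (k + 2 = k.+2)%nat by lia.
  have -> : (m + i.+1 + 1 = (m + i + 1).+1)%nat by lia.
  have -> : (m + i.+1 + j + 2 = (m + i + j + 2).+1)%nat by lia.
  rewrite (INR_factS (m + i + 1)) (INR_factS (m + i + j + 2)); abstract_factorials; rewrite !plus_INR !S_INR !INR_0.
  have := pos_INR m; have := pos_INR i; have := pos_INR j => pj pi pm.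
  by field; do !split=> //; lra.
have dn2 : INR (if j is j'.+1 then num_walks k i j' else 0%nat) =
    K * ((INR i + 1) * INR j * (INR m + INR j + 1) * (INR m + INR i + INR j + 2)).
  rewrite /K; case: j E {K up1 up2 dn1} => [|j] E; first by rewrite INR_0; ring.
  rewrite (IH m); last by lia.
  rewrite /walk_formula.
  have -> : (2 * m + i + j = k)%nat by lia.
  have -> : (k + 2 = k.+2)%nat by lia.
  have -> : (m + j.+1 + 1 = (m + j + 1).+1)%nat by lia.
  have -> : (m + i + j.+1 + 2 = (m + i + j + 2).+1)%nat by lia.
  rewrite (INR_factS (m + j + 1)) (INR_factS (m + i + j + 2)); abstract_factorials; rewrite !plus_INR !S_INR !INR_0.
  have := pos_INR m; have := pos_INR i; have := pos_INR j => pj pi pm.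
  by field; do !split=> //; lra.
rewrite up1 up2 dn1 dn2 /walk_formula -E /K.
have -> : (k.+1 + 2 = k.+3)%nat by lia.
rewrite (INR_factS k) (INR_factS k.+2).
have -> : INR k.+2 = INR k + 2 by rewrite !S_INR; lra.
have -> : INR k = 2 * INR m + INR i + INR j - 1.
  have : INR k.+1 = INR (2 * m + i + j) by rewrite E.
  rewrite mul2n -addnn S_INR !plus_INR; lra.
by abstract_factorials; field; do !split; lra.
Qed.

(** The right-hand side is Cat_n Cat_(n+1). *)
Lemma num_balanced_even n : INR (num_balanced (2 * n)) =
  INR (fact (2 * n)) * INR (fact (2 * n + 2)) /
  (INR (fact n) * INR (fact (n + 1)) * INR (fact (n + 1)) * INR (fact (n + 2))).
Proof.
rewrite -[num_balanced _]/(num_walks _ 0 0) (@num_walksE _ n 0 0) ?addn0 // /walk_formula !addn0 /=.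
by congr (_ / _); ring.
Qed.

(** * The Wallis product and the squared ratios (binom(2n,n) / 4^n)^2 *)

Fixpoint central_ratio (n : nat) : R :=
  match n with
  | O => 1
  | S k => central_ratio k * ((2 * INR k + 1) / (2 * INR k + 2)) ^ 2
  end.

Definition wallis (n : nat) : R := RInt (fun x => sin x ^ n) 0 (PI / 2).

Lemma ex_RInt_sin_pow n a b : ex_RInt (fun x => sin x ^ n) a b.
Proof.
apply: ex_RInt_continuous => z _; apply: ex_derive_continuous.
by auto_derive.
Qed.

Lemma wallis_rec n : (INR n + 2) * wallis (S (S n)) = (INR n + 1) * wallis n.
Proof.
(* The boundary term of an integration by parts, which vanishes at both ends. *)
pose F x := - (cos x * sin x ^ S n).
have D : is_RInt (fun x => (INR n + 2) * sin x ^ S (S n) - (INR n + 1) * sin x ^ n)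
    0 (PI / 2) (F (PI / 2) - F 0).
  apply: is_RInt_derive => x _.
    rewrite /F; auto_derive => //.
    rewrite -[match n with O => 1 | S _ => INR n + 1 end]/(INR (S n)) S_INR.
    have c2 : cos x * cos x = 1 - sin x * sin x by have := sin2_cos2 x; rewrite /Rsqr; lra.
    transitivity (sin x * sin x * sin x ^ n - (cos x * cos x) * (INR n + 1) * sin x ^ n).
      by ring.
    by rewrite c2 /=; ring.
  apply: ex_derive_continuous; by auto_derive.
have I n' := RInt_correct _ _ _ (ex_RInt_sin_pow n' 0 (PI / 2)).
have D' := is_RInt_minus _ _ _ _ _ _ (is_RInt_scal _ _ _ (INR n + 2) _ (I (S (S n))))
  (is_RInt_scal _ _ _ (INR n + 1) _ (I n)).
have E := is_RInt_unique _ _ _ _ D.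
have E' := is_RInt_unique _ _ _ _ D'.
have : (INR n + 2) * wallis (S (S n)) - (INR n + 1) * wallis n = F (PI / 2) - F 0.
  by rewrite -E -[LHS]E'.
rewrite /F cos_PI2 cos_0 sin_0 /=; lra.
Qed.

Lemma INR_double n : INR (2 * n) = 2 * INR n.
Proof. by rewrite mul2n -addnn plus_INR; ring. Qed.

Lemma wallis0 : wallis 0 = PI / 2.
Proof. by rewrite /wallis /= RInt_const /scal /= /mult /=; lra. Qed.

Lemma wallis1 : wallis 1 = 1.
Proof.
have D : is_RInt (fun x => sin x ^ 1) 0 (PI / 2) (- cos (PI / 2) - - cos 0).
  apply: (is_RInt_derive (fun x => - cos x)) => x _.
    by auto_derive => //; rewrite /=; ring.
  by apply: ex_derive_continuous; auto_derive.
by rewrite /wallis (is_RInt_unique _ _ _ _ D) cos_PI2 cos_0; lra.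
Qed.

Lemma wallis_decr n : wallis (S n) <= wallis n.
Proof.
have pi := PI_RGT_0.
apply: RInt_le; [lra|exact: ex_RInt_sin_pow|exact: ex_RInt_sin_pow|].
move=> x hx; have s0 : 0 <= sin x by apply: sin_ge_0; lra.
have s1 := SIN_bound x; have := pow_le _ n s0; rewrite /=.
by move=> h; rewrite -[X in _ <= X]Rmult_1_l; apply: Rmult_le_compat_r; lra.
Qed.

(** [p] is binom(2n,n) / 4^n, the positive square root of the central ratio. *)
Lemma wallis_even_odd n :
  exists2 p, 0 < p /\ p ^ 2 = central_ratio n &
    wallis (2 * n) = PI / 2 * p /\ wallis (2 * n + 1) * ((2 * INR n + 1) * p) = 1.
Proof.
elim: n => [|n [p [p0 pE] [e o]]].
  exists 1; first by simpl; lra.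
  by rewrite wallis0 wallis1 /=; lra.
have n0 := pos_INR n.
exists (p * ((2 * INR n + 1) / (2 * INR n + 2))).
  split; first by apply: Rmult_lt_0_compat => //; apply: Rdiv_lt_0_compat; lra.
  by rewrite /= -pE; ring.
have -> : (2 * S n = S (S (2 * n)))%nat by lia.
have -> : (S (S (2 * n)) + 1 = S (S (2 * n + 1)))%nat by lia.
have := wallis_rec (2 * n); have := wallis_rec (2 * n + 1).
rewrite plus_INR !INR_double -[INR 1]/1 S_INR e => h1 h2.
have w2 : wallis (S (S (2 * n + 1))) = (2 * INR n + 2) * wallis (2 * n + 1) / (2 * INR n + 3).
  have E1 : (2 * INR n + 3) * wallis (S (S (2 * n + 1))) = (2 * INR n + 2) * wallis (2 * n + 1) by lra.
  by rewrite -E1; field; lra.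
have w1 : wallis (S (S (2 * n))) = (2 * INR n + 1) * (PI / 2 * p) / (2 * INR n + 2).
  have E1 : (2 * INR n + 2) * wallis (S (S (2 * n))) = (2 * INR n + 1) * (PI / 2 * p) by lra.
  by rewrite -E1; field; lra.
split; first by rewrite w1; field; lra.
by rewrite w2 -[RHS]o; field; lra.
Qed.

(** The two bounds are W_(2n+1) <= W_(2n) and, for positive n, W_(2n) <= W_(2n-1), each divided by
    the odd integral. *)
Lemma central_ratio_bounds n :
  2 / (PI * (2 * INR n + 1)) <= central_ratio n /\ central_ratio n * INR n <= / PI.
Proof.
have pi := PI_RGT_0; have n0 := pos_INR n.
split.
  have [p [p0 <-] [e o]] := wallis_even_odd n.
  have := wallis_decr (2 * n); rewrite e.
  have -> : S (2 * n) = (2 * n + 1)%nat by lia.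
  move=> h; have h' := Rmult_le_compat_r ((2 * INR n + 1) * p) _ _ _ h.
  rewrite o in h'.
  have {h'}h1 := h' ltac:(apply: Rmult_le_pos; lra).
  apply: (Rmult_le_reg_r (PI * (2 * INR n + 1) / 2)).
    by apply: Rdiv_lt_0_compat; [apply: Rmult_lt_0_compat|]; lra.
  have -> : 2 / (PI * (2 * INR n + 1)) * (PI * (2 * INR n + 1) / 2) = 1 by field; lra.
  simpl; lra.
case: n n0 => [|n] n0; first by rewrite /= Rmult_0_r; left; apply: Rinv_0_lt_compat.
have [p [p0 pE] [e o]] := wallis_even_odd n.
have [p' [p0' pE'] [e' o']] := wallis_even_odd (S n).
have ppE : p' ^ 2 = (p * ((2 * INR n + 1) / (2 * INR n + 2))) ^ 2.
  by rewrite pE' /= -pE; ring.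
have n0' := pos_INR n.
have pp : p' = p * ((2 * INR n + 1) / (2 * INR n + 2)).
  apply: Rsqr_inj; [lra| |by rewrite !Rsqr_pow2].
  by apply: Rmult_le_pos; [lra|apply: Rdiv_le_0_compat; lra].
have := wallis_decr (2 * n + 1).
have -> : S (2 * n + 1) = (2 * S n)%nat by lia.
rewrite e' => h; have h' := Rmult_le_compat_r ((2 * INR n + 1) * p) _ _ _ h.
rewrite o in h'; have {h'}h1 := h' ltac:(apply: Rmult_le_pos; lra).
have E : (2 * INR n + 1) * p = (2 * INR n + 2) * p' by rewrite pp; field; lra.
rewrite E in h1; rewrite -pE' S_INR.
apply: (Rmult_le_reg_l PI) => //; rewrite Rinv_r; last lra.
simpl; lra.
Qed.

Lemma is_lim_central_ratio : is_lim_seq (fun n => central_ratio n * INR n) (/ PI).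
Proof.
have pi := PI_RGT_0.
apply: (is_lim_seq_le_le (fun n => / PI * (2 * (INR n / (2 * INR n + 1)))) _ (fun _ => / PI)).
- move=> n; have [h1 h2] := central_ratio_bounds n; split=> //.
  have n0 := pos_INR n.
  have := Rmult_le_compat_r _ _ _ n0 h1; apply: Rle_trans; right; field; lra.
- have E : is_lim_seq (fun n => / PI * (2 * (INR n / (2 * INR n + 1)))) (/ PI * (2 * (/ 2))).
    apply: is_lim_seq_mult'; first exact: is_lim_seq_const.
    apply: is_lim_seq_mult'; first exact: is_lim_seq_const.
    have L0 : is_lim_seq (fun n => / INR n) 0.
      have := @is_lim_seq_inv INR p_infty is_lim_seq_INR; exact.
    have L1 : is_lim_seq (fun n => 2 + / INR n) (2 + 0).
      apply: is_lim_seq_plus' => //; exact: is_lim_seq_const.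
    have L : is_lim_seq (fun n => / (2 + / (INR n))) (/ (2 + 0)).
      apply: (is_lim_seq_inv _ (2 + 0)) => // -[]; lra.
    rewrite Rplus_0_r in L; apply: is_lim_seq_ext_loc L.
    exists 1%nat => n hn; have : 1 <= INR n by exact: (le_INR 1).
    by move=> h; field; lra.
  have E0 : / PI * (2 * / 2) = / PI by field; lra.
  by rewrite E0 in E.
- exact: is_lim_seq_const.
Qed.

(** * Power series with nonnegative coefficients, up to the boundary *)

Lemma sum_n_incr (f : nat -> R) n : (forall k, 0 <= f k) -> sum_n f n <= sum_n f (S n).
Proof. by move=> f0; rewrite sum_Sn /plus /=; have := f0 (S n); lra. Qed.

Lemma sum_n_le_series (f : nat -> R) l n :
  (forall k, 0 <= f k) -> is_series f l -> sum_n f n <= l.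
Proof.
move=> f0 fl; apply: (is_lim_seq_incr_compare (sum_n f)) => // k.
exact: sum_n_incr.
Qed.

Lemma ex_series_bounded (f : nat -> R) C : (forall k, 0 <= f k) ->
  (forall n, sum_n f n <= C) -> ex_series f /\ Series f <= C.
Proof.
move=> f0 fC; have [|l fl] := ex_finite_lim_seq_incr (sum_n f) C _ fC.
  by move=> n; exact: sum_n_incr.
have sl : is_series f l by [].
split; first by exists l.
rewrite (is_series_unique _ _ sl).
exact: (is_lim_seq_le (sum_n f) (fun _ => C) l C fC fl (is_lim_seq_const C)).
Qed.

Section NonnegativePowerSeries.
Variable a : nat -> R.
Hypothesis a0 : forall n, 0 <= a n.

Lemma pow_term_ge0 x n : 0 <= x -> 0 <= a n * x ^ n.
Proof. by move=> x0; apply: Rmult_le_pos => //; exact: pow_le. Qed.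

Lemma ex_pseries_le x r : 0 <= x <= r -> ex_pseries a r -> ex_pseries a x.
Proof.
move=> [x0 xr]; rewrite !ex_pseries_R; apply: ex_series_le => n.
rewrite /norm /= /abs /= Rabs_pos_eq; last exact: pow_term_ge0.
by apply: Rmult_le_compat_l => //; exact: pow_incr.
Qed.

Lemma PSeries_correct_R x : ex_pseries a x -> is_series (fun n => a n * x ^ n) (PSeries a x).
Proof. by move=> h; apply/is_pseries_R; exact: PSeries_correct. Qed.

Lemma PSeries_mono x y : 0 <= x <= y -> ex_pseries a y -> PSeries a x <= PSeries a y.
Proof.
move=> xy ey; apply: Series_le; last by apply/ex_pseries_R.
move=> n; split; first by apply: pow_term_ge0; lra.
by apply: Rmult_le_compat_l => //; exact: pow_incr.
Qed.

Lemma PSeries_ge_head x : 0 <= x -> ex_pseries a x -> a 0%nat <= PSeries a x.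
Proof.
move=> x0 ex; have := sum_n_le_series 0 _ (PSeries_correct_R ex).
by rewrite sum_O /= Rmult_1_r; apply=> k; exact: pow_term_ge0.
Qed.

Lemma PSeries_ge0 x : 0 <= x -> ex_pseries a x -> 0 <= PSeries a x.
Proof. by move=> x0 ex; apply: Rle_trans (a0 0) _; exact: PSeries_ge_head. Qed.

Lemma continuous_polynomial n x : continuous (fun y => sum_n (fun k => a k * y ^ k) n) x.
Proof.
elim: n => [|n IH].
  apply: (continuous_ext (fun _ => a 0%nat)); last exact: continuous_const.
  by move=> y; rewrite sum_O /= Rmult_1_r.
apply: (continuous_ext (fun y => plus (sum_n (fun k => a k * y ^ k) n) (a (S n) * y ^ (S n)))).
  by move=> y; rewrite sum_Sn.
apply: continuous_plus => //; apply: continuous_mult; first exact: continuous_const.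
by apply: ex_derive_continuous; auto_derive.
Qed.

Lemma polynomial_at_left n x : filterlim (fun y => sum_n (fun k => a k * y ^ k) n)
  (at_left x) (locally (sum_n (fun k => a k * x ^ k) n)).
Proof.
apply: (filterlim_filter_le_1 _ _ (@continuous_polynomial n x)).
exact: filter_le_within.
Qed.

Variable r : R.
Hypothesis r0 : 0 < r.

Lemma at_left_between l : l < r -> at_left r (fun x => l < x < r).
Proof.
move=> lr; have d0 : 0 < r - l by lra.
exists (mkposreal _ d0) => x /=; rewrite /ball /= /AbsRing_ball /abs /minus /plus /opp /=.
by move=> /Rabs_def2 h xr; lra.
Qed.

(** Abel's theorem in the monotone case: to the left of [r] the value lies between a partial sum,
    which is continuous, and the value at [r]. *)
Lemma PSeries_at_left : ex_pseries a r ->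
  filterlim (PSeries a) (at_left r) (locally (PSeries a r)).
Proof.
move=> er; have sr := PSeries_correct_R er.
apply/filterlim_locally => eps.
have e2 : 0 < eps / 2 by have := cond_pos eps; lra.
have [N hN] := proj1 (filterlim_locally _ _) sr (mkposreal _ e2).
have {hN} := hN N (Nat.le_refl N).
rewrite /ball /= /AbsRing_ball /abs /minus /plus /opp /= => /Rabs_def2 [_ hN'].
have hN : - (eps / 2) < sum_n (fun k => a k * r ^ k) N - PSeries a r by exact: hN'.
have cN := proj1 (filterlim_locally _ _) (@polynomial_at_left N r) (mkposreal _ e2).
have {}cN := cN (@filter_filter _ _ (at_left_proper_filter r)).
apply: filter_imp (filter_and _ _ (at_left_between r0) cN) => x [[x0 xr]].
rewrite /ball /= /AbsRing_ball /abs /minus /plus /opp /= => /Rabs_def2 [_ h].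
have ex : ex_pseries a x by apply: ex_pseries_le er; lra.
have h1 : PSeries a x <= PSeries a r by apply: PSeries_mono => //; lra.
have h2 : sum_n (fun k => a k * x ^ k) N <= PSeries a x.
  by apply: sum_n_le_series; [move=> k; apply: pow_term_ge0; lra|exact: PSeries_correct_R].
have := cond_pos eps => e0.
rewrite /ball /= /AbsRing_ball /abs /minus /plus /opp /=; apply: Rabs_def1; lra.
Qed.

(** Each partial sum at [r] is a limit of partial sums at smaller points, which [C] bounds. This
    serves for B' at [rho_B] and, in the argument on the radius, for M'' at 1/16. *)
Lemma ex_pseries_of_bounded C :
  (forall x, 0 < x < r -> ex_pseries a x /\ PSeries a x <= C) ->
  ex_pseries a r /\ PSeries a r <= C.
Proof.
move=> h; rewrite ex_pseries_R; apply: ex_series_bounded.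
  by move=> k; apply: pow_term_ge0; lra.
move=> n.
have L : filterlim (fun x => sum_n (fun k => a k * x ^ k) n) (at_left r)
           (Rbar_locally (sum_n (fun k => a k * r ^ k) n)).
  exact: polynomial_at_left.
apply: (filterlim_le (fun x => sum_n (fun k => a k * x ^ k) n) (fun _ => C) _ C _ L
  (filterlim_const C)).
apply: filter_imp (at_left_between r0) => x hx; have [ex le] := h x hx.
apply: Rle_trans le; apply: sum_n_le_series; last exact: PSeries_correct_R.
by move=> k; apply: pow_term_ge0; lra.
Qed.

Lemma CV_radius_ge : ex_pseries a r -> Rbar_le r (CV_radius a).
Proof.
move=> er; apply: Rbar_not_lt_le => lt.
apply: (@CV_disk_outside a r); first by rewrite Rabs_pos_eq //; lra.
by apply: ex_series_lim_0; apply/ex_pseries_R.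
Qed.

Lemma inside_CV_radius x : ex_pseries a r -> 0 <= x < r -> Rbar_lt (Rabs x) (CV_radius a).
Proof.
move=> er hx; apply: Rbar_lt_le_trans (CV_radius_ge er).
by rewrite Rabs_pos_eq /=; lra.
Qed.

End NonnegativePowerSeries.

Ltac eq_in_R := match goal with |- @eq _ ?x ?y => change (@eq R x y) end.

(** * The series M and its derivative at 1/16 *)

Definition tree_rooted_coef (n : nat) : R := INR (num_balanced (2 * n)).

Lemma tree_rooted_coef_ge0 n : 0 <= tree_rooted_coef n.
Proof. exact: pos_INR. Qed.

Lemma sum_SnR (f : nat -> R) n : sum_n f n.+1 = sum_n f n + f n.+1.
Proof. exact: sum_Sn. Qed.

Lemma central_ratioS n : central_ratio n.+1 =
  central_ratio n * ((2 * INR n + 1) / (2 * INR n + 2)) ^ 2.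
Proof. by []. Qed.

Lemma central_ratioE n :
  central_ratio n = INR (fact (2 * n)) ^ 2 / INR (fact n) ^ 4 * (1 / 16) ^ n.
Proof.
elim: n => [|n IH]; first by rewrite /=; field.
rewrite central_ratioS IH.
have -> : (2 * n.+1 = (2 * n).+2)%nat by lia.
rewrite (INR_factS n) (INR_factS (2 * n).+1) (INR_factS (2 * n)).
have n0 := pos_INR n.
rewrite S_INR INR_double [(1 / 16) ^ n.+1]/=.
by abstract_factorials; field; do !split=> //; lra.
Qed.

(** As rational multiples of [central_ratio], the terms can be summed in closed form, and the Wallis
    product gives the limits. *)
Lemma tree_rooted_term n : tree_rooted_coef n * (1 / 16) ^ n =
  central_ratio n * (2 * (2 * INR n + 1) / ((INR n + 1) ^ 2 * (INR n + 2))).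
Proof.
rewrite central_ratioE /tree_rooted_coef num_balanced_even !addn2 !addn1.
rewrite (INR_factS n.+1) (INR_factS n) (INR_factS (2 * n).+1) (INR_factS (2 * n)).
have n0 := pos_INR n; rewrite !S_INR INR_double.
by abstract_factorials; field; do !split=> //; lra.
Qed.

(* The closed forms of the next two partial sums come from Gosper's algorithm. *)
Lemma sum_tree_rooted n : sum_n (fun k => tree_rooted_coef k * (1 / 16) ^ k) n =
  8 - 8 * (2 * INR n.+1 + 1) * (4 * INR n.+1 + 3) / (3 * (INR n.+1 + 1)) * central_ratio n.+1.
Proof.
elim: n => [|n IH]; first by rewrite sum_O tree_rooted_term /=; eq_in_R; field.
rewrite sum_SnR IH tree_rooted_term (central_ratioS n.+1).
have n0 := pos_INR n; rewrite !S_INR.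
by move: (central_ratio _) => q; eq_in_R; field; lra.
Qed.

Lemma sum_weighted_tree_rooted n :
  sum_n (fun k => INR k * (tree_rooted_coef k * (1 / 16) ^ k)) n =
  -8 + 8 * (2 * INR n.+1 + 1) * (5 * INR n.+1 + 3) / (3 * (INR n.+1 + 1)) * central_ratio n.+1.
Proof.
elim: n => [|n IH]; first by rewrite sum_O tree_rooted_term /=; eq_in_R; field.
rewrite sum_SnR IH tree_rooted_term (central_ratioS n.+1).
have n0 := pos_INR n; rewrite !S_INR.
by move: (central_ratio _) => q; eq_in_R; field; lra.
Qed.

(** [c] is 4 for the plain sum and 5 for the sum weighted by the index. *)
Lemma is_lim_weighted_ratio c :
  is_lim_seq (fun n => 8 * (2 * INR n + 1) * (c * INR n + 3) / (3 * (INR n + 1)) * central_ratio n)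
             (16 * c / (3 * PI)).
Proof.
have pi := PI_RGT_0.
have L0 : is_lim_seq (fun n => / INR n) 0.
  have := @is_lim_seq_inv INR p_infty is_lim_seq_INR; exact.
have Lc k l : is_lim_seq (fun n => k + l * / INR n) (k + l * 0).
  apply: is_lim_seq_plus'; first exact: is_lim_seq_const.
  by apply: is_lim_seq_mult' => //; exact: is_lim_seq_const.
have L : is_lim_seq (fun n => (8 / 3) * ((2 + 1 * / INR n) * ((c + 3 * / INR n) * / (1 + 1 * / INR n)))
     * (central_ratio n * INR n)) ((8 / 3) * ((2 + 1 * 0) * ((c + 3 * 0) * / (1 + 1 * 0))) * / PI).
  apply: is_lim_seq_mult'; last exact: is_lim_central_ratio.
  apply: is_lim_seq_mult'; first exact: is_lim_seq_const.
  apply: is_lim_seq_mult' => //; apply: is_lim_seq_mult' => //.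
  apply: (is_lim_seq_inv _ (1 + 1 * 0)) => // -[]; lra.
have -> : 16 * c / (3 * PI) = (8 / 3) * ((2 + 1 * 0) * ((c + 3 * 0) * / (1 + 1 * 0))) * / PI.
  by field; lra.
apply: is_lim_seq_ext_loc L.
exists 1%nat => n hn; have : 1 <= INR n by exact: (le_INR 1).
by move=> h; field; lra.
Qed.

Lemma is_series_tree_rooted :
  is_series (fun n => tree_rooted_coef n * (1 / 16) ^ n) (8 - 64 / (3 * PI)).
Proof.
have pi := PI_RGT_0.
suff : is_lim_seq (sum_n (fun n => tree_rooted_coef n * (1 / 16) ^ n)) (8 - 64 / (3 * PI)) by [].
apply: (is_lim_seq_ext _ _ _ (fun n => esym (sum_tree_rooted n))).
apply: is_lim_seq_minus'; first exact: is_lim_seq_const.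
apply: (proj1 (is_lim_seq_incr_1 (fun n => 8 * (2 * INR n + 1) * (4 * INR n + 3) / (3 * (INR n + 1))
  * central_ratio n) (64 / (3 * PI)))).
have -> : 64 = 16 * 4 by lra.
exact: is_lim_weighted_ratio.
Qed.

Lemma is_series_weighted_tree_rooted :
  is_series (fun n => INR n * (tree_rooted_coef n * (1 / 16) ^ n)) (80 / (3 * PI) - 8).
Proof.
have pi := PI_RGT_0.
suff : is_lim_seq (sum_n (fun n => INR n * (tree_rooted_coef n * (1 / 16) ^ n)))
  (80 / (3 * PI) - 8) by [].
apply: (is_lim_seq_ext _ _ _ (fun n => esym (sum_weighted_tree_rooted n))).
have -> : 80 / (3 * PI) - 8 = -8 + 80 / (3 * PI) by lra.
apply: is_lim_seq_plus'; first exact: is_lim_seq_const.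
apply: (proj1 (is_lim_seq_incr_1 (fun n => 8 * (2 * INR n + 1) * (5 * INR n + 3) / (3 * (INR n + 1))
  * central_ratio n) (80 / (3 * PI)))).
have -> : 80 = 16 * 5 by lra.
exact: is_lim_weighted_ratio.
Qed.

Definition tree_rooted (x : R) : R := PSeries tree_rooted_coef x.
Definition tree_rooted' (x : R) : R := PSeries (PS_derive tree_rooted_coef) x.

Lemma is_pseries_tree_rooted : is_pseries tree_rooted_coef (1 / 16) (8 - 64 / (3 * PI)).
Proof. by apply/is_pseries_R; exact: is_series_tree_rooted. Qed.

Lemma is_pseries_tree_rooted' :
  is_pseries (PS_derive tree_rooted_coef) (1 / 16) (16 * (80 / (3 * PI) - 8)).
Proof.
apply/is_pseries_R.
have h : is_series (fun k => INR k.+1 * (tree_rooted_coef k.+1 * (1 / 16) ^ k.+1))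
    (80 / (3 * PI) - 8).
  apply: (is_series_incr_1 (fun k => INR k * (tree_rooted_coef k * (1 / 16) ^ k))).
  by rewrite /plus /= Rmult_0_l Rplus_0_r; exact: is_series_weighted_tree_rooted.
apply: is_series_ext (is_series_scal_l 16 _ _ h) => n.
by rewrite /PS_derive /scal /= /mult /= -/(INR n.+1); field.
Qed.

(** * The block equation for series *)

Lemma PS_derive_ge0 a n : (forall k, 0 <= a k) -> 0 <= PS_derive a n.
Proof. by move=> a0; apply: Rmult_le_pos => //; exact: pos_INR. Qed.

Lemma INR_sum (F : nat -> nat) n :
  INR (\sum_(k < n.+1) F k)%nat = sum_n (fun k => INR (F k)) n.
Proof.
elim: n => [|n IH]; first by rewrite big_ord_recr big_ord0 sum_O.
by rewrite big_ord_recr plus_INR IH sum_SnR.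
Qed.

Definition conv_coef (k n : nat) : R := INR (conv_pow (fun i => num_balanced (2 * i)) k n).

Lemma is_series_conv k x : 0 <= x -> ex_pseries tree_rooted_coef x ->
  is_series (fun n => conv_coef k n * x ^ n) (tree_rooted x ^ k).
Proof.
move=> x0 ex; have sx := PSeries_correct_R ex.
have absolute (f : nat -> R) l : (forall n, 0 <= f n) -> is_series f l ->
    ex_series (fun n => Rabs (f n)).
  by move=> f0 fl; exists l; apply: is_series_ext fl => n; rewrite Rabs_pos_eq.
elim: k => [|k IH].
  suff : is_lim_seq (sum_n (fun n => conv_coef 0 n * x ^ n)) 1 by [].
  apply: (is_lim_seq_ext (fun _ => 1)); last exact: is_lim_seq_const.
  elim=> [|n IHn]; first by rewrite sum_O /conv_coef /=; eq_in_R; ring.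
  by rewrite sum_SnR -IHn /conv_coef /=; ring.
have pos1 n : 0 <= tree_rooted_coef n * x ^ n.
  by apply: pow_term_ge0 => // m; exact: tree_rooted_coef_ge0.
have pos2 n : 0 <= conv_coef k n * x ^ n by apply: pow_term_ge0 => // m; exact: pos_INR.
have := is_series_mult _ _ _ _ sx IH (absolute _ _ pos1 sx) (absolute _ _ pos2 IH).
apply: is_series_ext => n.
rewrite /conv_coef [conv_pow _ k.+1 n]/=.
rewrite (INR_sum (fun i => num_balanced (2 * i) * conv_pow (fun i => num_balanced (2 * i)) k (n - i))%nat).
rewrite sum_n_Reals Rmult_comm scal_sum.
apply: sum_eq => i /leP le.
rewrite mult_INR -/(conv_coef k (n - i)) -/(tree_rooted_coef i).
have -> : x ^ n = x ^ i * x ^ (n - i) by rewrite -pow_add plusE subnKC.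
by rewrite minusE; ring.
Qed.

Lemma is_series_shift (f : nat -> R) l k : is_series f l ->
  is_series (fun n => if (k <= n)%nat then f (n - k)%nat else 0) l.
Proof.
move=> fl; elim: k => [|k IH].
  by apply: is_series_ext fl => n; rewrite subn0.
apply: is_series_decr_1; rewrite /= opp_zero plus_zero_r.
by apply: is_series_ext IH => n; rewrite ltnS subSS.
Qed.

(** The coefficient of x^n in b_k (x M^2)^k. *)
Definition block_term (n k : nat) : R :=
  if (k <= n)%nat then b_coef k * conv_coef (2 * k) (n - k) else 0.

Lemma b_coef_ge0 k : 0 <= b_coef k.
Proof. exact: pos_INR. Qed.

Lemma block_term_ge0 n k : 0 <= block_term n k.
Proof.
rewrite /block_term; case: ifP => _; last lra.
by apply: Rmult_le_pos; exact: pos_INR.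
Qed.

Lemma tree_rooted_coefE n : tree_rooted_coef n = sum_n (block_term n) n.
Proof.
rewrite /tree_rooted_coef tree_rooted_block_decomposition.
rewrite (INR_sum (fun k => b k * conv_pow (fun i => num_balanced (2 * i)) (2 * k) (n - k))%nat).
rewrite !sum_n_Reals; apply: sum_eq => k /leP le.
by rewrite /block_term le mult_INR.
Qed.

Lemma sum_block_term_ge n K : (n <= K)%nat -> sum_n (block_term n) K = tree_rooted_coef n.
Proof.
elim: K => [|K IH]; first by rewrite leqn0 => /eqP ->; rewrite tree_rooted_coefE.
rewrite leq_eqVlt ltnS => /orP[/eqP ->|le]; first by rewrite tree_rooted_coefE.
rewrite sum_SnR IH // /block_term leqNgt ltnS le /=; ring.
Qed.

Lemma sum_block_term_le n K : sum_n (block_term n) K <= tree_rooted_coef n.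
Proof.
have incr K' : sum_n (block_term n) K <= sum_n (block_term n) (K + K').
  elim: K' => [|K' IH]; first by rewrite addn0; right.
  rewrite addnS; apply: Rle_trans IH _; apply: sum_n_incr => k; exact: block_term_ge0.
by rewrite -(@sum_block_term_ge n (K + n)) ?leq_addl.
Qed.

Definition substitution (x : R) : R := x * tree_rooted x ^ 2.

Lemma is_series_block_term x K : 0 <= x -> ex_pseries tree_rooted_coef x ->
  is_series (fun n => sum_n (block_term n) K * x ^ n)
            (sum_n (fun k => b_coef k * substitution x ^ k) K).
Proof.
move=> x0 ex.
have one k : is_series (fun n => block_term n k * x ^ n) (b_coef k * substitution x ^ k).
  have := is_series_scal_l (b_coef k * x ^ k) _ _
    (@is_series_shift _ _ k (@is_series_conv (2 * k) x x0 ex)).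
  have -> : scal (b_coef k * x ^ k) (tree_rooted x ^ (2 * k)) = b_coef k * substitution x ^ k.
    by rewrite /scal /= /mult /= /substitution Rpow_mult_distr pow_mult; ring.
  apply: is_series_ext => n; rewrite /block_term; case: leqP => le.
    have -> : x ^ n = x ^ k * x ^ (n - k) by rewrite -pow_add plusE subnKC.
    by rewrite /scal /= /mult /=; ring.
  by rewrite /scal /= /mult /=; ring.
elim: K => [|K IH].
  by rewrite sum_O; apply: is_series_ext (one 0%nat) => n; rewrite sum_O.
rewrite sum_SnR; apply: is_series_ext (is_series_plus _ _ _ _ IH (one K.+1)) => n.
by rewrite sum_SnR /plus /=; ring.
Qed.

(* The partial sums of the right-hand side are series in [x] that agree with
   [tree_rooted] up to order [K] and are dominated by it. *)
Lemma block_equation x : 0 <= x -> ex_pseries tree_rooted_coef x ->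
  is_pseries b_coef (substitution x) (tree_rooted x).
Proof.
move=> x0 ex; apply/is_pseries_R; have sx := PSeries_correct_R ex.
suff : is_lim_seq (sum_n (fun k => b_coef k * substitution x ^ k)) (tree_rooted x) by [].
apply: (is_lim_seq_le_le (sum_n (fun n => tree_rooted_coef n * x ^ n)) _
  (fun _ => tree_rooted x)) => [K||]; [|exact: sx|exact: is_lim_seq_const].
have sK := @is_series_block_term x K x0 ex.
split.
  apply: Rle_trans (sum_n_le_series K _ sK); last first.
    move=> k; apply: Rmult_le_pos; last exact: pow_le.
    apply: Rle_trans (block_term_ge0 k 0) _.
    rewrite -(sum_O (block_term k)); elim: K {sK} => [|K IH]; first by right.
    by apply: Rle_trans IH _; apply: sum_n_incr => j; exact: block_term_ge0.
  right; rewrite !sum_n_Reals; apply: sum_eq => n /leP le.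
  by rewrite sum_block_term_ge.
rewrite /tree_rooted -(is_series_unique _ _ sK) -(is_series_unique _ _ sx).
apply: Series_le; last by exists (tree_rooted x).
move=> n; split.
  apply: Rmult_le_pos; last exact: pow_le.
  apply: Rle_trans (block_term_ge0 n 0) _.
  rewrite -(sum_O (block_term n)); elim: K {sK} => [|K IH]; first by right.
  by apply: Rle_trans IH _; apply: sum_n_incr => j; exact: block_term_ge0.
by apply: Rmult_le_compat_r; [exact: pow_le|exact: sum_block_term_le].
Qed.

(** * Numerical bounds *)

Lemma PI_bounds : 31415 / 10000 < PI < 31416 / 10000.
Proof.
(* Truncations of the alternating series for pi / 4 = 2 atan(1/3) + atan(1/7). *)
have := PI_2_3_7_ineq 3.
rewrite /= /tg_alt /PI_2_3_7_tg /Ratan_seq /= ; lra.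
Qed.

Lemma u_C_denominator_gt0 : 0 < 420 * PI - 81 * PI ^ 2 - 512.
Proof. have := PI_bounds; nra. Qed.

Lemma u_C_gt0 : 0 < u_C.
Proof.
have := PI_bounds; have := u_C_denominator_gt0 => d0 pi.
by rewrite /u_C; apply: Rdiv_lt_0_compat => //; nra.
Qed.

(** The denominator is about 8 while [420 * PI] exceeds 1300, so errors on pi are amplified; this
    sets the precision of [PI_bounds]. *)
Lemma u_C_approx : Rabs (u_C - 302 / 100) <= 5 / 1000.
Proof.
have [p1 p2] := PI_bounds; have d0 := u_C_denominator_gt0.
have -> : u_C - 302 / 100 = (9 * PI * (4 - PI) - 302 / 100 * (420 * PI - 81 * PI ^ 2 - 512))
   / (420 * PI - 81 * PI ^ 2 - 512) by rewrite /u_C; field; lra.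
apply: Rabs_le; split.
  apply: (Rmult_le_reg_r _ _ _ d0); rewrite /Rdiv Rmult_assoc Rinv_l; [nra|lra].
apply: (Rmult_le_reg_r _ _ _ d0); rewrite /Rdiv Rmult_assoc Rinv_l; [nra|lra].
Qed.

(** * Transfer from M to B *)

Local Notation rho_M := (1 / 16).

Lemma rho_M_gt0 : 0 < rho_M.
Proof. lra. Qed.

Lemma tree_rooted_coef0 : tree_rooted_coef 0 = 1.
Proof. by rewrite /tree_rooted_coef num_balanced_even /=; field. Qed.

(** The two maps are the loop and the single non-loop edge. A positive linear coefficient makes
    [inv_weight] strictly increasing. *)
Lemma b_coef1 : b_coef 1 = 2.
Proof.
have : tree_rooted_coef 1 = b_coef 1.
  by rewrite tree_rooted_coefE sum_SnR sum_O /block_term /conv_coef /= !big_ord_recr !big_ord0 /=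
    /num_balanced !word_count0 /=; ring.
by move <-; rewrite /tree_rooted_coef num_balanced_even /=; field.
Qed.

Lemma ex_tree_rooted x : 0 <= x <= rho_M -> ex_pseries tree_rooted_coef x.
Proof.
move=> hx; apply: (ex_pseries_le tree_rooted_coef_ge0 hx).
by exists (8 - 64 / (3 * PI)); exact: is_pseries_tree_rooted.
Qed.

Lemma derive_coef_ge0 n : 0 <= PS_derive tree_rooted_coef n.
Proof. apply: PS_derive_ge0; exact: tree_rooted_coef_ge0. Qed.

Lemma derive2_coef_ge0 n : 0 <= PS_derive (PS_derive tree_rooted_coef) n.
Proof. apply: PS_derive_ge0; exact: derive_coef_ge0. Qed.

Lemma ex_tree_rooted' x : 0 <= x <= rho_M -> ex_pseries (PS_derive tree_rooted_coef) x.
Proof.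
move=> hx; apply: (ex_pseries_le derive_coef_ge0 hx).
by exists (16 * (80 / (3 * PI) - 8)); exact: is_pseries_tree_rooted'.
Qed.

Lemma tree_rooted_r : tree_rooted rho_M = 8 - 64 / (3 * PI).
Proof. exact: (is_pseries_unique _ _ _ is_pseries_tree_rooted). Qed.

Lemma tree_rooted'_r : tree_rooted' rho_M = 16 * (80 / (3 * PI) - 8).
Proof. exact: (is_pseries_unique _ _ _ is_pseries_tree_rooted'). Qed.

Lemma tree_rooted_ge1 x : 0 <= x <= rho_M -> 1 <= tree_rooted x.
Proof.
move=> hx; rewrite -tree_rooted_coef0.
apply: (PSeries_ge_head tree_rooted_coef_ge0); [lra|exact: ex_tree_rooted].
Qed.

Lemma tree_rooted_le x : 0 <= x <= rho_M -> tree_rooted x <= tree_rooted rho_M.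
Proof.
by move=> hx; apply: (PSeries_mono tree_rooted_coef_ge0 hx); apply: ex_tree_rooted; lra.
Qed.

Lemma tree_rooted'_ge0 x : 0 <= x <= rho_M -> 0 <= tree_rooted' x.
Proof.
by move=> hx; apply: (PSeries_ge0 derive_coef_ge0); [lra|exact: ex_tree_rooted'].
Qed.

Lemma tree_rooted'_le x : 0 <= x <= rho_M -> tree_rooted' x <= tree_rooted' rho_M.
Proof.
by move=> hx; apply: (PSeries_mono derive_coef_ge0 hx); apply: ex_tree_rooted'; lra.
Qed.

Lemma rho_BE : rho_B = substitution rho_M.
Proof.
have := PI_RGT_0; rewrite /rho_B /substitution tree_rooted_r => pi.
field; lra.
Qed.

Lemma substitution_bounds x : 0 <= x < rho_M -> 0 <= substitution x < rho_B.
Proof.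
move=> hx; have h1 := @tree_rooted_ge1 x ltac:(lra).
have h2 := @tree_rooted_le x ltac:(lra).
rewrite rho_BE /substitution; split; first by apply: Rmult_le_pos; [lra|nra].
have sq : tree_rooted x ^ 2 <= tree_rooted rho_M ^ 2 by apply: pow_incr; lra.
have sq1 : 0 < tree_rooted rho_M ^ 2 by nra.
apply: Rle_lt_trans (_ : x * tree_rooted rho_M ^ 2 < _); first by apply: Rmult_le_compat_l; lra.
by apply: Rmult_lt_compat_r; lra.
Qed.

Lemma rho_B_gt0 : 0 < rho_B.
Proof.
have := @tree_rooted_ge1 rho_M ltac:(lra); rewrite rho_BE /substitution => h.
by apply: Rmult_lt_0_compat; nra.
Qed.

Lemma is_pseries_B_rho : is_pseries b_coef rho_B (tree_rooted rho_M).
Proof. rewrite rho_BE; apply: block_equation; [lra|apply: ex_tree_rooted; lra]. Qed.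

Lemma ex_B y : 0 <= y <= rho_B -> ex_pseries b_coef y.
Proof.
move=> hy; apply: (ex_pseries_le b_coef_ge0 hy).
by exists (tree_rooted rho_M); exact: is_pseries_B_rho.
Qed.

Lemma B_rho : B rho_B = tree_rooted rho_M.
Proof. exact: (is_pseries_unique _ _ _ is_pseries_B_rho). Qed.

Lemma B_substitution x : 0 <= x <= rho_M -> B (substitution x) = tree_rooted x.
Proof.
move=> hx; apply: is_pseries_unique; apply: block_equation; [lra|exact: ex_tree_rooted].
Qed.

Lemma inside_B y : 0 <= y < rho_B -> Rbar_lt (Rabs y) (CV_radius b_coef).
Proof.
move=> hy; apply: (inside_CV_radius rho_B_gt0) => //.
by apply: ex_B; have := rho_B_gt0; lra.
Qed.

Lemma inside_tree_rooted x : 0 <= x < rho_M -> Rbar_lt (Rabs x) (CV_radius tree_rooted_coef).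
Proof.
move=> hx; apply: (inside_CV_radius rho_M_gt0) => //.
by apply: ex_tree_rooted; lra.
Qed.

Definition substitution' (x : R) : R :=
  tree_rooted x ^ 2 + 2 * x * tree_rooted x * tree_rooted' x.

Lemma is_derive_tree_rooted x : 0 <= x < rho_M -> is_derive tree_rooted x (tree_rooted' x).
Proof. by move=> hx; apply: is_derive_PSeries; exact: inside_tree_rooted. Qed.

Lemma is_derive_substitution x : 0 <= x < rho_M ->
  is_derive substitution x (substitution' x).
Proof.
move=> hx; have d := is_derive_tree_rooted hx.
have -> : substitution' x = plus (mult 1 (tree_rooted x ^ 2))
   (mult x (INR 2 * tree_rooted' x * tree_rooted x ^ (Nat.pred 2))).
  by rewrite /substitution' /plus /mult /=; ring.
apply: is_derive_mult; [exact: is_derive_id|exact: is_derive_pow|].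
by move=> n m; exact: Rmult_comm.
Qed.

Lemma near_in_interval x : 0 < x < rho_M -> locally x (fun t => 0 < t < rho_M).
Proof.
move=> hx; have hx' : Rbar_lt 0 x /\ Rbar_lt x rho_M by [].
exact: (open_and _ _ (open_gt 0) (open_lt rho_M) x (conj (proj1 hx) (proj2 hx))).
Qed.

(** The chain rule applied to B(x M^2) = M. That equation is available for nonnegative x only, so a
    neighbourhood of x requires [0 < x]. *)
Lemma B'_substitution x : 0 < x < rho_M ->
  B' (substitution x) * substitution' x = tree_rooted' x.
Proof.
move=> hx; have hx' : 0 <= x < rho_M by lra.
have sb := substitution_bounds hx'.
have dB : is_derive B (substitution x) (B' (substitution x)).
  by apply: is_derive_PSeries; exact: inside_B.
have dc := is_derive_comp _ _ _ _ _ dB (is_derive_substitution hx').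
have dm : is_derive (fun t => B (substitution t)) x (tree_rooted' x).
  apply: is_derive_ext_loc (is_derive_tree_rooted hx').
  apply: filter_imp (near_in_interval hx) => t ht.
  by rewrite B_substitution; lra.
rewrite -(is_derive_unique _ _ _ dm) (is_derive_unique _ _ _ dc).
by rewrite /scal /= /mult /=; ring.
Qed.

Lemma substitution'_ge1 x : 0 <= x <= rho_M -> 1 <= substitution' x.
Proof.
move=> hx; have h1 := tree_rooted_ge1 hx; have h2 := tree_rooted'_ge0 hx.
have h3 : 0 <= x * tree_rooted x * tree_rooted' x.
  by apply: Rmult_le_pos => //; apply: Rmult_le_pos; lra.
rewrite /substitution'; nra.
Qed.

Lemma substitution'_le x : 0 <= x <= rho_M -> substitution' x <= substitution' rho_M.
Proof.
move=> hx; have h1 := tree_rooted_ge1 hx; have h2 := tree_rooted'_ge0 hx.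
have h3 := tree_rooted_le hx; have h4 := tree_rooted'_le hx.
have sq : tree_rooted x ^ 2 <= tree_rooted rho_M ^ 2 by apply: pow_incr; lra.
apply: Rplus_le_compat => //; apply: Rmult_le_compat => //.
  by apply: Rmult_le_pos; lra.
by apply: Rmult_le_compat; lra.
Qed.

Lemma filterlim_mult_R (F : (R -> Prop) -> Prop) {FF : Filter F} (f g : R -> R) l l' :
  filterlim f F (locally l) -> filterlim g F (locally l') ->
  filterlim (fun x => f x * g x) F (locally (l * l')).
Proof. by move=> fl gl; apply: filterlim_comp_2 fl gl _; exact: (filterlim_mult l l'). Qed.

Lemma filterlim_plus_R (F : (R -> Prop) -> Prop) {FF : Filter F} (f g : R -> R) l l' :
  filterlim f F (locally l) -> filterlim g F (locally l') ->
  filterlim (fun x => f x + g x) F (locally (l + l')).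
Proof. by move=> fl gl; apply: filterlim_comp_2 fl gl _; exact: (filterlim_plus l l'). Qed.

Lemma filterlim_id_at_left x : filterlim (fun y : R => y) (at_left x) (locally x).
Proof. exact: filter_le_within. Qed.

Lemma tree_rooted_at_left : filterlim tree_rooted (at_left rho_M) (locally (tree_rooted rho_M)).
Proof.
by apply: (PSeries_at_left tree_rooted_coef_ge0 rho_M_gt0); apply: ex_tree_rooted; lra.
Qed.

Lemma tree_rooted'_at_left : filterlim tree_rooted' (at_left rho_M) (locally (tree_rooted' rho_M)).
Proof.
by apply: (PSeries_at_left derive_coef_ge0 rho_M_gt0); apply: ex_tree_rooted'; lra.
Qed.

(** The target is [at_left rho_B] and not just [locally rho_B], so that left limits at [rho_B] can
    be composed with it. *)
Lemma substitution_at_left : filterlim substitution (at_left rho_M) (at_left rho_B).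
Proof.
have L : filterlim substitution (at_left rho_M) (locally rho_B).
  rewrite rho_BE; apply: filterlim_mult_R; first exact: filterlim_id_at_left.
  apply: (@filterlim_mult_R _ _ tree_rooted (fun x => tree_rooted x * 1)); first exact: tree_rooted_at_left.
  apply: filterlim_mult_R; [exact: tree_rooted_at_left|exact: filterlim_const].
move=> P [eps hP].
have := L (ball rho_B eps) (locally_ball _ _).
rewrite /filtermap => near.
apply: filter_imp (filter_and _ _ (at_left_between rho_M_gt0) near) => x [hx bx].
apply: hP => //.
by have [] := @substitution_bounds x ltac:(lra).
Qed.

Lemma substitution'_at_left :
  filterlim substitution' (at_left rho_M) (locally (substitution' rho_M)).
Proof.
apply: filterlim_plus_R.
  apply: (@filterlim_mult_R _ _ tree_rooted (fun x => tree_rooted x * 1)); first exact: tree_rooted_at_left.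
  apply: filterlim_mult_R; [exact: tree_rooted_at_left|exact: filterlim_const].
apply: filterlim_mult_R; last exact: tree_rooted'_at_left.
apply: filterlim_mult_R; last exact: tree_rooted_at_left.
apply: filterlim_mult_R; [exact: filterlim_const|exact: filterlim_id_at_left].
Qed.

Lemma derive_b_ge0 n : 0 <= PS_derive b_coef n.
Proof. apply: PS_derive_ge0; exact: b_coef_ge0. Qed.

Lemma ex_B'_inside y : 0 <= y < rho_B -> ex_pseries (PS_derive b_coef) y.
Proof. by move=> hy; apply: ex_pseries_derive; exact: inside_B. Qed.

Lemma substitution_above y : y < rho_B -> exists2 x, 0 < x < rho_M & y < substitution x.
Proof.
move=> hy.
have h : at_left rho_B (fun z => y < z < rho_B) by exact: at_left_between.
have near := substitution_at_left h.
have [x [hx [hs _]]] : exists x, 0 < x < rho_M /\ y < substitution x < rho_B.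
  exact: filter_ex (filter_and _ _ (at_left_between rho_M_gt0) near).
by exists x.
Qed.

(** With H = x M^2, the interior identity B'(H) H' = M' and H' >= 1 keep B' below M'(1/16), and H
    takes values arbitrarily close to [rho_B]. *)
Lemma ex_B' : ex_pseries (PS_derive b_coef) rho_B.
Proof.
apply: (proj1 (@ex_pseries_of_bounded _ derive_b_ge0 _ rho_B_gt0 (tree_rooted' rho_M) _)).
move=> y hy; have ey : ex_pseries (PS_derive b_coef) y by apply: ex_B'_inside; lra.
split=> //.
have [x hx lt] := substitution_above (proj2 hy).
have sb := @substitution_bounds x ltac:(lra).
apply: Rle_trans (PSeries_mono derive_b_ge0 _ (ex_B'_inside sb)) _; first by lra.
have E := B'_substitution hx.
have s1 := @substitution'_ge1 x ltac:(lra).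
have d1 := @tree_rooted'_le x ltac:(lra).
have b0 : 0 <= B' (substitution x).
  by apply: (PSeries_ge0 derive_b_ge0); [lra|exact: ex_B'_inside].
rewrite -/(B' (substitution x)); nra.
Qed.

(** At the endpoint the chain rule is replaced by a passage to the left limit. *)
Lemma B'_rho : B' rho_B * substitution' rho_M = tree_rooted' rho_M.
Proof.
have L1 : filterlim (fun x => B' (substitution x) * substitution' x) (at_left rho_M)
    (locally (B' rho_B * substitution' rho_M)).
  apply: filterlim_mult_R; last exact: substitution'_at_left.
  apply: filterlim_comp substitution_at_left _.
  exact: (PSeries_at_left derive_b_ge0 rho_B_gt0 ex_B').
have L2 : filterlim (fun x => B' (substitution x) * substitution' x) (at_left rho_M)
    (locally (tree_rooted' rho_M)).
  apply: filterlim_ext_loc tree_rooted'_at_left.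
  apply: filter_imp (at_left_between rho_M_gt0) => x hx.
  by rewrite B'_substitution.
exact: (filterlim_locally_unique _ _ _ L1 L2).
Qed.

(** * The radius of convergence of B *)

Lemma derive2_term_ge n :
  / (INR n + 1) <= PS_derive (PS_derive tree_rooted_coef) n * rho_M ^ n.
Proof.
have n0 := pos_INR n; have [p1 p2] := PI_bounds.
(* Cat_n Cat_(n+1) / 16^n decays like n^(-3) and two derivatives bring back n^2, so the terms are of
   harmonic size; the constant 1 is far from optimal. *)
have -> : PS_derive (PS_derive tree_rooted_coef) n * rho_M ^ n =
   256 * ((INR n + 1) * (INR n + 2)) * (tree_rooted_coef n.+2 * rho_M ^ n.+2).
  by rewrite /PS_derive -[rho_M ^ n.+2]/(rho_M * (rho_M * rho_M ^ n)) !S_INR; field.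
rewrite tree_rooted_term.
have [q _] := central_ratio_bounds n.+2.
have E2 : INR n.+2 = INR n + 2 by rewrite !S_INR; ring.
rewrite E2 in q *; move: (central_ratio n.+2) q => Q q.
move: (INR n) n0 q {E2} => x x0 q.
(* The crude bound [PI < 4] is enough here. *)
have q2 : / (2 * (2 * (x + 2) + 1)) <= Q.
  apply: Rle_trans q; rewrite /Rdiv.
  have -> : / (2 * (2 * (x + 2) + 1)) = 2 * / (4 * (2 * (x + 2) + 1)) by field; lra.
  apply: Rmult_le_compat_l; first lra.
  apply: Rinv_le_contravar; first by apply: Rmult_lt_0_compat; lra.
  by apply: Rmult_le_compat_r; lra.
have d0 : 0 < (x + 2 + 1) ^ 2 * (x + 2 + 2) by apply: Rmult_lt_0_compat; nra.
apply: (Rle_trans _ (256 * ((x + 1) * (x + 2)) * (/ (2 * (2 * (x + 2) + 1)) *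
   (2 * (2 * (x + 2) + 1) / ((x + 2 + 1) ^ 2 * (x + 2 + 2)))))).
  have -> : 256 * ((x + 1) * (x + 2)) * (/ (2 * (2 * (x + 2) + 1)) *
   (2 * (2 * (x + 2) + 1) / ((x + 2 + 1) ^ 2 * (x + 2 + 2)))) =
   / (x + 1) * (256 * (x + 1) ^ 2 * (x + 2) / ((x + 2 + 1) ^ 2 * (x + 2 + 2))).
    by field; lra.
  rewrite -[X in X <= _]Rmult_1_r; apply: Rmult_le_compat_l.
    by left; apply: Rinv_0_lt_compat; lra.
  apply: (Rmult_le_reg_r _ _ _ d0).
  rewrite /Rdiv Rmult_assoc Rinv_l; last lra.
  nra.
apply: Rmult_le_compat_l; first by apply: Rmult_le_pos; [lra|nra].
apply: Rmult_le_compat_r => //; left; apply: Rdiv_lt_0_compat => //; lra.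
Qed.

Lemma sum_inv_ge_ln n : ln (INR n + 2) - ln 1 <= sum_n (fun k => / (INR k + 1)) n.
Proof.
have step x : 1 <= x -> ln (x + 1) - ln x <= / x.
  move=> x1; rewrite -ln_div; [|lra|lra].
  have -> : (x + 1) / x = 1 + / x by field; lra.
  have x0 : 0 < / x by apply: Rinv_0_lt_compat; lra.
  rewrite -[X in _ <= X]ln_exp; left; apply: ln_increasing; first lra.
  apply: exp_ineq1; lra.
elim: n => [|n IH].
  by rewrite sum_O /=; have := step 1 ltac:(lra); rewrite (_ : 0 + 2 = 1 + 1) ?Rplus_0_l; lra.
rewrite sum_SnR S_INR; have n0 := pos_INR n.
have := step (INR n + 2) ltac:(lra).
have -> : INR n + 1 + 2 = INR n + 2 + 1 by ring.
have -> : INR n + 1 + 1 = INR n + 2 by ring.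
lra.
Qed.

Lemma not_ex_derive2 : ~ ex_pseries (PS_derive (PS_derive tree_rooted_coef)) rho_M.
Proof.
move=> ex; have s := PSeries_correct_R ex.
set S := PSeries _ _ in s.
have bound n : ln (INR n + 2) <= S.
  have := sum_inv_ge_ln n; rewrite ln_1 Rminus_0_r => h; apply: Rle_trans h _.
  apply: Rle_trans (sum_n_le_series n _ s); last first.
    by move=> k; apply: pow_term_ge0; [exact: derive2_coef_ge0|lra].
  by rewrite !sum_n_Reals; apply: sum_Rle => k _; exact: derive2_term_ge.
have [n hn] := INR_unbounded (exp S).
have := bound n; apply: Rlt_not_le; rewrite -[X in X < _]ln_exp.
apply: ln_increasing; first exact: exp_pos.
lra.
Qed.

(* Differentiating B'(H) H' = M' once more gives
   M^2 M'' = H'^3 B''(H) + M' (4 M M' + 2 x M'^2), which bounds M''. *)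
Lemma bounded_derive2 :
  Rbar_lt rho_B (CV_radius b_coef) -> ex_pseries (PS_derive (PS_derive tree_rooted_coef)) rho_M.
Proof.
move=> lt.
pose g := PSeries (PS_derive (PS_derive b_coef)).
have rho0 := rho_B_gt0.
have dd0 n : 0 <= PS_derive (PS_derive b_coef) n by apply: PS_derive_ge0; exact: derive_b_ge0.
have inside y : 0 <= y <= rho_B -> Rbar_lt (Rabs y) (CV_radius (PS_derive b_coef)).
  move=> hy; rewrite CV_radius_derive; apply: Rbar_le_lt_trans lt.
  by rewrite Rabs_pos_eq /=; lra.
have exg y : 0 <= y <= rho_B -> ex_pseries (PS_derive (PS_derive b_coef)) y.
  by move=> hy; apply: ex_pseries_derive; exact: inside.
pose m := tree_rooted rho_M; pose d := tree_rooted' rho_M; pose s := substitution' rho_M.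
(* The bound takes every function in that formula at its endpoint and replaces the factor x by 1;
   the division by M^2 only helps, since M >= 1. *)
apply: (proj1 (@ex_pseries_of_bounded _ derive2_coef_ge0 _ rho_M_gt0
  (g rho_B * s ^ 3 + d * (4 * m * d + 2 * d ^ 2)) _)) => x hx.
have hx' : 0 <= x < rho_M by lra.
have hx'' : 0 <= x <= rho_M by lra.
have ins' : Rbar_lt (Rabs x) (CV_radius (PS_derive tree_rooted_coef)).
  by rewrite CV_radius_derive; exact: inside_tree_rooted.
have ex2 : ex_pseries (PS_derive (PS_derive tree_rooted_coef)) x by exact: ex_pseries_derive.
split=> //.
set e := PSeries _ x.
have e0 : 0 <= e by apply: (PSeries_ge0 derive2_coef_ge0); [lra|].
have sb := substitution_bounds hx'.
have de : is_derive tree_rooted' x e by exact: is_derive_PSeries.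
have dm := is_derive_tree_rooted hx'.
have ds : is_derive substitution' x (2 * tree_rooted x * tree_rooted' x +
    (2 * tree_rooted x * tree_rooted' x + 2 * x * tree_rooted' x ^ 2 + 2 * x * tree_rooted x * e)).
  rewrite /substitution'.
  auto_derive; first by split; [exists (tree_rooted' x)|
    split; [exists (tree_rooted' x)|split; [exists e|]]].
  have -> : Derive [eta tree_rooted] x = tree_rooted' x by exact: is_derive_unique.
  have -> : Derive [eta tree_rooted'] x = e by exact: is_derive_unique.
  ring.
have E := B'_substitution hx.
have dB' : is_derive B' (substitution x) (g (substitution x)).
  by apply: is_derive_PSeries; apply: inside; lra.
have dc := is_derive_comp _ _ _ _ _ dB' (is_derive_substitution hx').
have dp := is_derive_mult _ _ _ _ _ dc ds (fun n m => Rmult_comm n m).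
have dp' : is_derive (fun t => mult (B' (substitution t)) (substitution' t)) x e.
  apply: is_derive_ext_loc de; apply: filter_imp (near_in_interval hx) => t ht.
  by rewrite /mult /= B'_substitution.
have := is_derive_unique _ _ _ dp'; rewrite (is_derive_unique _ _ _ dp).
rewrite /plus /mult /scal /= /mult /= => {dp dp' dc ds dB'} Ee.
have h1 := tree_rooted_ge1 hx''; have h2 := tree_rooted'_ge0 hx''.
have h3 := tree_rooted_le hx''; have h4 := tree_rooted'_le hx''.
have h5 := substitution'_ge1 hx''; have h6 := substitution'_le hx''.
have g1 : 0 <= g (substitution x) by apply: (PSeries_ge0 dd0); [lra|apply: exg; lra].
have g2 : g (substitution x) <= g rho_B by apply: (PSeries_mono dd0); [lra|apply: exg; lra].
have sE : substitution' x = tree_rooted x ^ 2 + 2 * x * tree_rooted x * tree_rooted' x by [].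
move: (g (substitution x)) (g rho_B) (B' (substitution x)) E Ee g1 g2 => G Gr b E Ee g1 g2.
rewrite -/m -/d -/s in h3 h4 h6.
move: (tree_rooted x) (tree_rooted' x) (substitution' x) h1 h2 h3 h4 h5 h6 sE E Ee
  => mx dx sx h1 h2 h3 h4 h5 h6 sE E Ee.
have key : e * mx ^ 2 = G * sx ^ 3 + dx * (4 * mx * dx + 2 * x * dx ^ 2).
  have Es : e * sx = G * sx ^ 3 + dx * (4 * mx * dx + 2 * x * dx ^ 2) + 2 * x * mx * dx * e.
    transitivity (G * sx ^ 3 + (b * sx) * (4 * mx * dx + 2 * x * dx ^ 2 + 2 * x * mx * e)).
      by rewrite -{1}Ee; ring.
    by rewrite E; ring.
  have -> : mx ^ 2 = sx - 2 * x * mx * dx by lra.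
  by rewrite Rmult_minus_distr_l Es; ring.
have m2 : 1 <= mx ^ 2 by nra.
have le1 : e <= e * mx ^ 2 by rewrite -{1}[e]Rmult_1_r; apply: Rmult_le_compat_l.
apply: Rle_trans le1 _; rewrite key; apply: Rplus_le_compat.
  by apply: Rmult_le_compat => //; [apply: pow_le; lra|apply: pow_incr; lra].
have md0 : 0 <= mx * dx by apply: Rmult_le_pos; lra.
have md1 : mx * dx <= m * d by apply: Rmult_le_compat; lra.
have dd1 : dx ^ 2 <= d ^ 2 by apply: pow_incr; lra.
have dd2 : 0 <= dx ^ 2 by apply: pow_le.
have xd0 : 0 <= x * dx ^ 2 by apply: Rmult_le_pos; lra.
have xd1 : x * dx ^ 2 <= 1 * d ^ 2 by apply: Rmult_le_compat; lra.
apply: Rmult_le_compat; [lra| |lra|].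
  have -> : 4 * mx * dx + 2 * x * dx ^ 2 = 4 * (mx * dx) + 2 * (x * dx ^ 2) by ring.
  lra.
have -> : 4 * mx * dx + 2 * x * dx ^ 2 = 4 * (mx * dx) + 2 * (x * dx ^ 2) by ring.
have -> : 4 * m * d = 4 * (m * d) by ring.
lra.
Qed.

Lemma CV_radius_b_coef : CV_radius b_coef = Finite rho_B.
Proof.
apply: Rbar_le_antisym.
  by apply: Rbar_not_lt_le => /bounded_derive2; exact: not_ex_derive2.
apply: (CV_radius_ge rho_B_gt0); apply: ex_B; have := rho_B_gt0; lra.
Qed.

(** * The factor of u in the equation *)

Definition inv_weight_coef (n : nat) : R := if n is O then 0 else (2 * INR n - 1) * b_coef n.

Lemma inv_weight_coef_ge0 n : 0 <= inv_weight_coef n.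
Proof.
case: n => [|n]; first by right.
apply: Rmult_le_pos; last exact: b_coef_ge0.
by rewrite S_INR; have := pos_INR n; lra.
Qed.

(** The constant term is -b_0 + 1 = 0, whence the separate first coefficient. *)
Lemma is_pseries_inv_weight y : 0 <= y <= rho_B ->
  is_pseries inv_weight_coef y (2 * y * B' y - B y + 1).
Proof.
move=> hy; apply/is_pseries_R.
have sB := PSeries_correct_R (ex_B hy).
have sB' := PSeries_correct_R (ex_pseries_le derive_b_ge0 hy ex_B').
apply: is_series_decr_1.
have t1 := is_series_scal_l (2 * y) _ _ sB'.
have t2 : is_series (fun k => b_coef k.+1 * y ^ k.+1) (B y - 1).
  apply: (is_series_incr_1 (fun k => b_coef k * y ^ k)).
  by rewrite /plus /b_coef /= Rmult_1_r; have -> : B y - 1 + 1 = B y by ring.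
have t := is_series_minus _ _ _ _ t1 t2.
have -> : plus (2 * y * B' y - B y + 1) (opp (inv_weight_coef 0 * y ^ 0)) =
    plus (scal (2 * y) (PSeries (PS_derive b_coef) y)) (opp (B y - 1)).
  by rewrite /plus /opp /scal /= /mult /= /B'; ring.
apply: is_series_ext t => n.
rewrite /plus /opp /scal /= /mult /= /PS_derive /inv_weight_coef -/(INR n.+1).
by ring.
Qed.

Definition inv_weight (y : R) : R := PSeries inv_weight_coef y.

Lemma inv_weightE y : 0 <= y <= rho_B -> inv_weight y = 2 * y * B' y - B y + 1.
Proof. by move=> hy; apply: is_pseries_unique; exact: is_pseries_inv_weight. Qed.

Lemma ex_inv_weight y : 0 <= y <= rho_B -> ex_pseries inv_weight_coef y.
Proof. by move=> hy; exists (2 * y * B' y - B y + 1); exact: is_pseries_inv_weight. Qed.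

(** The linear coefficient is 2 and the others are nonnegative, so the values differ by at least 2
    (y2 - y1). *)
Lemma inv_weight_lt y1 y2 : 0 <= y1 < y2 -> y2 <= rho_B -> inv_weight y1 < inv_weight y2.
Proof.
move=> hy h2.
have s1 := PSeries_correct_R (@ex_inv_weight y1 ltac:(lra)).
have s2 := PSeries_correct_R (@ex_inv_weight y2 ltac:(lra)).
have s := is_series_minus _ _ _ _ s2 s1.
have := sum_n_le_series 1 _ s; rewrite sum_SnR sum_O.
rewrite /plus /opp /= b_coef1 => h.
suff : 0 < inv_weight y2 - inv_weight y1 by lra.
apply: Rlt_le_trans (h _); first by lra.
move=> k; have := pow_incr y1 y2 k ltac:(lra).
by have := inv_weight_coef_ge0 k; nra.
Qed.

Lemma inv_weight_rho : inv_weight rho_B = / u_C.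
Proof.
have rho0 := rho_B_gt0; have [p1 p2] := PI_bounds; have d0 := u_C_denominator_gt0.
rewrite inv_weightE ?B_rho; last by lra.
have s1 := @substitution'_ge1 rho_M ltac:(lra).
have -> : B' rho_B = tree_rooted' rho_M / substitution' rho_M by rewrite -B'_rho; field; lra.
have m1 := @tree_rooted_ge1 rho_M ltac:(lra).
have -> : rho_B = substitution rho_M by exact: rho_BE.
rewrite /substitution /substitution' /u_C in s1 *.
(* At 1/16 the derivative of x M^2 is M (M + 2 x M'); its second factor is the source of [4 - PI] in
   [u_C]. *)
have e : 2 * rho_M * tree_rooted' rho_M + tree_rooted rho_M = 8 * (4 - PI) / PI.
  by rewrite tree_rooted'_r tree_rooted_r; field; lra.
have -> : tree_rooted rho_M ^ 2 + 2 * rho_M * tree_rooted rho_M * tree_rooted' rho_M =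
  tree_rooted rho_M * (8 * (4 - PI) / PI) by rewrite -e; ring.
rewrite tree_rooted'_r tree_rooted_r in m1 *.
field; do !split; try lra.
Qed.

(** [IVT_interv] needs two-sided continuity and so cannot be used up to [rho_B]; the left limit
    supplies a point [y1] below [rho_B] whose value already exceeds [v]. The extreme value of [v] is
    attained at [rho_B] itself. *)
Lemma inv_weight_solution v : 0 < v <= / u_C -> exists2 y, 0 <= y <= rho_B & inv_weight y = v.
Proof.
rewrite -inv_weight_rho => -[v0 [lt|->]]; have rho0 := rho_B_gt0; last first.
  by exists rho_B => //; lra.
have ew : ex_pseries inv_weight_coef rho_B by apply: ex_inv_weight; lra.
have L := PSeries_at_left inv_weight_coef_ge0 rho_B_gt0 ew.
have near : at_left rho_B (fun y => v < inv_weight y).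
  have [eps He] : exists eps : posreal, forall y, ball (inv_weight rho_B) eps y -> v < y.
    have e0 : 0 < inv_weight rho_B - v by lra.
    exists (mkposreal _ e0) => y.
    rewrite /ball /= /AbsRing_ball /abs /minus /plus /opp /= => /Rabs_def2; lra.
  by apply: filter_imp (L _ (locally_ball _ eps)) => y; exact: He.
have [y1 [hy1 vy1]] : exists y, 0 < y < rho_B /\ v < inv_weight y.
  exact: filter_ex (filter_and _ _ (at_left_between rho0) near).
have b0 : inv_weight 0 = 0.
  by rewrite inv_weightE; [rewrite /B PSeries_0 /b_coef /=; ring|lra].
have [||||y [hy Ey]] := IVT_interv (fun y => inv_weight y - v) 0 y1.
- move=> a ha; apply: continuity_pt_minus; last exact: continuity_pt_const.
  by apply: PSeries_continuity; apply: (inside_CV_radius rho0 ew); lra.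
- lra.
- rewrite b0; lra.
- lra.
by exists y; lra.
Qed.

Lemma B_ge1 y : 0 <= y <= rho_B -> 1 <= B y.
Proof.
by move=> hy; apply: (PSeries_ge_head b_coef_ge0); [lra|exact: ex_B].
Qed.

(** Since B >= 1, the denominator u (B - 1) + 1 is positive and can be cleared. *)
Lemma equation_inv_weight u y : 0 <= u -> 0 <= y <= rho_B ->
  2 * y * u * B' y / (u * B y + 1 - u) = 1 <-> u * inv_weight y = 1.
Proof.
move=> u0 hy; have b1 := B_ge1 hy; rewrite (inv_weightE hy).
have d0 : 0 < u * B y + 1 - u by nra.
split=> E.
  have : 2 * y * u * B' y = u * B y + 1 - u.
    rewrite -[RHS]Rmult_1_l -{1}E; move: (u * B y + 1 - u) d0 => D d0.
    by field; lra.
  by lra.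
have -> : 2 * y * u * B' y = u * B y + 1 - u by lra.
by field; lra.
Qed.

Theorem proposition8 :
  CV_radius b_coef = Finite rho_B /\
  ex_pseries b_coef rho_B /\
  ex_pseries (PS_derive b_coef) rho_B /\
  Rabs (u_C - 302 / 100) <= 5 / 1000 /\
  forall u : R, 0 <= u ->
    ((exists! y : R, 0 <= y <= rho_B /\
        2 * y * u * B' y / (u * B y + 1 - u) = 1)
     <-> u_C <= u).
Proof.
have rho0 := rho_B_gt0; have uC0 := u_C_gt0.
split; first exact: CV_radius_b_coef.
split; first by apply: ex_B; lra.
split; first exact: ex_B'.
split; first exact: u_C_approx.
move=> u u0; split=> [[y [[hy /(equation_inv_weight u0 hy) E] _]]|uu].
  have le : inv_weight y <= / u_C.
    rewrite -inv_weight_rho; case: (Rle_lt_or_eq_dec y rho_B (proj2 hy)) => [lt|->]; last by right.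
    by left; apply: inv_weight_lt; lra.
  have h := Rmult_le_compat_l u _ _ u0 le; rewrite E in h.
  have := Rmult_le_compat_r u_C _ _ (Rlt_le _ _ uC0) h.
  rewrite Rmult_assoc Rinv_l; lra.
have u1 : 0 < u by lra.
have hv : 0 < / u <= / u_C.
  by split; [exact: Rinv_0_lt_compat|exact: Rinv_le_contravar].
have [y hy Ey] := inv_weight_solution hv.
exists y; split.
  by split=> //; apply/(equation_inv_weight u0 hy); rewrite Ey; field; lra.
move=> z [hz /(equation_inv_weight u0 hz) Ez].
have Ez' : inv_weight z = inv_weight y by rewrite Ey -[inv_weight z]Rmult_1_l -{1}(Rinv_l u) ?Rmult_assoc ?Ez; lra.
case: (Rtotal_order y z) => [lt|[//|gt]].
  by have := @inv_weight_lt y z ltac:(lra) ltac:(lra); lra.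
by have := @inv_weight_lt z y ltac:(lra) ltac:(lra); lra.
Qed.
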